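(* Let $d\ge 1$, $\beta>0$, and let $U\in C^4(\mathbb{R}^d)$, $b:=-\nabla U$, satisfy: there are $M_0>0$, $\kappa>0$ with $\nabla^2U(x)\succeq\kappa I$ whenever $|x|\ge M_0$; there is $L>0$ with $|b(x)-b(y)|\le L|x-y|$ for all $x,y\in\mathbb{R}^d$; and all second and third order partial derivatives of $b$ are bounded. Let $\rho_0$ be a positive (twice differentiable) probability density on $\mathbb{R}^d$ such that, for some constants $A_0,A_1,c_0,\delta,p_0,q,C_0>0$ and $M_1\ge\|\rho_0\|_\infty$, for all $x$, $$A_0e^{-c_0|x|^{p_0}}\le\rho_0(x)\le A_1e^{-\delta\beta U(x)},\quad |\nabla\log\rho_0(x)|\le C_0\bigl(1-\log(\rho_0(x)/M_1)\bigr),\quad \|\nabla^2\log\rho_0(x)\|\le C_0(1+|x|^q).$$ Let $\bar\rho(t)$ be the averaged interpolated density of the random splitting Langevin Monte Carlo with step size $\tau\in(0,1]$ and initial density $\rho_0$. Then for any $T>0$ there exist $p>0$ and $C(T)>0$, not depending on $\tau$, such that for all $x\in\mathbb{R}^d$ $$\sup_{t\le T}\Bigl(|\log\bar\rho(t,x)|+|\nabla\log\bar\rho(t,x)|+|\nabla^2\log\bar\rho(t,x)|\Bigr)\le C(T)(1+|x|)^p.$$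
   Context: Let $\phi_t$ be the flow of $\dot x=b(x)$, $\phi_0(x)=x$, and $J(t,x)=\det\nabla_x\phi_t(x)$. Define $\mathcal{L}_1\rho=-\nabla\cdot(b\rho)$ and $\mathcal{L}_2\rho=\beta^{-1}\Delta\rho$, with semigroups $e^{t\mathcal{L}_1}\rho(x)=\rho(\phi_{-t}(x))J(-t,x)$ and $e^{t\mathcal{L}_2}\rho(x)=\int(4\pi\beta^{-1}t)^{-d/2}e^{-\beta|x-y|^2/(4t)}\rho(y)\,dy$. The random splitting Langevin Monte Carlo with step size $\tau$ applies, at each step and with probability $1/2$ each (independently over steps), either advection by $\phi_\tau$ followed by the addition of $\sqrt{2\beta^{-1}\tau}\,\mathcal{N}(0,I_d)$ noise, or the same two operations in the reverse order. Its law $\bar\rho_n$ at step $n$ satisfies $\bar\rho_0=\rho_0$, $\bar\rho_{n+1}=\tfrac12\bigl(e^{\tau\mathcal{L}_1}e^{\tau\mathcal{L}_2}+e^{\tau\mathcal{L}_2}e^{\tau\mathcal{L}_1}\bigr)\bar\rho_n$. The averaged interpolated density is, for $t\in[n\tau,(n+1)\tau]$ and $s=t-n\tau$, $\bar\rho(t)=\tfrac12\bigl(e^{s\mathcal{L}_1}e^{s\mathcal{L}_2}+e^{s\mathcal{L}_2}e^{s\mathcal{L}_1}\bigr)\bar\rho_n$. *)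

(* Defs.v *)
From HB Require Import structures.
From mathcomp Require Import all_boot all_order all_algebra.
From mathcomp Require Import all_classical all_reals all_analysis.

Set Implicit Arguments.
Unset Strict Implicit.
Unset Printing Implicit Defensive.
Import Order.TTheory GRing.Theory Num.Theory.
Import numFieldNormedType.Exports.
Local Open Scope classical_set_scope.
Local Open Scope ring_scope.

(* Lebesgue measure on R^n, obtained by iterating the binary product measure
   on n-tuples (which carry the product sigma-algebra). *)
Section LebesgueTuple.
Context {R : realType}.
Local Notation mR := (measurableTypeR R).

Definition tuple_cons n (p : mR * n.-tuple mR) : n.+1.-tuple mR :=
  [the n.+1.-tuple mR of p.1 :: p.2].

Lemma measurable_tuple_cons n : measurable_fun setT (@tuple_cons n).
Proof. exact: measurable_cons measurable_fst measurable_snd. Qed.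

Section step.
Context n (mu : {sigma_finite_measure set (n.-tuple mR) -> \bar R}).

Definition lebesgue_step : set (n.+1.-tuple mR) -> \bar R :=
  pushforward (lebesgue_measure \x mu)%E (@tuple_cons n).

Let step0 : lebesgue_step set0 = 0%E.
Proof.
by rewrite /lebesgue_step; apply: measure0; exact: measurable_tuple_cons.
Qed.

Let step_ge0 A : (0 <= lebesgue_step A)%E.
Proof.
by rewrite /lebesgue_step; apply: measure_ge0; exact: measurable_tuple_cons.
Qed.

Let step_sigma_additive : semi_sigma_additive lebesgue_step.
Proof.
rewrite /lebesgue_step.
apply: measure_semi_sigma_additive; exact: measurable_tuple_cons.
Qed.

HB.instance Definition _ := isMeasure.Build _ _ _ lebesgue_step
  step0 step_ge0 step_sigma_additive.

(* The canonical sigma-finite structure inferred for a product measure is the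
   one of subprobabilities, hence the direct proof. *)
Let step_sigma_finite : sigma_finite setT lebesgue_step.
Proof.
have /sigma_finiteP[F [TF ndF Foo]] := sigma_finiteT (@lebesgue_measure R).
have /sigma_finiteP[G [TG ndG Goo]] := sigma_finiteT mu.
pose uncons (t : n.+1.-tuple mR) : mR * n.-tuple mR :=
  (thead t, [tuple of behead t]).
have tuple_consK : cancel (@tuple_cons n) uncons.
  by move=> [x t]; congr pair; apply/val_inj.
have muncons : measurable_fun setT uncons.
  apply/measurable_fun_pairP; split; first exact: measurable_tnth.
  exact: measurable_behead.
exists (fun k => uncons @^-1` (F k `*` G k)).
  rewrite -preimage_bigcup -(preimage_setT uncons) -setXTT TF TG.
  congr (_ @^-1` _); apply/seteqP; split => -[x y] /=.
    move=> [[i _ Fix] [j _ Gjy]]; exists (maxn i j) => //; split.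
      by move: Fix; exact/subsetPset/ndF/leq_maxl.
    by move: Gjy; exact/subsetPset/ndG/leq_maxr.
  by move=> [i _ [? ?]]; split; exists i.
move=> k; have [mFk Fkoo] := Foo k; have [mGk Gkoo] := Goo k; split.
  by rewrite -[X in measurable X]setTI; apply: muncons => //; exact: measurableX.
rewrite /lebesgue_step /pushforward -comp_preimage.
rewrite (_ : uncons \o _ = id); last by apply/funext => p /=; rewrite tuple_consK.
by rewrite preimage_id product_measure1E// lte_mul_pinfty// ge0_fin_numE.
Qed.

HB.instance Definition _ := Measure_isSigmaFinite.Build _ _ _ lebesgue_step
  step_sigma_finite.

End step.

Fixpoint lebesgue_tuple n : {sigma_finite_measure set (n.-tuple mR) -> \bar R} :=
  match n with
  | 0 => [the {sigma_finite_measure set _ -> \bar R} of \d_([tuple] : 0.-tuple mR)]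
  | n'.+1 => [the {sigma_finite_measure set _ -> \bar R} of lebesgue_step (lebesgue_tuple n')]
  end.

Lemma lebesgue_tuple_box n (A : 'I_n -> set mR) :
  (forall i, measurable (A i)) ->
  lebesgue_tuple n [set t | forall i, A i (tnth t i)] =
  (\prod_(i < n) lebesgue_measure (A i))%E.
Proof.
elim: n A => [A _|n IHn A mA].
  by rewrite big_ord0 /= diracE mem_set// => -[].
rewrite big_ord_recl/= -IHn; last by move=> i; exact: mA.
rewrite /lebesgue_step /pushforward -product_measure1E//; last first.
  rewrite (_ : [set t | _] =
      \bigcap_(i in setT) ((@tnth n mR) ^~ i @^-1` A (lift ord0 i))).
    apply: fin_bigcap_measurable => // i _.
    by rewrite -[X in measurable X]setTI; exact: measurable_tnth.
  by apply/seteqP; split => t /= At i; [move=> _|]; exact: At.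
congr (_ _); apply/seteqP; split => -[x t] /=.
  move=> At; split; first exact: (At ord0).
  by move=> i; have := At (lift ord0 i); rewrite tnthS.
move=> [Ax At] i; case: (unliftP ord0 i) => [j ->|->]; last exact: Ax.
by rewrite tnthS; exact: At.
Qed.

End LebesgueTuple.

Section Calculus.
Context {R : realType} {d : nat}.
Implicit Types (f : 'rV[R]_d -> R) (x : 'rV[R]_d).

Definition partial (i : 'I_d) f : 'rV[R]_d -> R :=
  fun x => 'D_(delta_mx 0 i) f x.

Definition grad f x : 'rV[R]_d := \row_i partial i f x.

Definition hess f x : 'M[R]_d := \matrix_(i, j) partial i (partial j f) x.

Fixpoint Ck (k : nat) f : Prop :=
  match k with
  | 0 => continuous f
  | k'.+1 => (forall x, differentiable f x) /\ forall i, Ck k' (partial i f)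
  end.

Definition twice_differentiable f : Prop :=
  (forall x, differentiable f x) /\
  (forall i x, differentiable (partial i f) x).

(* The library norm `|x| on row vectors is the maximum norm, so the Euclidean
   norm has to be defined. *)
Definition enorm x : R := Num.sqrt (\sum_i x 0 i ^+ 2).

Definition opnorm (A : 'M[R]_d) : R :=
  sup [set enorm (v *m A) | v in [set v | enorm v <= 1]].

Definition loewner_le (A B : 'M[R]_d) : Prop :=
  forall v : 'rV[R]_d, (v *m A *m v^T) 0 0 <= (v *m B *m v^T) 0 0.

Definition sup_norm f : \bar R := ereal_sup (range (fun x => `|f x|%:E)).

Definition row_of_tuple (t : d.-tuple (measurableTypeR R)) : 'rV[R]_d :=
  \row_i tnth t i.

Definition probability_density f : Prop :=
  [/\ measurable_fun setT (fun t => f (row_of_tuple t)),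
      forall x, 0 <= f x &
      (\int[lebesgue_tuple d]_t (f (row_of_tuple t))%:E = 1)%E].

End Calculus.

Section Splitting.
Context {R : realType} {d : nat}.
Implicit Types (phi : R -> 'rV[R]_d -> 'rV[R]_d) (rho : 'rV[R]_d -> R).

Definition is_flow (b : 'rV[R]_d -> 'rV[R]_d) phi : Prop :=
  (forall x, phi 0 x = x) /\
  (forall t x, is_derive (t : R) (1 : R) (phi ^~ x) (b (phi t x))).

Definition flow_jac phi (t : R) x : R := \det ('J (phi t) x).

Definition advection phi (t : R) rho : 'rV[R]_d -> R :=
  fun x => rho (phi (- t) x) * flow_jac phi (- t) x.

Definition heat_kernel (beta t : R) (z : 'rV[R]_d) : R :=
  (4 * pi * beta^-1 * t) `^ (- (d%:R / 2)) *
  expR (- (beta * enorm z ^+ 2 / (4 * t))).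

(* The Gaussian formula degenerates at t = 0, where the semigroup is the
   identity. *)
Definition diffusion (beta t : R) rho : 'rV[R]_d -> R :=
  fun x => if t == 0 then rho x else
    \int[lebesgue_tuple d]_y
      (heat_kernel beta t (x - row_of_tuple y) * rho (row_of_tuple y)).

Definition averaged_step phi (beta s : R) rho : 'rV[R]_d -> R :=
  fun x => 2^-1 * (advection phi s (diffusion beta s rho) x +
                   diffusion beta s (advection phi s rho) x).

Definition rslmc_law phi (beta tau : R) rho0 (n : nat) : 'rV[R]_d -> R :=
  iter n (averaged_step phi beta tau) rho0.

(* On [n tau, (n+1) tau[ the index n is the integer part of t / tau; the right
   endpoint is covered by averaged_density_itv. *)
Definition averaged_density phi (beta tau : R) rho0 (t : R) : 'rV[R]_d -> R :=
  let n := Num.truncn (t / tau) in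
  averaged_step phi beta (t - n%:R * tau) (rslmc_law phi beta tau rho0 n).

Lemma averaged_step0 phi beta rho :
  (forall x, phi 0 x = x) -> averaged_step phi beta 0 rho = rho.
Proof.
move=> phi0; have phi0E : phi 0 = id by apply/funext.
apply/funext => x; rewrite /averaged_step /diffusion eqxx /advection.
have -> : flow_jac phi (- 0) x = 1.
  rewrite /flow_jac oppr0 phi0E -[RHS](det1 R d); congr (\det _).
  apply/row_matrixP => i; rewrite !rowE -deriveEjacobian//.
  by rewrite derive_id mulmx1.
by rewrite oppr0 phi0 mulr1 -mulr2n -[rho x *+ 2]mulr_natl mulrA mulVf ?mul1r// pnatr_eq0.
Qed.

Lemma averaged_density_itv phi beta tau rho0 (n : nat) t :
  (forall x, phi 0 x = x) -> 0 < tau ->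
  n%:R * tau <= t <= n.+1%:R * tau ->
  averaged_density phi beta tau rho0 t =
  averaged_step phi beta (t - n%:R * tau) (rslmc_law phi beta tau rho0 n).
Proof.
move=> phi0 tau0 /andP[nt]; rewrite le_eqVlt => /predU1P[->|tn].
  have -> : n.+1%:R * tau - n%:R * tau = tau.
    by rewrite -mulrBl -natr1 addrAC subrr add0r mul1r.
  rewrite /averaged_density mulfK; last by rewrite gt_eqF.
  by rewrite natrK subrr (averaged_step0 beta _ phi0).
rewrite /averaged_density (_ : Num.truncn _ = n)//.
by apply/truncn_def; rewrite ler_pdivlMr// ltr_pdivrMr// nt.
Qed.

End Splitting.

(* Main.v *)
Require Import Defs.
From HB Require Import structures.
From mathcomp Require Import all_boot all_order all_algebra.
From mathcomp Require Import all_classical all_reals all_analysis.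
From mathcomp Require Import perm measurable_realfun ring lra.

Set Implicit Arguments.
Unset Strict Implicit.
Unset Printing Implicit Defensive.
Import Order.TTheory GRing.Theory Num.Theory.
Import numFieldNormedType.Exports.
Local Open Scope classical_set_scope.
Local Open Scope ring_scope.

(** Fix an integer [r >= 2] and put [h_M u = u (r - ln (u / M))^r], which is
    increasing in [M] and concave in [u] on ]0, M].  The densities are confined to
    the class
      [0 < f <= M],  [f >= exp (- c (1 + |x|^2)^m)],
      [|d_i f| <= C h_M f],  [|d_i d_j f| <= C h_M f],
    whose members satisfy the required bound on [ln f] and its derivatives, since
    [r - ln (f / M)] grows at most polynomially.  The initial density belongs to it
    because [U] grows at least linearly (convexity at infinity), so that
    [rho0 <= A1 exp (- delta beta U)] turns every power of [|x|] into a power of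
    [- ln rho0].
    The heat semigroup keeps [M] and [C] by Jensen's inequality for [h_M], and
    multiplies [c] by [exp (K s)], by Jensen for [exp] and a symmetrised moment
    bound.  The advection multiplies [M], [C + 1] and [c + 1] by at most
    [exp (K s)], because the flow at time [s] is [O(s)]-close to the identity with
    three derivatives.  Averaging is harmless by concavity.  Over a total time [T]
    these factors compose to [exp (K T)], whatever the step size. *)

(** * Differentiability and first-order expansions *)

(** A polynomial bound on [grad ln f] compares [|d_i f|] with [|x|^p f], and convolution carries the
    weight [|x|^p] to other points. A concave function of [f] alone passes through averages, and the
    hypothesis on [grad ln rho0] already has this form, with [u (1 - ln (u / M1))]. The Hessian
    forces a higher power: it brings a product of two logarithmic derivatives and the factor
    [|x|^q], whence [r >= 2] and [r >= q]. Shifting the logarithm by [r] keeps this power both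
    concave and increasing on the whole of ]0, M].

    The number of steps is of order [T / tau], so a step may only cost a factor [1 + O(tau)]; a
    fixed dimensional factor, or a loss of order [sqrt tau], would blow up as [tau] tends to 0.

    Three derivatives of the flow enter because its Jacobian determinant, made of first derivatives,
    is differentiated twice in the Hessian of the advected density. The shifts [C + 1] and [c + 1]
    record additive losses: derivatives of the advected density contain the density itself, which is
    at most [h_M f], and the logarithm of the Jacobian adds [O(s)] to the exponent even when [c] is
    0. *)

Section HasGrad.
Context {R : realType} {d : nat}.
Implicit Types (f : 'rV[R]_d -> R) (x v : 'rV[R]_d).

Lemma coord_le_norm v i : `|v 0 i| <= `|v|.
Proof.
rewrite [leRHS]/Num.Def.normr/= mx_normrE.
by apply: (le_trans _ (le_bigmax _ _ (0, i))).
Qed.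

(** Fréchet differentiability with a prescribed gradient, in epsilon form: for limits and integrals
    the gradient is guessed first and differentiability then follows. *)
Definition has_grad f x (g : 'I_d -> R) := forall e, 0 < e ->
  exists2 eta, 0 < eta & forall v, `|v| <= eta ->
    `|f (x + v) - f x - \sum_i v 0 i * g i| <= e * `|v|.

Lemma diff_sum f x v : differentiable f x ->
  'd f x v = \sum_i v 0 i * partial i f x.
Proof.
move=> df; rewrite [in LHS](row_sum_delta v) linear_sum.
by apply: eq_bigr => i _; rewrite linearZ/= /partial deriveE.
Qed.

Lemma has_gradP f x : differentiable f x -> has_grad f x (fun i => partial i f x).
Proof.
move=> df e e0.
have /diff_locallyxC := df.
set r := 'o _ => H.
have /nbhs_ballP[eta /= eta0 Hr] := littleoP [littleo of r] e0.
exists (eta / 2); first by rewrite divr_gt0.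
move=> v vh; rewrite H -diff_sum//.
have -> a b c : a + b + c - a - b = c :> R by ring.
apply: Hr; rewrite -ball_normE /ball_/= sub0r normrN (le_lt_trans vh)//.
by rewrite ltr_pdivrMr// ltr_pMr// ltr1n.
Qed.

(** The candidate differential is packed as a continuous linear map; uniqueness of the differential
    then identifies the partial derivatives. *)
Lemma has_grad_diff f x g : has_grad f x g ->
  differentiable f x /\ forall i, partial i f x = g i.
Proof.
move=> H.
pose dfun v := \sum_i v 0 i * g i.
have dfl : linear dfun.
  move=> a u v; rewrite /dfun scaler_sumr -big_split; apply: eq_bigr => i _.
  by rewrite !mxE mulrDl /= -mulrA.
pose L := GRing.isLinear.Build _ _ _ _ _ dfl.
pose df : {linear 'rV[R]_d -> R} := HB.pack dfun L.
have dfc : continuous df.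
  apply: bounded_linear_continuous; apply/linear_boundedP.
  near=> K.
  have H1 : \sum_i `|g i| <= K by near: K; apply: nbhs_pinfty_ge; rewrite num_real.
  move=> v; rewrite /= /dfun.
  apply: (le_trans (ler_norm_sum _ _ _)).
  apply: (@le_trans _ _ (\sum_i `|g i| * `|v|)).
    apply: ler_sum => i _; rewrite normrM mulrC ler_wpM2l//.
    exact: coord_le_norm.
  rewrite -mulr_suml ler_wpM2r//.
have dfo : f \o shift x = cst (f x) + (df : 'rV[R]_d -> R) +o_ (0 : 'rV[R]_d) id.
  apply/eqaddoP => e e0; have [eta eta0 Heta] := H e e0.
  apply/nbhs_ballP; exists eta => //= v; rewrite -ball_normE /ball_/= sub0r normrN => /ltW vh.
  by rewrite !fctE /= opprD addrA [v + x]addrC; exact: Heta.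
have dE := diff_unique dfc dfo.
have dif : differentiable f x.
  by apply/diff_locallyP; split; rewrite dE.
split=> // i; rewrite /partial deriveE// dE /= /dfun.
rewrite (bigD1 i)//= big1 ?addr0 => [|j ji]; rewrite mxE eqxx /= ?eqxx ?mul1r//.
by rewrite (negbTE ji) mul0r.
Unshelve. all: by end_near. Qed.

End HasGrad.

(** * Scalar and vector Gronwall inequalities *)

Section RealDerivative.
Context {R : realType}.
Implicit Types (f df E dE : R -> R) (t h s r a K c C e l : R).

Lemma is_derive_eps f t l : is_derive t 1 f l -> forall e, 0 < e ->
  exists2 eta, 0 < eta & forall h, `|h| <= eta ->
    `|f (t + h) - f t - h * l| <= e * `|h|.
Proof.
move=> [dft Dft] e e0.
have : (fun h => h^-1 *: ((f \o shift t) (h *: 1) - f t)) @ 0^' --> l.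
  by rewrite -Dft; exact: dft.
move/cvgrPdist_le => /(_ _ e0) /nbhs_ballP[eta /= eta0 H].
exists (eta / 2); first by rewrite divr_gt0.
move=> h hh; have [->|h0] := eqVneq h 0.
  by rewrite addr0 subrr mul0r subrr normr0 mulr0.
have := H h; rewrite -ball_normE /ball_/= sub0r normrN => H0.
have {H0} := H0 _ h0.
rewrite /GRing.scale /= mulr1 [h + t]addrC => H1.
have -> : f (t + h) - f t - h * l = - (h * (l - h^-1 * (f (t + h) - f t))).
  by field.
by rewrite normrN normrM mulrC ler_wpM2r// H1// (le_lt_trans hh)// ltr_pdivrMr// ltr_pMr// ltr1n.
Qed.

Lemma eps_is_derive f t l : (forall e, 0 < e ->
  exists2 eta, 0 < eta & forall h, `|h| <= eta ->
    `|f (t + h) - f t - h * l| <= e * `|h|) -> is_derive t 1 f l.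
Proof.
move=> H.
have K : (fun h => h^-1 *: ((f \o shift t) (h *: 1) - f t)) @ 0^' --> l.
  apply/cvgrPdist_le => e e0; have [eta eta0 He] := H e e0.
  apply/nbhs_ballP; exists eta => //= h.
  rewrite -ball_normE /ball_/= sub0r normrN => /ltW/He hh h0.
  rewrite /GRing.scale /= mulr1 [h + t]addrC.
  have -> : l - h^-1 * (f (t + h) - f t) = - h^-1 * (f (t + h) - f t - h * l).
    by field.
  rewrite normrM normrN normfV ler_pdivrMl ?normr_gt0//.
  by rewrite [_ * e]mulrC.
by split; [apply/cvg_ex; exists l|apply/cvg_lim].
Qed.

Lemma mvt_abs f df a K t s : (forall r, `|r| < a -> is_derive r 1 f (df r)) ->
  (forall r, `|r| < a -> `|df r| <= K) -> `|t| < a -> `|s| < a ->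
  `|f t - f s| <= K * `|t - s|.
Proof.
move=> Hf Hdf.
wlog st : t s / s <= t.
  move=> W ta sa; have [/W|/ltW/W] := leP s t; first exact.
  by rewrite distrC [`|s - t|]distrC; exact.
move=> ta sa.
have Hr r : s <= r -> r <= t -> `|r| < a.
  move: ta sa; rewrite !ltr_norml => /andP[? ?] /andP[? ?] ? ?.
  by apply/andP; split; lra.
have [||c] := MVT_segment st (df := df) (f := f).
- by move=> r; rewrite in_itv/= => /andP[/ltW s1 /ltW r1]; apply: Hf; exact: Hr.
- apply: derivable_within_continuous => r; rewrite in_itv/= => /andP[s1 r1].
  by have [] := Hf r (Hr _ s1 r1).
- rewrite in_itv/= => /andP[s1 r1] ->.
  by rewrite normrM ler_wpM2r// Hdf// Hr.
Qed.

Lemma nincr_oo f df a t s : (forall r, `|r| < a -> is_derive r 1 f (df r)) ->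
  (forall r, s <= r -> r <= t -> df r <= 0) -> `|t| < a -> `|s| < a -> s <= t ->
  f t <= f s.
Proof.
move=> Hf Hdf ta sa st.
have Hr r : s <= r -> r <= t -> `|r| < a.
  move: ta sa; rewrite !ltr_norml => /andP[? ?] /andP[? ?] ? ?.
  by apply/andP; split; lra.
have [||c] := MVT_segment st (df := df) (f := f).
- by move=> r; rewrite in_itv/= => /andP[/ltW s1 /ltW r1]; apply: Hf; exact: Hr.
- apply: derivable_within_continuous => r; rewrite in_itv/= => /andP[s1 r1].
  by have [] := Hf r (Hr _ s1 r1).
- rewrite in_itv/= => /andP[s1 r1] E; rewrite -subr_le0 E.
  by apply: mulr_le0_ge0; [exact: Hdf|rewrite subr_ge0].
Qed.

(** The integrating factor makes [F] nonincreasing: its derivative is at most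
    [c expR (- C (r - s)) - c], which is nonpositive for [r >= s]. *)
Lemma gronwall_fwd E dE a C c t s :
  (forall r, `|r| < a -> is_derive r 1 E (dE r)) ->
  (forall r, `|r| < a -> dE r <= C * E r + c) -> 0 <= C -> 0 <= c ->
  `|t| < a -> `|s| < a -> s <= t ->
  E t <= (E s + c * (t - s)) * expR (C * (t - s)).
Proof.
move=> HE HdE C0 c0 ta sa st.
pose F r := E r * expR (- (C * (r - s))) - c * (r - s).
pose dF r := (dE r - C * E r) * expR (- (C * (r - s))) - c.
have HF r : `|r| < a -> is_derive r 1 F (dF r).
  move=> ra; have H := HE r ra; rewrite /F.
  apply: is_derive_eq.
  rewrite /dF /GRing.scale /=; ring.
have := @nincr_oo F dF a t s HF _ ta sa st.
have -> : F s = E s by rewrite /F subrr !mulr0 oppr0 expR0 mulr1 addr0.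
have Hr r : s <= r -> r <= t -> `|r| < a.
  move: ta sa; rewrite !ltr_norml => /andP[? ?] /andP[? ?] ? ?.
  by apply/andP; split; lra.
move=> H; rewrite -ler_pdivrMr ?expR_gt0// -expRN -lerBlDr.
apply: H => r sr rt; rewrite /dF subr_le0.
have := HdE r (Hr _ sr rt); rewrite -lerBlDl => H1.
apply: (@le_trans _ _ (c * expR (- (C * (r - s))))).
  by rewrite ler_wpM2r// expR_ge0.
by rewrite ler_piMr// -expR0 ler_expR oppr_le0 mulr_ge0// subr_ge0.
Qed.

(** Time reversal covers [t < s]. Both directions matter, since the advection uses the flow at
    negative times. *)
Lemma gronwall E dE a C c t s :
  (forall r, `|r| < a -> is_derive r 1 E (dE r)) ->
  (forall r, `|r| < a -> `|dE r| <= C * E r + c) -> 0 <= C -> 0 <= c ->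
  `|t| < a -> `|s| < a ->
  E t <= (E s + c * `|t - s|) * expR (C * `|t - s|).
Proof.
move=> HE HdE C0 c0 ta sa; have [st|ts] := leP s t.
  rewrite ger0_norm ?subr_ge0//; apply: gronwall_fwd => // r ra.
  exact: le_trans (ler_norm _) (HdE r ra).
rewrite ltr0_norm ?subr_lt0// opprB.
have := @gronwall_fwd (E \o -%R) (fun r => - dE (- r)) a C c (- t) (- s).
rewrite /= !opprK [- t + s]addrC; apply => //; rewrite ?normrN ?lerN2// 1?ltW//.
- move=> r ra; have H : is_derive (- r) 1 E (dE (- r)) by apply: HE; rewrite normrN.
  have H2 : is_derive r 1 (-%R : R -> R) (-1) by apply: is_derive_eq.
  have := is_derive1_comp H H2; rewrite /GRing.scale /= mulrN1; exact.
- move=> r ra; apply: le_trans (ler_norm _) _; rewrite normrN; apply: HdE.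
  by rewrite normrN.
Qed.
End RealDerivative.

(** * Differentiation of uniform limits on an open interval *)

Section Sequences.
Context {R : realType}.

Lemma unif_cauchy_lim (q : nat -> R -> R) (a : R) :
  (forall e, 0 < e -> exists N, forall n m, (N <= n)%N -> (N <= m)%N ->
     forall t, `|t| < a -> `|q n t - q m t| <= e) ->
  exists Z : R -> R, forall e, 0 < e -> exists N, forall n, (N <= n)%N ->
     forall t, `|t| < a -> `|q n t - Z t| <= e.
Proof.
move=> H; exists (fun t => lim (q ^~ t @ \oo)) => e e0.
have [N HN] := H e e0; exists N => n Nn t ta.
have cq : cvgn (q ^~ t).
  apply/cauchy_cvgP/cauchy_exP => e' e'0.
  have [N' HN'] := H _ (divr_gt0 e'0 (ltr0n _ 2)).
  exists (q N' t); exists N' => // j Nj; rewrite -ball_normE /ball_/=.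
  by rewrite (le_lt_trans (HN' _ _ (leqnn _) Nj t ta))// ltr_pdivrMr// ltr_pMr// ltr1n.
suff : lim (q ^~ t @ \oo) \in `[q n t - e, q n t + e].
  by rewrite in_itv/= => /andP[H1 H2]; rewrite ler_distlC; apply/andP; split; lra.
rewrite in_itv/=; apply/andP; split.
- apply: limr_ge => //; exists N => // m /= Nm.
  by have := HN n m Nn Nm t ta; rewrite ler_distlC => /andP[? ?]; lra.
- apply: limr_le => //; exists N => // m /= Nm.
  by have := HN n m Nn Nm t ta; rewrite ler_distlC => /andP[? ?]; lra.
Qed.

(** The mean value inequality controls the increments of [q n - q N] uniformly in [n], so [n] may be
    chosen after the increment [h]. *)
Lemma is_derive_unif_lim (q dq : nat -> R -> R) (Z g : R -> R) (a : R) :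
  (forall n (r : R), `|r| < a -> is_derive r 1 (q n) (dq n r)) ->
  (forall e, 0 < e -> exists N, forall n, (N <= n)%N ->
     forall t, `|t| < a -> `|q n t - Z t| <= e) ->
  (forall e, 0 < e -> exists N, forall n, (N <= n)%N ->
     forall t, `|t| < a -> `|dq n t - g t| <= e) ->
  forall t : R, `|t| < a -> is_derive t 1 Z (g t).
Proof.
move=> Hq HZ Hdq t ta; apply: eps_is_derive => e e0.
(* The error is split below into five terms, one of which counts twice: six shares in all. *)
have e5 : 0 < e / 6 by rewrite divr_gt0.
have [N HN] := Hdq _ e5.
have [eta eta0 Heta] := is_derive_eps (Hq N t ta) e5.
pose eta' := Num.min eta ((a - `|t|) / 2).
have eta'0 : 0 < eta' by rewrite lt_min eta0 divr_gt0// subr_gt0.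
exists eta' => // h; rewrite le_min => /andP[heta hta].
have [->|h0] := eqVneq h 0.
  by rewrite addr0 subrr mul0r subrr normr0 mulr0.
have tha : `|t + h| < a.
  apply: (le_lt_trans (ler_normD _ _)).
  have : 0 < a - `|t| by rewrite subr_gt0.
  by move: hta; lra.
have eh0 : 0 < e / 6 * `|h| by rewrite mulr_gt0 ?normr_gt0.
have [N' HN'] := HZ _ eh0.
pose n := maxn N N'.
have nN : (N <= n)%N by rewrite leq_maxl.
have nN' : (N' <= n)%N by rewrite leq_maxr.
have := HN' n nN' t ta; have := HN' n nN' _ tha.
have : `|(q n (t + h) - q N (t + h)) - (q n t - q N t)| <= (e / 6 + e / 6) * `|(t + h) - t|.
  apply: (@mvt_abs _ (fun r => q n r - q N r) (fun r => dq n r - dq N r) a) => // r ra.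
    have H1 := Hq n r ra; have H2 := Hq N r ra; exact: is_deriveB.
  rewrite -(subrKA (g r)) (le_trans (ler_normD _ _))// lerD ?HN//.
  by rewrite distrC HN.
have := Heta h heta.
have := HN N (leqnn _) t ta.
rewrite [t + h]addrC addrK.
move=> H1 H2 H3 H4 H5.
have -> : Z (h + t) - Z t - h * g t =
  (h * (dq N t - g t)) + (q N (h + t) - q N t - h * dq N t) +
  ((q n (h + t) - q N (h + t)) - (q n t - q N t)) - (q n (h + t) - Z (h + t))
  + (q n t - Z t) by ring.
have H6 : `|h * (dq N t - g t)| <= e / 6 * `|h| by rewrite normrM mulrC ler_wpM2r.
rewrite (_ : e * `|h| = e / 6 * `|h| + e / 6 * `|h| + (e / 6 + e / 6) * `|h| +
  e / 6 * `|h| + e / 6 * `|h|); last by field.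
do 2 (apply: (le_trans (ler_normD _ _)); rewrite ?normrN; apply: lerD => //).
by do 2 (apply: (le_trans (ler_normD _ _)); rewrite ?normrN; apply: lerD => //).
Qed.
End Sequences.

Section VectorGronwall.
Context {R : realType}.

Lemma sqr_sum_le n (w : 'I_n -> R) : (\sum_i w i) ^+ 2 <= n%:R * \sum_i w i ^+ 2.
Proof.
have -> : (\sum_i w i) ^+ 2 = \sum_i \sum_j w i * w j.
  by rewrite expr2 mulr_suml; apply: eq_bigr => i _; rewrite mulr_sumr.
have -> : n%:R * \sum_i w i ^+ 2 = \sum_i \sum_j (w i ^+ 2 / 2 + w j ^+ 2 / 2).
  transitivity (\sum_i (n%:R * (w i ^+ 2 / 2) + (\sum_j w j ^+ 2 / 2))).
    rewrite big_split/= -mulr_sumr sumr_const card_ord -mulr_suml.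
    by rewrite -[_ *+ n]mulr_natl; field.
  apply: eq_bigr => i _; rewrite big_split/=; congr (_ + _).
  by rewrite sumr_const card_ord mulr_natl.
apply: ler_sum => i _; apply: ler_sum => j _.
by have := sqr_ge0 (w i - w j); lra.
Qed.

(** [2 * a] bounds the distance between two times of the window. If [B] denotes the second summand,
    then [B <= (1 + B) ^+ 2], so that the leading 1 avoids a square root when passing from squares
    to absolute values. *)
Definition gconst n (K a : R) := 1 + (n%:R + 2 * a) * expR ((2 * K + 1) * n%:R * (2 * a)).

Lemma gconst_ge1 n K a : 0 <= a -> 1 <= gconst n K a.
Proof. by move=> a0; rewrite lerDl mulr_ge0 ?expR_ge0// addr_ge0// mulr_ge0. Qed.

(** The sum of squares is differentiable where the norm is not, so the scalar inequality is applied
    to it; the forcing is separated by [0 <= (S - e) ^+ 2]. *)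
Lemma gronwall_vec n (w dw : 'I_n -> R -> R) (a K e m t s : R) :
  (forall k (r : R), `|r| < a -> is_derive r 1 (w k) (dw k r)) ->
  (forall k r, `|r| < a -> `|dw k r| <= K * \sum_j `|w j r| + e) ->
  0 <= K -> 0 <= e -> `|t| < a -> `|s| < a ->
  0 <= m -> (forall k, `|w k s| <= m) ->
  forall k, `|w k t| <= gconst n K a * (m + e).
Proof.
move=> Hw Hdw K0 e0 ta sa m0 ws k.
have a0 : 0 <= a by apply/ltW/(le_lt_trans _ ta).
pose E r := \sum_i w i r ^+ 2.
pose dE r := \sum_i (2 * w i r * dw i r).
have HE (r : R) : `|r| < a -> is_derive r 1 E (dE r).
  move=> ra.
  have -> : E = \sum_i (fun r => w i r ^+ 2).
    by apply/funext => r'; rewrite /E fct_sumE.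
  apply: is_derive_sum => i; have H := Hw i r ra.
  by apply: is_derive_eq; rewrite /GRing.scale /=; ring.
have HdE r : `|r| < a -> `|dE r| <= (2 * K + 1) * n%:R * E r + e ^+ 2.
  move=> ra; pose S := \sum_i `|w i r|.
  have S0 : 0 <= S by apply: sumr_ge0.
  have S2 : S ^+ 2 <= n%:R * E r.
    apply: (le_trans (sqr_sum_le _)); rewrite ler_wpM2l// ler_sum// => i _.
    by rewrite real_normK// num_real.
  apply: (@le_trans _ _ (2 * S * (K * S + e))).
    apply: (le_trans (ler_norm_sum _ _ _)).
    rewrite -mulrA mulr_suml mulr_sumr; apply: ler_sum => i _.
    rewrite -mulrA normrM ger0_norm// ler_wpM2l// normrM ler_wpM2l//.
    exact: Hdw.
  apply: (@le_trans _ _ ((2 * K + 1) * S ^+ 2 + e ^+ 2)).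
    by have := sqr_ge0 (S - e); lra.
  by rewrite lerD2r -mulrA ler_wpM2l// addr_ge0// mulr_ge0.
have C0 : 0 <= (2 * K + 1) * n%:R by rewrite mulr_ge0// addr_ge0// mulr_ge0.
have := gronwall HE HdE C0 (sqr_ge0 _) ta sa.
have ts : `|t - s| <= 2 * a.
  by apply: (le_trans (ler_normB _ _)); move: ta sa; lra.
have Es : E s <= n%:R * m ^+ 2.
  rewrite /E (le_trans (y := \sum_(i < n) m ^+ 2))//; last first.
    by rewrite sumr_const card_ord mulr_natl.
  apply: ler_sum => i _; rewrite -[leLHS]real_normK ?num_real//.
  by rewrite lerXn2r ?nnegrE.
move=> H.
set B := (n%:R + 2 * a) * expR ((2 * K + 1) * n%:R * (2 * a)).
have B0 : 0 <= B by rewrite mulr_ge0 ?expR_ge0// addr_ge0// mulr_ge0.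
have HEt : E t <= B * (m + e) ^+ 2.
  apply: (le_trans H); rewrite /B [leRHS]mulrAC ler_pM ?expR_ge0//.
  - apply: addr_ge0; first by apply: sumr_ge0 => i _; exact: sqr_ge0.
    by rewrite mulr_ge0 ?sqr_ge0.
  - rewrite mulrDl lerD//.
      apply: (le_trans Es); rewrite ler_wpM2l// lerXn2r ?nnegrE ?addr_ge0//.
      by rewrite lerDl.
    rewrite mulrC ler_pM// ?sqr_ge0// lerXn2r ?nnegrE ?addr_ge0//.
    by rewrite lerDr.
  - by rewrite ler_expR ler_wpM2l.
rewrite -(@ler_pXn2r _ 2)// ?nnegrE ?mulr_ge0 ?addr_ge0//.
rewrite real_normK ?num_real// exprMn.
apply: (@le_trans _ _ (E t)).
  by rewrite /E (bigD1 k)//= lerDl; apply: sumr_ge0 => i _; exact: sqr_ge0.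
apply: (le_trans HEt); rewrite ler_wpM2r ?sqr_ge0//.
rewrite /gconst -/B; have := mulr_ge0 B0 B0; lra.
Qed.
End VectorGronwall.

(** * Linearisation of a parametrised differential equation *)

Section Linearization.
Context {R : realType} {d : nat}.

Lemma finite_eventually n (P : 'I_n -> nat -> Prop) :
  (forall j, exists N, forall m, (N <= m)%N -> P j m) ->
  exists N, forall j m, (N <= m)%N -> P j m.
Proof.
move=> /choice[N HN]; exists (\max_j N j)%N => j m Nm; apply: HN.
exact: leq_trans (leq_bigmax j) Nm.
Qed.

Lemma norm_sumM_le n (a b : 'I_n -> R) (K : R) :
  (forall j, `|a j| <= K) -> `|\sum_j a j * b j| <= K * \sum_j `|b j|.
Proof.
move=> aK; apply: (le_trans (ler_norm_sum _ _ _)); rewrite mulr_sumr.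
by apply: ler_sum => j _; rewrite normrM ler_wpM2r.
Qed.

Lemma sum_le_const n (b : 'I_n -> R) (K : R) :
  (forall j, b j <= K) -> \sum_j b j <= n%:R * K.
Proof.
move=> bK; rewrite (le_trans (y := \sum_(j < n) K))//; first exact: ler_sum.
by rewrite sumr_const card_ord mulr_natl.
Qed.

Lemma norm_sum_coord_le (v : 'rV[R]_d) (g : 'I_d -> R) (K : R) :
  (forall i, `|g i| <= K) -> `|\sum_i v 0 i * g i| <= d%:R * K * `|v|.
Proof.
move=> gK; apply: (le_trans (ler_norm_sum _ _ _)).
rewrite -mulrA; apply: sum_le_const => i.
rewrite normrM mulrC ler_pM//; exact: coord_le_norm.
Qed.

(* Difference quotients in [v] are Cauchy, uniformly in [t], by Gronwall; their
   limit solves the linearised equation because the derivatives converge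
   uniformly too, so no existence theorem for linear equations is needed. *)
Lemma linearization n (del ddel : 'rV[R]_d -> 'I_n -> R -> R)
    (A : 'I_n -> 'I_n -> R -> R) (g : 'I_d -> 'I_n -> R -> R)
    (l : 'I_d -> 'I_n -> R) (K a : R) :
  0 < a -> 0 <= K ->
  (forall v k (t : R), `|t| < a -> is_derive t 1 (del v k) (ddel v k t)) ->
  (forall v k, del v k 0 = \sum_i v 0 i * l i k) ->
  (forall k j t, `|t| < a -> `|A k j t| <= K) ->
  (forall i k t, `|t| < a -> `|g i k t| <= K) ->
  (forall i k, `|l i k| <= K) ->
  (forall e, 0 < e -> exists2 eta, 0 < eta & forall v, `|v| <= eta ->
    forall t k, `|t| < a ->
    `|ddel v k t - \sum_j A k j t * del v j t - \sum_i v 0 i * g i k t| <=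
      e * (`|v| + \sum_j `|del v j t|)) ->
  exists Z : 'I_d -> 'I_n -> R -> R,
  [/\ forall i k (t : R), `|t| < a ->
        is_derive t 1 (Z i k) (\sum_j A k j t * Z i j t + g i k t),
      forall i k, Z i k 0 = l i k,
      forall i k t, `|t| < a -> `|Z i k t| <= gconst n K a * (K + K) &
      forall e, 0 < e -> exists2 eta, 0 < eta & forall v, `|v| <= eta ->
        forall t k, `|t| < a ->
        `|del v k t - \sum_i v 0 i * Z i k t| <= e * `|v|].
Proof.
move=> a0 K0 Hdel del0 AK gK lK Hrem.
have z0 : `|0 : R| < a by rewrite normr0.
have B1 c : 1 <= gconst n c a by apply: gconst_ge1; exact: ltW.
have B0 c : 0 <= gconst n c a by apply: le_trans (B1 c).
pose B2 := gconst n (K + 1) a * (d%:R * K + (d%:R * K + 1)).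
have B20 : 0 <= B2 by rewrite mulr_ge0// !addr_ge0// mulr_ge0.
have [eta1 eta10 H1] := Hrem 1 ltr01.
(* A priori Lipschitz bound: the remainder with tolerance 1 adds 1 to the coefficient [K] and 1 to
   the forcing constant [d K]. *)
have delB v k t : `|v| <= eta1 -> `|t| < a -> `|del v k t| <= B2 * `|v|.
  move=> veta ta.
  have -> : B2 * `|v| = gconst n (K + 1) a * (d%:R * K * `|v| + (d%:R * K + 1) * `|v|).
    by rewrite /B2; ring.
  apply: (@gronwall_vec _ _ (del v) (ddel v) a (K + 1) _ _ t 0) => //; rewrite ?addr_ge0//.
  - move=> j r ra.
    have -> : ddel v j r = (ddel v j r - \sum_j0 A j j0 r * del v j0 r - \sum_i v 0 i * g i j r)
      + \sum_j0 A j j0 r * del v j0 r + \sum_i v 0 i * g i j r by ring.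
    apply: (le_trans (ler_normD _ _)).
    apply: (le_trans (lerD (ler_normD _ _) (lexx _))).
    have := H1 v veta r j ra.
    have := @norm_sumM_le n (fun j0 => A j j0 r) (fun j0 => del v j0 r) K (fun j0 => AK j j0 r ra).
    have := @norm_sum_coord_le v (fun i => g i j r) K (fun i => gK i j r ra).
    rewrite mul1r; lra.
  - by rewrite mulr_ge0// addr_ge0// mulr_ge0.
  - by rewrite mulr_ge0// mulr_ge0.
  - by move=> j; rewrite del0; exact: norm_sum_coord_le.
(* By the a priori bound, a remainder measured against [del] itself becomes [o(|v|)]. *)
have Hrem' e : 0 < e -> exists2 eta, 0 < eta & forall v, `|v| <= eta ->
    forall t k, `|t| < a ->
    `|ddel v k t - \sum_j A k j t * del v j t - \sum_i v 0 i * g i k t| <= e * `|v|.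
  move=> e0.
  have c0 : 0 < 1 + n%:R * B2 by rewrite ltr_wpDr// mulr_ge0.
  have [eta eta0 H] := Hrem _ (divr_gt0 e0 c0).
  exists (Num.min eta eta1); first by rewrite lt_min eta0.
  move=> v; rewrite le_min => /andP[v1 v2] t k ta.
  apply: (le_trans (H v v1 t k ta)).
  rewrite -mulrA ler_pM2l// ler_pdivrMl// mulrDl mul1r lerD2l -mulrA.
  by apply: sum_le_const => j; exact: delB.
pose h m : R := m.+1%:R^-1.
have h0 m : 0 < h m by rewrite invr_gt0.
pose V i m : 'rV[R]_d := h m *: delta_mx 0 i.
have normV i m : `|V i m| <= h m.
  rewrite /V normrZ gtr0_norm// ler_piMr ?(ltW (h0 m))//.
  rewrite /Num.Def.normr/= mx_normrE bigmax_le//= => -[i1 i2] _ /=.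
  by rewrite mxE; case: (_ && _); rewrite ?normr1 ?normr0.
have sumV i m (b : 'I_d -> R) : \sum_j V i m 0 j * b j = h m * b i.
  rewrite (bigD1 i)//= big1 ?addr0 => [|j ji]; rewrite !mxE eqxx/= ?eqxx ?mulr1//.
  by rewrite (negbTE ji) mulr0 mul0r.
(* Difference quotients in the direction [i] with increment [h m = 1 / (m + 1)]; their initial value
   is exactly [l i k], so only the remainders separate two of them. *)
pose q i k m t := del (V i m) k t / h m.
pose dq i k m t := ddel (V i m) k t / h m.
have Hq i k m (t : R) : `|t| < a -> is_derive t 1 (q i k m) (dq i k m t).
  move=> ta; have H := Hdel (V i m) k t ta; apply: is_derive_eq.
  by rewrite /dq /GRing.scale /=; ring.
have q0 i k m : q i k m 0 = l i k.
  by rewrite /q del0 sumV mulrC mulKf ?gt_eqF.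
have Hdq e : 0 < e -> exists N, forall m, (N <= m)%N -> forall i k t, `|t| < a ->
    `|dq i k m t - \sum_j A k j t * q i j m t - g i k t| <= e.
  move=> e0; have [eta eta0 H] := Hrem' e e0.
  pose N := (Num.truncn eta^-1).+1.
  exists N => m Nm i k t ta.
  have hm : h m <= eta.
    rewrite /h -[leRHS]invrK lef_pV2 ?posrE ?invr_gt0//.
    rewrite (le_trans (ltW (truncnS_gt _)))// ler_nat.
    exact: leq_trans Nm (leqnSn _).
  have := H (V i m) (le_trans (normV _ _) hm) t k ta.
  rewrite sumV => H2.
  rewrite -(@ler_pM2l _ (h m))// -[X in X * `|_| <= _]gtr0_norm// -normrM.
  rewrite !mulrBr mulr_sumr [h m * e]mulrC.
  apply: le_trans (le_trans H2 _); last by rewrite ler_wpM2l// ltW.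
  rewrite [dq _ _ _ _]/dq mulrCA mulfV ?gt_eqF// mulr1.
  under eq_bigr do rewrite /q mulrCA (mulrCA (h m)) mulfV ?gt_eqF// mulr1.
  by [].
have qcauchy i k e : 0 < e -> exists N, forall n m, (N <= n)%N -> (N <= m)%N ->
     forall t, `|t| < a -> `|q i k n t - q i k m t| <= e.
  move=> e0; have Bp : 0 < gconst n K a * 2 by rewrite mulr_gt0// (lt_le_trans _ (B1 K)).
  have [N HN] := Hdq _ (divr_gt0 e0 Bp).
  exists N => n1 m Nn Nm t ta.
  set e' := e / _ in HN.
  have -> : e = gconst n K a * (0 + (e' + e')).
    rewrite /e'; field; move: (B1 K); lra.
  apply: (@gronwall_vec _ _ (fun k t => q i k n1 t - q i k m t)
     (fun k t => dq i k n1 t - dq i k m t) a K (e' + e') 0 t 0) => //.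
  - move=> j r ra; have H3 := Hq i j n1 r ra; have H4 := Hq i j m r ra.
    exact: is_deriveB.
  - move=> j r ra.
    have -> : dq i j n1 r - dq i j m r =
      (\sum_j0 A j j0 r * (q i j0 n1 r - q i j0 m r)) +
      ((dq i j n1 r - \sum_j0 A j j0 r * q i j0 n1 r - g i j r) -
       (dq i j m r - \sum_j0 A j j0 r * q i j0 m r - g i j r)).
      under eq_bigr do rewrite mulrBr.
      rewrite sumrB; ring.
    apply: (le_trans (ler_normD _ _)); apply: lerD.
      by apply: norm_sumM_le => j0; exact: AK.
    by apply: (le_trans (ler_normB _ _)); apply: lerD; exact: HN.
  - by rewrite addr_ge0// ltW// divr_gt0.
  - by move=> j; rewrite !q0 subrr normr0.
have [Z HZ] : exists Z : 'I_d -> 'I_n -> R -> R, forall i k e, 0 < e ->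
    exists N, forall m, (N <= m)%N -> forall t, `|t| < a -> `|q i k m t - Z i k t| <= e.
  have /choice[Z HZ] : forall ik : 'I_d * 'I_n, exists Z : R -> R, forall e, 0 < e ->
    exists N, forall m, (N <= m)%N -> forall t, `|t| < a -> `|q ik.1 ik.2 m t - Z t| <= e.
    by move=> [i k]; apply: unif_cauchy_lim; exact: qcauchy.
  by exists (fun i k => Z (i, k)) => i k; exact: HZ (i, k).
have Z0 i k : Z i k 0 = l i k.
  apply/eqP; rewrite -subr_eq0 -normr_le0; apply/ler_addgt0Pr => e e0.
  have [N HN] := HZ i k e e0; rewrite add0r.
  by have := HN N (leqnn _) 0 z0; rewrite q0 distrC.
have dZ i k (t : R) : `|t| < a ->
    is_derive t 1 (Z i k) (\sum_j A k j t * Z i j t + g i k t).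
  apply: (is_derive_unif_lim (a := a) (q := q i k) (dq := dq i k)
    (g := fun t => \sum_j A k j t * Z i j t + g i k t)).
  - exact: HZ.
  - move=> e e0.
    pose e' := e / (1 + K * n%:R).
    have c0 : 0 < 1 + K * n%:R by rewrite ltr_wpDr// mulr_ge0.
    have e'0 : 0 < e' by rewrite divr_gt0.
    have [N1 HN1] := Hdq _ e'0.
    have [N2 HN2] := @finite_eventually n _ (fun j => HZ i j e' e'0).
    exists (maxn N1 N2) => m; rewrite geq_max => /andP[m1 m2] r ra.
    have -> : dq i k m r - (\sum_j A k j r * Z i j r + g i k r) =
      (dq i k m r - \sum_j A k j r * q i j m r - g i k r) +
      \sum_j A k j r * (q i j m r - Z i j r).
      under [X in _ = _ + X]eq_bigr do rewrite mulrBr.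
      rewrite sumrB; ring.
    have -> : e = e' + K * (n%:R * e').
      by rewrite /e'; field; rewrite gt_eqF.
    apply: (le_trans (ler_normD _ _)); apply: lerD; first exact: HN1.
    apply: (le_trans (@norm_sumM_le _ _ _ K _)); first by move=> j; exact: AK.
    by rewrite ler_wpM2l//; apply: sum_le_const => j; exact: HN2.
exists Z; split => //.
- move=> i k t ta.
  apply: (gronwall_vec (w := Z i)
    (dw := fun k t => \sum_j A k j t * Z i j t + g i k t) (s := 0)) => //.
  + move=> j r ra; apply: (le_trans (ler_normD _ _)); apply: lerD; last exact: gK.
    by apply: norm_sumM_le => j0; exact: AK.
  + by move=> j; rewrite Z0.
- move=> e e0.
  have Bp : 0 < gconst n K a by apply: (lt_le_trans _ (B1 K)).
  have [eta eta0 H] := Hrem' _ (divr_gt0 e0 Bp).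
  exists eta => // v veta t k ta.
  have -> : e * `|v| = gconst n K a * (0 + e / gconst n K a * `|v|).
    by field; rewrite gt_eqF.
  apply: (@gronwall_vec _ _ (fun k t => del v k t - \sum_i v 0 i * Z i k t)
    (fun k t => ddel v k t - \sum_i v 0 i * (\sum_j A k j t * Z i j t + g i k t))
    a K _ 0 t 0) => //.
  + move=> j r ra; apply: is_deriveB; first exact: Hdel.
    have -> : (fun t => \sum_i v 0 i * Z i j t) = \sum_i (fun t => v 0 i * Z i j t).
      by apply/funext => s; rewrite fct_sumE.
    apply: is_derive_sum => i; have Hd := dZ i j r ra.
    by apply: is_derive_eq; rewrite /GRing.scale /=; ring.
  + move=> j r ra.
    have -> : ddel v j r - \sum_i v 0 i * (\sum_j0 A j j0 r * Z i j0 r + g i j r) =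
      \sum_j0 A j j0 r * (del v j0 r - \sum_i v 0 i * Z i j0 r) +
      (ddel v j r - \sum_j0 A j j0 r * del v j0 r - \sum_i v 0 i * g i j r).
      have -> : \sum_i v 0 i * (\sum_j0 A j j0 r * Z i j0 r + g i j r) =
          \sum_j0 A j j0 r * (\sum_i v 0 i * Z i j0 r) + \sum_i v 0 i * g i j r.
        under eq_bigr do rewrite mulrDr mulr_sumr.
        rewrite big_split/= exchange_big/=; congr (_ + _).
        apply: eq_bigr => j0 _; rewrite mulr_sumr.
        by apply: eq_bigr => i _; rewrite mulrCA.
      under [X in _ = X + _]eq_bigr do rewrite mulrBr.
      rewrite sumrB; ring.
    apply: (le_trans (ler_normD _ _)); apply: lerD; last exact: H.
    by apply: norm_sumM_le => j0; exact: AK.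
  + by rewrite mulr_ge0// ltW// divr_gt0.
  + by move=> j; rewrite del0 (eq_bigr (fun i => v 0 i * Z i j 0)) ?subrr ?normr0// => i _; rewrite Z0.
Qed.
End Linearization.

(** * Mean value theorem along segments and expansions uniform on balls *)

Section SegmentMVT.
Context {R : realType} {d : nat}.
Implicit Types (f : 'rV[R]_d -> R) (x y v h : 'rV[R]_d).

Lemma is_derive_segment f y h (s : R) : differentiable f (y + s *: h) ->
  is_derive s 1 (fun r => f (y + r *: h)) (\sum_k h 0 k * partial k f (y + s *: h)).
Proof.
move=> df; apply: eps_is_derive => e e0.
have c0 : 0 < 1 + `|h| by rewrite ltr_wpDr.
have [eta eta0 H] := has_gradP df (divr_gt0 e0 c0).
exists (eta / (1 + `|h|)); first by rewrite divr_gt0.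
move=> r rh; have vle : `|r *: h| <= eta.
  rewrite normrZ; apply: (@le_trans _ _ (`|r| * (1 + `|h|))).
    by rewrite ler_wpM2l// lerDr.
  by rewrite -ler_pdivlMr.
rewrite scalerDl addrA.
have := H _ vle; under eq_bigr do rewrite mxE -mulrA.
rewrite -mulr_sumr => /le_trans; apply.
rewrite normrZ.
have -> : e / (1 + `|h|) * (`|r| * `|h|) = e * `|r| * (`|h| / (1 + `|h|)) by ring.
by rewrite ler_piMr ?mulr_ge0 ?(ltW e0)// ler_pdivrMr// mul1r lerDr.
Qed.

Lemma segment_mvt f y h : (forall x, differentiable f x) ->
  exists2 c : R, 0 <= c <= 1 &
    f (y + h) - f y = \sum_k h 0 k * partial k f (y + c *: h).
Proof.
move=> df.
have H (s : R) : is_derive s 1 (fun r => f (y + r *: h)) (\sum_k h 0 k * partial k f (y + s *: h)).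
  exact: is_derive_segment.
have [|c] := MVT_segment (@ler01 R) (f := fun r => f (y + r *: h))
  (df := fun s => \sum_k h 0 k * partial k f (y + s *: h)).
  by apply: derivable_within_continuous => s _; have [] := H s.
rewrite in_itv/= => c01; rewrite scale1r scale0r addr0 subr0 mulr1 => ->.
by exists c.
Qed.

Lemma grad_bound_lip f (K : R) : (forall x, differentiable f x) ->
  (forall k x, `|partial k f x| <= K) ->
  forall y h, `|f (y + h) - f y| <= d%:R * K * `|h|.
Proof.
move=> df dK y h; have [c _ ->] := segment_mvt y h df.
exact: norm_sum_coord_le.
Qed.

(** Only the base point [y] is confined to the compact ball, while [y + h] may leave it; hence the
    covering form of compactness instead of uniform continuity on the ball. *)
Lemma unif_cont_ball f (r : R) : continuous f -> forall e, 0 < e ->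
  exists2 eta, 0 < eta & forall y h, `|y| <= r -> `|h| <= eta ->
    `|f (y + h) - f y| <= e.
Proof.
move=> cf e e0.
have Kc : compact [set y : 'rV[R]_d | `|y| <= r].
  apply: bounded_closed_compact.
    exists r; split; first exact: num_real.
    by move=> M rM y /= /le_trans; apply; exact: ltW.
  rewrite (_ : mkset _ = (fun y : 'rV[R]_d => `|y|) @^-1` [set x : R | x <= r])//.
  apply: closed_comp; last exact: closed_le.
  by move=> y _; exact: norm_continuous.
have := (compact_near_coveringP [set y : 'rV[R]_d | `|y| <= r]).1 Kc.
move=> /(_ 'rV[R]_d (nbhs (0 : 'rV[R]_d)) (fun h y => `|f (y + h) - f y| <= e) _).
move=> H; have /nbhs_ballP[eta /= eta0 He] : \forall h \near (0 : 'rV[R]_d),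
    [set y : 'rV[R]_d | `|y| <= r] `<=` (fun y => `|f (y + h) - f y| <= e).
  apply: H => x xr.
  have c1 : (fun p : 'rV[R]_d * 'rV[R]_d => f (p.1 + p.2)) @ (x, 0 : 'rV[R]_d) --> f x.
    rewrite -[in f x](addr0 x).
    apply: (@cvg_comp _ _ _ (fun p : 'rV[R]_d * 'rV[R]_d => p.1 + p.2) f _ (nbhs (x + 0))); last exact: cf.
    exact: (add_continuous (x, 0 : 'rV[R]_d)).
  have c2 : (fun p : 'rV[R]_d * 'rV[R]_d => f p.1) @ (x, 0 : 'rV[R]_d) --> f x.
    by apply: (@cvg_comp _ _ _ (fun p : 'rV[R]_d * 'rV[R]_d => p.1) f _ (nbhs x)); [exact: cvg_fst|exact: cf].
  have c3 : (fun p : 'rV[R]_d * 'rV[R]_d => f (p.1 + p.2) - f p.1) @ (x, 0 : 'rV[R]_d) --> 0.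
    by rewrite -(subrr (f x)); apply: cvgB.
  by move/cvgr0Pnorm_le : c3 => /(_ e e0).
exists (eta / 2); first by rewrite divr_gt0.
move=> y h yr hh; apply: He => //=.
rewrite -ball_normE /ball_/= sub0r normrN (le_lt_trans hh)//.
by rewrite ltr_pdivrMr// ltr_pMr// ltr1n.
Qed.

(** By the mean value theorem the remainder is [h] paired with an oscillation of the gradient, which
    is uniformly small on balls. *)
Lemma unif_diff_ball f (r : R) : Ck 1 f -> forall e, 0 < e ->
  exists2 eta, 0 < eta & forall y h, `|y| <= r -> `|h| <= eta ->
    `|f (y + h) - f y - \sum_k h 0 k * partial k f y| <= e * `|h|.
Proof.
move=> [df cf] e e0.
have c0 : 0 < 1 + d%:R :> R by rewrite ltr_wpDr.
have e'0 : 0 < e / (1 + d%:R) by rewrite divr_gt0.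
have : exists2 eta, 0 < eta & forall k y h, `|y| <= r -> `|h| <= eta ->
    `|partial k f (y + h) - partial k f y| <= e / (1 + d%:R).
  have /choice[eta Heta] : forall k, exists eta, 0 < eta /\
     forall y h, `|y| <= r -> `|h| <= eta -> `|partial k f (y + h) - partial k f y| <= e / (1 + d%:R).
    by move=> k; have [eta ? ?] := unif_cont_ball r (cf k) e'0; exists eta.
  exists (\big[Num.min/1]_k eta k).
    by apply: lt_bigmin => // k _; case: (Heta k).
  move=> k y h yr hh; apply: (Heta k).2 => //.
  by apply: (le_trans hh); exact: bigmin_le.
move=> [eta eta0 H]; exists eta => // y h yr hh.
have [c /andP[c0' c1] ->] := segment_mvt y h df.
rewrite -sumrB; under eq_bigr do rewrite -mulrBr.
apply: le_trans (norm_sum_coord_le _ (K := e / (1 + d%:R)) _) _.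
  move=> k; apply: H => //; rewrite normrZ (le_trans _ hh)// ler_piMl//.
  by rewrite ger0_norm.
rewrite ler_wpM2r// mulrCA ler_piMr ?(ltW e0)//.
by rewrite ler_pdivrMr// mul1r lerDr.
Qed.
End SegmentMVT.

(** * Differentiability uniform in time *)

Lemma fin_radius {R : realType} (T : finType) (P : T -> R -> Prop) :
  (forall k r s, s <= r -> P k r -> P k s) ->
  (forall k, exists2 r, 0 < r & P k r) -> exists2 r, 0 < r & forall k, P k r.
Proof.
move=> mono H.
have /choice[r Hr] : forall k, exists r, 0 < r /\ P k r.
  by move=> k; have [r ? ?] := H k; exists r.
exists (\big[Num.min/1]_k r k); first by apply: lt_bigmin => // k _; case: (Hr k).
by move=> k; apply: (mono k (r k)); [exact: bigmin_le|case: (Hr k)].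
Qed.

Section UniformDifferentiability.
Context {R : realType} {d : nat} (a : R).
Implicit Types (w u : R -> 'rV[R]_d -> R) (dw du : 'I_d -> R -> 'rV[R]_d -> R)
  (x v : 'rV[R]_d).

Definition ubnd w := exists2 K, 0 <= K & forall t x, `|t| < a -> `|w t x| <= K.

(* The time window is open, so that time derivatives are two-sided, and it will be
   taken of radius 2, to contain [-1, 1]. *)
Definition udiff w (dw : 'I_d -> R -> 'rV[R]_d -> R) := forall x e, 0 < e ->
  exists2 eta, 0 < eta & forall v, `|v| <= eta -> forall t, `|t| < a ->
    `|w t (x + v) - w t x - \sum_i v 0 i * dw i t x| <= e * `|v|.

(** The differential is carried as data, so that sums, products and compositions produce explicit
    derivatives. Expansions are pointwise in [x] but uniform in time, as [linearization] requires of
    its remainder, which Gronwall propagates over the whole window. *)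
Definition uC1 w dw := [/\ ubnd w, forall i, ubnd (dw i) & udiff w dw].

Lemma fin_bound n (P : 'I_n -> R -> Prop) :
  (forall k K K', K <= K' -> P k K -> P k K') ->
  (forall k, exists2 K, 0 <= K & P k K) ->
  exists2 K, 0 <= K & forall k, P k K.
Proof.
move=> mono H.
have /choice[K HK] : forall k, exists K, 0 <= K /\ P k K.
  by move=> k; have [K ? ?] := H k; exists K.
exists (\sum_k K k); first by apply: sumr_ge0 => k _; case: (HK k).
move=> k; apply: (mono k (K k)); last by case: (HK k).
by rewrite (bigD1 k)//= lerDl; apply: sumr_ge0 => j _; case: (HK j).
Qed.

Lemma ubnd_cst (c : R) : ubnd (fun _ _ => c).
Proof. by exists `|c|. Qed.

Lemma ubndD w u : ubnd w -> ubnd u -> ubnd (fun t x => w t x + u t x).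
Proof.
move=> [K K0 HK] [L L0 HL]; exists (K + L); first exact: addr_ge0.
by move=> t x ta; rewrite (le_trans (ler_normD _ _))// lerD ?HK ?HL.
Qed.

Lemma ubndM w u : ubnd w -> ubnd u -> ubnd (fun t x => w t x * u t x).
Proof.
move=> [K K0 HK] [L L0 HL]; exists (K * L); first exact: mulr_ge0.
by move=> t x ta; rewrite normrM ler_pM ?HK ?HL.
Qed.

Lemma ubnd_sum n (w : 'I_n -> R -> 'rV[R]_d -> R) : (forall k, ubnd (w k)) ->
  ubnd (fun t x => \sum_k w k t x).
Proof.
elim: n w => [|n IH] w Hw.
  by exists 0 => // t x _; rewrite big_ord0 normr0.
have [K K0 HK] := ubndD (IH (fun k => w (widen_ord (leqnSn n) k)) (fun k => Hw _)) (Hw ord_max).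
by exists K => // t x ta; rewrite big_ord_recr/=; exact: HK.
Qed.

Lemma udiff_lip w dw : (forall i, ubnd (dw i)) -> udiff w dw -> forall x,
  exists2 K, 0 <= K & exists2 eta, 0 < eta & forall v, `|v| <= eta ->
    forall t, `|t| < a -> `|w t (x + v) - w t x| <= K * `|v|.
Proof.
move=> Hb H x.
have [||K K0 HK] := @fin_bound _ (fun i K => forall t x, `|t| < a -> `|dw i t x| <= K).
- by move=> k K1 K2 K12 H1 t y ta; rewrite (le_trans (H1 _ _ ta)).
- by move=> i; have [K ? ?] := Hb i; exists K.
have [eta eta0 He] := H x 1 ltr01.
exists (1 + d%:R * K); first by rewrite addr_ge0// mulr_ge0.
exists eta => // v veta t ta.
rewrite -[_ - _](subrK (\sum_i v 0 i * dw i t x)) (le_trans (ler_normD _ _))//.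
rewrite mulrDl lerD//; first exact: He.
by apply: norm_sum_coord_le => i; exact: HK.
Qed.

Lemma uC1_cst (c : R) : uC1 (fun _ _ => c) (fun _ _ _ => 0).
Proof.
split; [exact: ubnd_cst|by move=> i; exact: ubnd_cst|].
move=> x e e0; exists 1 => // v _ t _; rewrite subrr big1 ?subr0 ?normr0 ?mulr_ge0 ?(ltW e0)//.
by move=> i _; rewrite mulr0.
Qed.

Lemma uC1D w dw u du : uC1 w dw -> uC1 u du ->
  uC1 (fun t x => w t x + u t x) (fun i t x => dw i t x + du i t x).
Proof.
move=> [bw bdw dfw] [bu bdu dfu]; split; [exact: ubndD|by move=> i; exact: ubndD|].
move=> x e e0; have e20 : 0 < e / 2 by rewrite divr_gt0.
have [eta eta0 H] := dfw x _ e20; have [eta' eta'0 H'] := dfu x _ e20.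
exists (Num.min eta eta'); first by rewrite lt_min eta0.
move=> v; rewrite le_min => /andP[v1 v2] t ta.
under eq_bigr do rewrite mulrDr; rewrite big_split/=.
have -> : forall p q r s m n : R, p + q - (r + s) - (m + n) = (p - r - m) + (q - s - n).
  by move=> *; ring.
rewrite (le_trans (ler_normD _ _))// (splitr e) mulrDl lerD//; [exact: H|exact: H'].
Qed.

Lemma uC1_sum n (w : 'I_n -> R -> 'rV[R]_d -> R) (dw : 'I_n -> 'I_d -> R -> 'rV[R]_d -> R) :
  (forall k, uC1 (w k) (dw k)) ->
  uC1 (fun t x => \sum_k w k t x) (fun i t x => \sum_k dw k i t x).
Proof.
elim: n w dw => [|n IH] w dw Hw.
  have -> : (fun t x => \sum_k w k t x) = (fun _ _ => 0).
    by apply/funext => t; apply/funext => x; rewrite big_ord0.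
  have -> : (fun i t x => \sum_k dw k i t x) = (fun _ _ _ => 0).
    by apply/funext => i; apply/funext => t; apply/funext => x; rewrite big_ord0.
  exact: uC1_cst.
have := uC1D (IH (fun k => w (widen_ord (leqnSn n) k)) _ (fun k => Hw _)) (Hw ord_max).
congr uC1.
  by apply/funext => t; apply/funext => x; rewrite big_ord_recr.
by apply/funext => i; apply/funext => t; apply/funext => x; rewrite big_ord_recr.
Qed.

Lemma uC1M w dw u du : uC1 w dw -> uC1 u du ->
  uC1 (fun t x => w t x * u t x) (fun i t x => dw i t x * u t x + w t x * du i t x).
Proof.
move=> [bw bdw dfw] [bu bdu dfu]; split; first exact: ubndM.
  by move=> i; apply: ubndD; exact: ubndM.
move=> x e e0.
have [Kw Kw0 HKw] := bw; have [Ku Ku0 HKu] := bu.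
have [L L0 [eta1 eta10 HL]] := udiff_lip bdw dfw x.
have [L' L'0 [eta2 eta20 HL']] := udiff_lip bdu dfu x.
pose e' := e / (Ku + Kw + 1).
have e'0 : 0 < e' by rewrite divr_gt0// ltr_wpDl// addr_ge0.
have [eta3 eta30 H] := dfw x _ e'0; have [eta4 eta40 H'] := dfu x _ e'0.
(* Radius at which the product of the two increments, quadratic in [v], is at most [e' * |v|]. *)
pose eta5 := e' / (L * L' + 1).
have LL : 0 < L * L' + 1 by rewrite ltr_wpDl// mulr_ge0.
have eta50 : 0 < eta5 by rewrite divr_gt0.
exists (Num.min (Num.min (Num.min eta1 eta2) (Num.min eta3 eta4)) eta5).
  by rewrite !lt_min eta10 eta20 eta30 eta40.
move=> v; rewrite !le_min => /andP[/andP[/andP[v1 v2] /andP[v3 v4]] v5] t ta.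
have -> : \sum_i v 0 i * (dw i t x * u t x + w t x * du i t x) =
   (\sum_i v 0 i * dw i t x) * u t x + w t x * (\sum_i v 0 i * du i t x).
  rewrite mulr_suml mulr_sumr -big_split; apply: eq_bigr => i _ /=; ring.
have -> : forall p q r s m n : R, p * q - r * s - (m * s + r * n) =
   (p - r - m) * s + r * (q - s - n) + (p - r) * (q - s) by move=> *; ring.
apply: (le_trans (ler_normD _ _)).
apply: (@le_trans _ _ (e' * `|v| * Ku + Kw * (e' * `|v|) + e' * `|v|)); last first.
  have -> : e = e' * (Ku + Kw + 1).
    by rewrite /e' divfK// gt_eqF// ltr_wpDl// addr_ge0.
  by rewrite le_eqVlt; apply/orP; left; apply/eqP; ring.
apply: lerD.
  apply: (le_trans (ler_normD _ _)); rewrite !normrM.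
  by apply: lerD; rewrite ler_pM// ?HKw ?HKu ?H ?H'.
rewrite normrM; apply: (@le_trans _ _ ((L * `|v|) * (L' * `|v|))).
  by rewrite ler_pM// ?HL ?HL'.
have -> : L * `|v| * (L' * `|v|) = (L * L') * `|v| * `|v| by ring.
rewrite ler_wpM2r//; apply: (@le_trans _ _ ((L * L' + 1) * `|v|)).
  by rewrite ler_wpM2r// lerDl.
by rewrite mulrC -ler_pdivlMr.
Qed.
End UniformDifferentiability.

Lemma norm_le_sum {R : realType} {d : nat} (h : 'rV[R]_d) : `|h| <= \sum_j `|h 0 j|.
Proof.
rewrite [leLHS]/Num.Def.normr/= mx_normrE bigmax_le//=; first exact: sumr_ge0.
move=> [i j] _ /=; rewrite (ord1 i) (bigD1 j)//= lerDl; exact: sumr_ge0.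
Qed.

Lemma norm_le_coord {R : realType} {d : nat} (h : 'rV[R]_d) (B : R) :
  0 <= B -> (forall k, `|h 0 k| <= B) -> `|h| <= B.
Proof.
move=> B0 H; rewrite [leLHS]/Num.Def.normr/= mx_normrE bigmax_le//=.
by move=> [i j] _ /=; rewrite (ord1 i).
Qed.

(** * Differentiability of the flow in the initial condition *)

Definition coordf {R : realType} {d n : nat} (b : 'rV[R]_d -> 'rV[R]_n) (k : 'I_n) :
  'rV[R]_d -> R := fun y => b y 0 k.

Section FlowRegularity.
Context {R : realType} {d : nat} (b : 'rV[R]_d -> 'rV[R]_d)
  (phi : R -> 'rV[R]_d -> 'rV[R]_d) (hphi : is_flow b phi).
Context (a : R) (a0 : 0 < a).
Local Notation bc := (coordf b).
Context (hb : forall k, Ck 3 (bc k)).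
Context (B1 : R) (B10 : 0 <= B1) (hB1 : forall j k x, `|partial j (bc k) x| <= B1).

Lemma is_derive_coord (F : R -> 'rV[R]_d) (t : R) (dF : 'rV[R]_d) (k : 'I_d) :
  is_derive t 1 F dF -> is_derive t 1 (fun s => F s 0 k) (dF 0 k).
Proof.
move=> [H1 H2]; have := (derivable_mxP F t 1).1 H1 0 k => H3.
by split => //; rewrite -H2 derive_mx// mxE.
Qed.

Lemma flow_coord x (k : 'I_d) (t : R) : is_derive t 1 (fun s => phi s x 0 k) (bc k (phi t x)).
Proof. by apply: is_derive_coord; case: hphi => _; apply. Qed.

Let bdiff k x : differentiable (bc k) x. Proof. by case: (hb k). Qed.

(** A bounded gradient gives [b] affine growth, so Gronwall confines a trajectory to a ball, on
    which first-order expansions are uniform. *)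
Lemma flow_bounded x : exists2 r, 0 <= r & forall t, `|t| < a -> `|phi t x| <= r.
Proof.
pose m := \sum_k `|bc k 0|.
have m0 : 0 <= m by apply: sumr_ge0.
have g0 := le_trans ler01 (gconst_ge1 d (d%:R * B1) (ltW a0)).
exists (gconst d (d%:R * B1) a * (`|x| + m)); first by rewrite mulr_ge0// addr_ge0.
move=> t ta; apply: norm_le_coord => [|k]; first by rewrite mulr_ge0// addr_ge0.
apply: (@gronwall_vec _ _ (fun k s => phi s x 0 k) (fun k s => bc k (phi s x)) a _ _ _ t 0) => //.
- by move=> *; exact: flow_coord.
- move=> j r ra; have := grad_bound_lip (bdiff j) (fun i => hB1 i j) 0 (phi r x).
  rewrite add0r => H.
  rewrite -[bc j _](subrK (bc j 0)) (le_trans (ler_normD _ _))// lerD//.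
    by apply: (le_trans H); rewrite ler_wpM2l ?mulr_ge0//; exact: norm_le_sum.
  by rewrite /m (bigD1 j)//= lerDl; apply: sumr_ge0.
- by rewrite mulr_ge0.
- by rewrite normr0.
- by move=> j; case: hphi => -> _; exact: coord_le_norm.
Qed.

Lemma flow_lip x v t : `|t| < a ->
  `|phi t (x + v) - phi t x| <= gconst d (d%:R * B1) a * `|v|.
Proof.
move=> ta.
have g0 := le_trans ler01 (gconst_ge1 d (d%:R * B1) (ltW a0)).
apply: norm_le_coord => [|k]; first by rewrite mulr_ge0.
rewrite !mxE -[`|v|]addr0.
apply: (@gronwall_vec _ _ (fun k s => phi s (x + v) 0 k - phi s x 0 k)
  (fun k s => bc k (phi s (x + v)) - bc k (phi s x)) a _ _ _ t 0) => //.
- by move=> j r ra; apply: is_deriveB; exact: flow_coord.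
- move=> j r ra; have := grad_bound_lip (bdiff j) (fun i => hB1 i j) (phi r x) (phi r (x + v) - phi r x).
  rewrite addrCA subrr addr0 addr0 => H; apply: (le_trans H); rewrite ler_wpM2l ?mulr_ge0//.
  apply: (le_trans (norm_le_sum _)); apply: ler_sum => i _; by rewrite !mxE.
- by rewrite mulr_ge0.
- by rewrite normr0.
- by move=> j; case: hphi => H _; rewrite !H !mxE [_ + v 0 j]addrC addrK; exact: coord_le_norm.
Qed.

(** [Y i k] is the derivative of the [k]-th component of the flow in the [i]-th initial coordinate.
    For each fixed [x] it comes from [linearization] applied to [phi t (x + v) - phi t x]. *)
Lemma flow_diff : exists Y : 'I_d -> 'I_d -> R -> 'rV[R]_d -> R,
  [/\ forall i k x (t : R), `|t| < a -> is_derive t 1 (fun s => Y i k s x)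
        (\sum_j partial j (bc k) (phi t x) * Y i j t x),
      forall i k x, Y i k 0 x = (i == k)%:R,
      forall i k, ubnd a (Y i k) &
      forall k, udiff a (fun t x => phi t x 0 k) (fun i => Y i k)].
Proof.
(* One constant dominates both the coefficients, at most [B1], and the initial values, which are 0
   or 1. *)
pose B := 1 + B1.
have B0 : 0 <= B by rewrite addr_ge0.
have HB j k x : `|partial j (bc k) x| <= B by rewrite (le_trans (hB1 _ _ _))// lerDr.
have key x : exists Z : 'I_d -> 'I_d -> R -> R,
  [/\ forall i k (t : R), `|t| < a ->
        is_derive t 1 (Z i k) (\sum_j partial j (bc k) (phi t x) * Z i j t + 0),
      forall i k, Z i k 0 = (i == k)%:R,
      forall i k t, `|t| < a -> `|Z i k t| <= gconst d B a * (B + B) &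
      forall e, 0 < e -> exists2 eta, 0 < eta & forall v, `|v| <= eta ->
        forall t k, `|t| < a ->
        `|(phi t (x + v) 0 k - phi t x 0 k) - \sum_i v 0 i * Z i k t| <= e * `|v|].
  apply: (@linearization _ _ _ (fun v k t => phi t (x + v) 0 k - phi t x 0 k)
    (fun v k t => bc k (phi t (x + v)) - bc k (phi t x))
    (fun k j t => partial j (bc k) (phi t x)) (fun _ _ _ => 0)
    (fun i k => (i == k)%:R) B a) => //.
  - by move=> v k t ta; apply: is_deriveB; exact: flow_coord.
  - move=> v k; case: hphi => H _; rewrite !H mxE addrAC subrr add0r.
    rewrite (bigD1 k)//= eqxx mulr1 big1 ?addr0// => i /negbTE ->.
    by rewrite mulr0.
  - by move=> *; rewrite normr0.
  - by move=> i k; case: eqP => _; rewrite ?normr1 ?normr0// lerDl.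
  - move=> e e0; have [r r0 Hr] := flow_bounded x.
    have Hc k : Ck 1 (bc k).
      have [? H] := hb k; split=> // i; have [? ?] := H i.
      by move=> y; exact: differentiable_continuous.
    have [||eta eta0 Heta] := @fin_radius R _ (fun k eta => forall y h, `|y| <= r -> `|h| <= eta ->
      `|bc k (y + h) - bc k y - \sum_j h 0 j * partial j (bc k) y| <= e * `|h|).
    + by move=> k r1 r2 r12 H y h yr hr; apply: H => //; exact: le_trans r12.
    + by move=> k; exact: unif_diff_ball.
    have g0 := lt_le_trans ltr01 (gconst_ge1 d (d%:R * B1) (ltW a0)).
    exists (eta / gconst d (d%:R * B1) a); first by rewrite divr_gt0.
    move=> v veta t k ta; rewrite [X in _ - X]big1 ?subr0; last by move=> i _; rewrite mulr0.
    have hle : `|phi t (x + v) - phi t x| <= eta.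
      apply: (le_trans (flow_lip x v ta)); rewrite mulrC -ler_pdivlMr//.
    have := Heta k (phi t x) _ (Hr t ta) hle.
    rewrite [phi t x + _]addrC subrK => H.
    have -> : \sum_j partial j (bc k) (phi t x) * (phi t (x + v) 0 j - phi t x 0 j) =
      \sum_j (phi t (x + v) - phi t x) 0 j * partial j (bc k) (phi t x).
      by apply: eq_bigr => j _; rewrite mulrC !mxE.
    apply: (le_trans H); rewrite ler_wpM2l ?(ltW e0)//.
    apply: (le_trans (norm_le_sum _)); rewrite ler_wpDl//.
    by apply: ler_sum => j _; rewrite !mxE.
have [Z HZ] := choice key.
exists (fun i k t x => Z x i k t); split.
- by move=> i k x t ta; have [H _ _ _] := HZ x; have := H i k t ta; rewrite addr0.
- by move=> i k x; have [_ H _ _] := HZ x.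
- move=> i k; exists (gconst d B a * (B + B)).
    by apply: mulr_ge0; [apply: (le_trans ler01); apply: gconst_ge1; exact: ltW|exact: addr_ge0].
  by move=> t x ta; have [_ _ H _] := HZ x; exact: H.
- move=> k x e e0; have [_ _ _ H] := HZ x; have [eta eta0 He] := H e e0.
  by exists eta => // v veta t ta; exact: He.
Qed.

Context (Y : 'I_d -> 'I_d -> R -> 'rV[R]_d -> R).
Context (bY : forall i k, ubnd a (Y i k)).
Context (dY : forall k, udiff a (fun t x => phi t x 0 k) (fun i => Y i k)).

(** Chain rule uniform in time: half of the tolerance goes to the expansion of [f] on a ball
    containing the trajectory, half to the expansion of the flow. *)
Lemma uC1_comp_flow f (K : R) : Ck 1 f -> (forall x, `|f x| <= K) ->
  (forall k x, `|partial k f x| <= K) ->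
  uC1 a (fun t x => f (phi t x)) (fun i t x => \sum_k Y i k t x * partial k f (phi t x)).
Proof.
move=> cf fK dfK.
have bound w : (forall x, `|w x| <= K) -> ubnd a (fun t x => w (phi t x)).
  by move=> wK; exists `|K| => // t x _; rewrite (le_trans (wK _))// ler_norm.
split; first exact: bound.
  by move=> i; apply: ubnd_sum => k; apply: ubndM => //; apply: bound => x; exact: dfK.
move=> x e e0.
have K0 : 0 <= K by apply: le_trans (fK 0).
have [r r0 Hr] := flow_bounded x.
set g := gconst d (d%:R * B1) a.
have g0 : 0 < g := lt_le_trans ltr01 (gconst_ge1 d (d%:R * B1) (ltW a0)).
have e2g : 0 < e / 2 / g by rewrite !divr_gt0.
have [eta eta0 Heta] := unif_diff_ball r cf e2g.
have c0 : 0 < d%:R * K + 1 :> R by rewrite ltr_wpDl// mulr_ge0.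
have e2K : 0 < e / 2 / (d%:R * K + 1) by rewrite !divr_gt0.
have [||eta1 eta10 Heta1] := @fin_radius R _ (fun k eta => forall v, `|v| <= eta ->
   forall t, `|t| < a -> `|phi t (x + v) 0 k - phi t x 0 k - \sum_i v 0 i * Y i k t x| <= e / 2 / (d%:R * K + 1) * `|v|).
- by move=> k r1 r2 r12 H v hr; apply: H => //; exact: le_trans r12.
- by move=> k; exact: dY.
exists (Num.min (eta / g) eta1).
  by rewrite lt_min divr_gt0.
move=> v; rewrite le_min => /andP[v1 v2] t ta.
have hle := flow_lip x v ta; rewrite -/g in hle.
have heta : `|phi t (x + v) - phi t x| <= eta.
  by apply: (le_trans hle); rewrite mulrC -ler_pdivlMr.
have := Heta (phi t x) _ (Hr t ta) heta.
rewrite [phi t x + _]addrC subrK => H.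
have -> : \sum_i v 0 i * (\sum_k Y i k t x * partial k f (phi t x)) =
  \sum_k (\sum_i v 0 i * Y i k t x) * partial k f (phi t x).
  under eq_bigr do rewrite mulr_sumr.
  rewrite exchange_big/=; apply: eq_bigr => k _; rewrite mulr_suml.
  by apply: eq_bigr => i _; rewrite mulrA.
have -> : f (phi t (x + v)) - f (phi t x) - \sum_k (\sum_i v 0 i * Y i k t x) * partial k f (phi t x) =
  (f (phi t (x + v)) - f (phi t x) - \sum_k (phi t (x + v) - phi t x) 0 k * partial k f (phi t x)) +
  \sum_k partial k f (phi t x) * (phi t (x + v) 0 k - phi t x 0 k - \sum_i v 0 i * Y i k t x).
  have -> : \sum_k partial k f (phi t x) * (phi t (x + v) 0 k - phi t x 0 k - \sum_i v 0 i * Y i k t x)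
    = \sum_k (phi t (x + v) - phi t x) 0 k * partial k f (phi t x) - \sum_k (\sum_i v 0 i * Y i k t x) * partial k f (phi t x).
    by rewrite -sumrB; apply: eq_bigr => k _; rewrite mulrC -mulrBl !mxE.
  ring.
apply: (le_trans (ler_normD _ _)); rewrite (splitr e) mulrDl; apply: lerD.
  apply: (le_trans H); rewrite -[e / 2 / g * _]mulrA ler_wpM2l ?divr_ge0 ?(ltW e0)//.
  by rewrite ler_pdivrMl.
apply: (le_trans (norm_sumM_le _ (fun k => dfK k (phi t x)))).
apply: (@le_trans _ _ (K * (d%:R * (e / 2 / (d%:R * K + 1) * `|v|)))).
  rewrite ler_wpM2l//; apply: sum_le_const => k; exact: Heta1.
have -> : K * (d%:R * (e / 2 / (d%:R * K + 1) * `|v|)) = e / 2 * `|v| * ((d%:R * K) / (d%:R * K + 1)).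
  by ring.
by rewrite ler_piMr ?mulr_ge0 ?divr_ge0 ?(ltW e0)// ler_pdivrMr// mul1r lerDl.
Qed.

Context (B2 : R) (hB2 : forall i j k x, `|partial i (partial j (bc k)) x| <= B2).

Definition drift_jac j k : R -> 'rV[R]_d -> R := fun t x => partial j (bc k) (phi t x).
Definition drift_jac_diff j k i : R -> 'rV[R]_d -> R :=
  fun t x => \sum_l Y i l t x * partial l (partial j (bc k)) (phi t x).
Local Notation P := drift_jac.
Local Notation dP := drift_jac_diff.

Lemma uC1_drift_jac j k : uC1 a (P j k) (dP j k).
Proof.
apply: (@uC1_comp_flow (partial j (bc k)) (Num.max B1 B2)).
- have [_ H] := hb k; have [H1 H2] := H j; split => // i.
  by have [H3 _] := H2 i => x; exact: differentiable_continuous.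
- by move=> x; rewrite le_max hB1.
- by move=> i x; rewrite le_max hB2 orbT.
Qed.

(* One more derivative in the initial condition: applied to [Y = D phi] and then to
   its derivative, it gives the second and third derivatives of the flow. *)
Lemma variational_udiff (u g : 'I_d -> R -> 'rV[R]_d -> R) (dg : 'I_d -> 'I_d -> R -> 'rV[R]_d -> R)
    (c : 'I_d -> R) :
  (forall k x (t : R), `|t| < a -> is_derive t 1 (fun s => u k s x)
     (\sum_j P j k t x * u j t x + g k t x)) ->
  (forall k x, u k 0 x = c k) -> (forall k, ubnd a (u k)) ->
  (forall k, uC1 a (g k) (dg k)) ->
  exists Z : 'I_d -> 'I_d -> R -> 'rV[R]_d -> R,
  [/\ forall i k x (t : R), `|t| < a -> is_derive t 1 (fun s => Z i k s x)
        (\sum_j P j k t x * Z i j t x + (\sum_j dP j k i t x * u j t x + dg k i t x)),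
      forall i k x, Z i k 0 x = 0,
      forall i k, ubnd a (Z i k) &
      forall k, udiff a (u k) (fun i => Z i k)].
Proof.
move=> Hu u0 bu cg.
have g2b i k : ubnd a (fun t x => \sum_j dP j k i t x * u j t x + dg k i t x).
  apply: ubndD; last by case: (cg k).
  by apply: ubnd_sum => j; apply: ubndM => //; case: (uC1_drift_jac j k).
have [K [K0 HK]] : exists K, 0 <= K /\ [/\ forall k j t x, `|t| < a -> `|P j k t x| <= K,
   forall i k t x, `|t| < a -> `|\sum_j dP j k i t x * u j t x + dg k i t x| <= K &
   forall j t x, `|t| < a -> `|u j t x| <= K].
  have [||K1 K10 HK1] := @fin_bound R _ (fun i K => forall k t x, `|t| < a -> `|\sum_j dP j k i t x * u j t x + dg k i t x| <= K).
  - by move=> i K K' KK H k t x ta; rewrite (le_trans (H _ _ _ ta)).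
  - move=> i; have [||K2 K20 HK2] := @fin_bound R _ (fun k K => forall t x, `|t| < a -> `|\sum_j dP j k i t x * u j t x + dg k i t x| <= K).
    + by move=> k K K' KK H t x ta; rewrite (le_trans (H _ _ ta)).
    + by move=> k; exact: g2b.
    + by exists K2.
  have [||K3 K30 HK3] := @fin_bound R _ (fun k K => forall t x, `|t| < a -> `|u k t x| <= K).
  - by move=> k K K' KK H t x ta; rewrite (le_trans (H _ _ ta)).
  - by move=> k; exact: bu.
  exists (B1 + (K1 + K3)); split; first by rewrite !addr_ge0.
  split.
  - by move=> k j t x _; rewrite (le_trans (hB1 _ _ _))// lerDl addr_ge0.
  - by move=> i k t x ta; rewrite (le_trans (HK1 _ _ _ _ ta))//; rewrite addrCA lerDl addr_ge0.
  - by move=> k t x ta; rewrite (le_trans (HK3 _ _ _ ta))//; rewrite addrA lerDr addr_ge0.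
have [PK gK uK] := HK.
have key x : exists Z : 'I_d -> 'I_d -> R -> R,
  [/\ forall i k (t : R), `|t| < a ->
        is_derive t 1 (Z i k) (\sum_j P j k t x * Z i j t + (\sum_j dP j k i t x * u j t x + dg k i t x)),
      forall i k, Z i k 0 = 0,
      forall i k t, `|t| < a -> `|Z i k t| <= gconst d K a * (K + K) &
      forall e, 0 < e -> exists2 eta, 0 < eta & forall v, `|v| <= eta ->
        forall t k, `|t| < a ->
        `|(u k t (x + v) - u k t x) - \sum_i v 0 i * Z i k t| <= e * `|v|].
  apply: (@linearization _ _ _ (fun v k t => u k t (x + v) - u k t x)
    (fun v k t => (\sum_j P j k t (x + v) * u j t (x + v) + g k t (x + v)) - (\sum_j P j k t x * u j t x + g k t x))
    (fun k j t => P j k t x) (fun i k t => \sum_j dP j k i t x * u j t x + dg k i t x)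
    (fun i k => 0) K a) => //.
  - by move=> v k t ta; apply: is_deriveB; exact: Hu.
  - by move=> v k; rewrite !u0 subrr big1// => i _; rewrite mulr0.
  - by move=> k j t ta; exact: PK.
  - by move=> i k t ta; exact: gK.
  - by move=> *; rewrite normr0.
  - move=> e e0.
    pose e1 := e / (d%:R * K + 1).
    have c0 : 0 < d%:R * K + 1 :> R by rewrite ltr_wpDl// mulr_ge0.
    have e10 : 0 < e1 by rewrite divr_gt0.
    have [eta1 eta10 H1] : exists2 eta, 0 < eta & forall k v, `|v| <= eta -> forall t, `|t| < a ->
      `|g k t (x + v) - g k t x - \sum_i v 0 i * dg k i t x| <= e1 * `|v|.
      apply: (@fin_radius R _ (fun k eta => forall v, `|v| <= eta -> forall t, `|t| < a ->
        `|g k t (x + v) - g k t x - \sum_i v 0 i * dg k i t x| <= e1 * `|v|)).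
        by move=> k r1 r2 r12 H v hr; apply: H => //; exact: le_trans r12.
      by move=> k; have [_ _ H] := cg k; exact: H.
    have [eta2 eta20 H2] : exists2 eta, 0 < eta & forall j k v, `|v| <= eta -> forall t, `|t| < a ->
      `|P j k t (x + v) - P j k t x - \sum_i v 0 i * dP j k i t x| <= e1 * `|v|.
      have [||eta eta0 H] := @fin_radius R _ (fun jk : 'I_d * 'I_d => fun eta => forall v, `|v| <= eta -> forall t, `|t| < a ->
        `|P jk.1 jk.2 t (x + v) - P jk.1 jk.2 t x - \sum_i v 0 i * dP jk.1 jk.2 i t x| <= e1 * `|v|).
      + by move=> k r1 r2 r12 H v hr; apply: H => //; exact: le_trans r12.
      + by move=> jk; have [_ _ H] := uC1_drift_jac jk.1 jk.2; exact: H.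
      + by exists eta => // j k; exact: H (j, k).
    have [eta3 eta30 H3] : exists2 eta, 0 < eta & forall j k v, `|v| <= eta -> forall t, `|t| < a ->
      `|P j k t (x + v) - P j k t x| <= e.
      have [||eta eta0 H] := @fin_radius R _ (fun jk : 'I_d * 'I_d => fun eta => forall v, `|v| <= eta -> forall t, `|t| < a ->
        `|P jk.1 jk.2 t (x + v) - P jk.1 jk.2 t x| <= e).
      + by move=> k r1 r2 r12 H v hr; apply: H => //; exact: le_trans r12.
      + move=> jk; have [_ bd H] := uC1_drift_jac jk.1 jk.2; have [L L0 [eta eta0 He]] := udiff_lip bd H x.
        have L10 : 0 < L + 1 by rewrite ltr_wpDl.
        exists (Num.min eta (e / (L + 1))); first by rewrite lt_min eta0 divr_gt0.
        move=> v; rewrite le_min => /andP[v1 v2] t ta; apply: (le_trans (He v v1 t ta)).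
        apply: (@le_trans _ _ ((L + 1) * `|v|)); first by rewrite ler_wpM2r// lerDl.
        by rewrite mulrC -ler_pdivlMr.
      + by exists eta => // j k; exact: H (j, k).
    exists (Num.min (Num.min eta1 eta2) eta3); first by rewrite !lt_min eta10 eta20.
    move=> v; rewrite !le_min => /andP[/andP[v1 v2] v3] t k ta.
    (* The product of two increments is at most [e] times the increments of [u], a term that the
       remainder of [linearization] tolerates; the other two sums are first-order remainders and
       share [e * |v|]. *)
    have -> : \sum_j P j k t (x + v) * u j t (x + v) + g k t (x + v) -
       (\sum_j P j k t x * u j t x + g k t x) -
       \sum_j P j k t x * (u j t (x + v) - u j t x) -
       \sum_i v 0 i * (\sum_j dP j k i t x * u j t x + dg k i t x) =
      (\sum_j (P j k t (x + v) - P j k t x) * (u j t (x + v) - u j t x) +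
       \sum_j (P j k t (x + v) - P j k t x - \sum_i v 0 i * dP j k i t x) * u j t x) +
      (g k t (x + v) - g k t x - \sum_i v 0 i * dg k i t x).
      have -> : \sum_i v 0 i * (\sum_j dP j k i t x * u j t x + dg k i t x) =
        \sum_j (\sum_i v 0 i * dP j k i t x) * u j t x + \sum_i v 0 i * dg k i t x.
        under eq_bigr do rewrite mulrDr mulr_sumr.
        rewrite big_split/= exchange_big/=; congr (_ + _); apply: eq_bigr => j _.
        by rewrite mulr_suml; apply: eq_bigr => i _; rewrite mulrA.
      have -> : \sum_j (P j k t (x + v) - P j k t x) * (u j t (x + v) - u j t x) +
         \sum_j (P j k t (x + v) - P j k t x - \sum_i v 0 i * dP j k i t x) * u j t x =
        \sum_j P j k t (x + v) * u j t (x + v) - \sum_j P j k t x * u j t x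
        - \sum_j P j k t x * (u j t (x + v) - u j t x)
        - \sum_j (\sum_i v 0 i * dP j k i t x) * u j t x.
        by rewrite -big_split -!sumrB/=; apply: eq_bigr => j _; ring.
      ring.
    apply: (le_trans (ler_normD _ _)); apply: (le_trans (lerD (ler_normD _ _) (lexx _))).
    have L1 : `|\sum_j (P j k t (x + v) - P j k t x) * (u j t (x + v) - u j t x)| <=
      e * \sum_j `|u j t (x + v) - u j t x|.
      by apply: norm_sumM_le => j; exact: H3.
    have L2 : `|\sum_j (P j k t (x + v) - P j k t x - \sum_i v 0 i * dP j k i t x) * u j t x| <=
      e1 * `|v| * (d%:R * K).
      apply: (le_trans (norm_sumM_le _ (fun j => H2 j k v v2 t ta))).
      have S : \sum_j `|u j t x| <= d%:R * K by apply: sum_le_const => j; exact: uK.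
      by rewrite ler_wpM2l// mulr_ge0// ltW.
    have L3 := H1 k v v1 t ta.
    have -> : e * (`|v| + \sum_j `|u j t (x + v) - u j t x|) =
      e * \sum_j `|u j t (x + v) - u j t x| + e1 * `|v| * (d%:R * K) + e1 * `|v|.
      by rewrite /e1; field; rewrite gt_eqF.
    by rewrite !lerD.
have [Z HZ] := choice key.
exists (fun i k t x => Z x i k t); split.
- by move=> i k x t ta; have [H _ _ _] := HZ x; exact: H.
- by move=> i k x; have [_ H _ _] := HZ x.
- move=> i k; exists (gconst d K a * (K + K)).
    by apply: mulr_ge0; [apply: (le_trans ler01); apply: gconst_ge1; exact: ltW|exact: addr_ge0].
  by move=> t x ta; have [_ _ H _] := HZ x; exact: H.
- move=> k x e e0; have [_ _ _ H] := HZ x; have [eta eta0 He] := H e e0.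
  by exists eta => // v veta t ta; exact: He.
Qed.
End FlowRegularity.

(** * Rules for partial derivatives, and families of functions close to a constant in the C^2
    norm *)

Section PartialCalculus.
Context {R : realType} {d : nat}.
Implicit Types (f g : 'rV[R]_d -> R) (x : 'rV[R]_d).

Lemma partial_cst (c : R) i : partial i (fun _ : 'rV[R]_d => c) = fun=> 0.
Proof. by apply/funext => x; rewrite /partial derive_cst. Qed.

Lemma partialD f g i : (forall x, differentiable f x) -> (forall x, differentiable g x) ->
  partial i (fun x => f x + g x) = fun x => partial i f x + partial i g x.
Proof.
by move=> df dg; apply/funext => x; rewrite /partial deriveD//; exact: diff_derivable.
Qed.

Lemma partialM f g i : (forall x, differentiable f x) -> (forall x, differentiable g x) ->
  partial i (fun x => f x * g x) = fun x => partial i f x * g x + f x * partial i g x.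
Proof.
move=> df dg; apply/funext => x; rewrite /partial deriveM//; last 2 first.
  exact: diff_derivable.
  exact: diff_derivable.
by rewrite /GRing.scale /= addrC mulrC.
Qed.

Lemma twice_diff_cst (c : R) : twice_differentiable (fun _ : 'rV[R]_d => c).
Proof. by split=> // i x; rewrite partial_cst. Qed.

Lemma twice_diffD f g : twice_differentiable f -> twice_differentiable g ->
  twice_differentiable (fun x => f x + g x).
Proof.
move=> [df ddf] [dg ddg]; split=> [x|i x]; first exact: differentiableD.
by rewrite partialD//; apply: differentiableD.
Qed.

Lemma twice_diffM f g : twice_differentiable f -> twice_differentiable g ->
  twice_differentiable (fun x => f x * g x).
Proof.
move=> [df ddf] [dg ddg]; split=> [x|i x]; first exact: differentiableM.
by rewrite partialM//; apply: differentiableD; apply: differentiableM.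
Qed.

Definition jet_near (c M : R) f := [/\ twice_differentiable f,
  forall x, `|f x - c| <= M, forall i x, `|partial i f x| <= M &
  forall i j x, `|partial i (partial j f) x| <= M].

(* The function [w t] is the constant [c] up to [O(t)] in the C^2 norm. *)
Definition jet_family (c : R) (w : R -> 'rV[R]_d -> R) :=
  exists2 K, 0 <= K & forall t, `|t| <= 1 -> jet_near c (K * `|t|) (w t).

Lemma jet_family_cst (c : R) : jet_family c (fun _ _ => c).
Proof.
exists 0 => // t _; split; first exact: twice_diff_cst.
- by move=> x; rewrite subrr normr0 mul0r.
- by move=> i x; rewrite partial_cst normr0 mul0r.
- by move=> i j x; rewrite !partial_cst normr0 mul0r.
Qed.

Lemma jet_familyD c e w u : jet_family c w -> jet_family e u ->
  jet_family (c + e) (fun t x => w t x + u t x).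
Proof.
move=> [K K0 HK] [L L0 HL]; exists (K + L); first exact: addr_ge0.
move=> t t1; have [[dw ddw] w0 w1 w2] := HK t t1; have [[du ddu] u0 u1 u2] := HL t t1.
rewrite mulrDl; split; first exact: twice_diffD.
- move=> x; have -> : w t x + u t x - (c + e) = (w t x - c) + (u t x - e) by ring.
  by rewrite (le_trans (ler_normD _ _))// lerD.
- by move=> i x; rewrite partialD// (le_trans (ler_normD _ _))// lerD.
- move=> i j x; rewrite !partialD// (le_trans (ler_normD _ _))// lerD//.
Qed.

(** Terms quadratic in [t] are absorbed by [|t| * |t| <= |t|] on the window of radius 1. *)
Lemma jet_familyM c e w u : jet_family c w -> jet_family e u ->
  jet_family (c * e) (fun t x => w t x * u t x).
Proof.
move=> [K K0 HK] [L L0 HL].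
pose D := K * (`|e| + L) + (`|c| + K) * L + (K * L + K * L).
have D1 : K * (`|e| + L) + (`|c| + K) * L <= D by rewrite lerDl addr_ge0// mulr_ge0.
exists D; first by rewrite !addr_ge0// mulr_ge0// addr_ge0.
move=> t t1; have [[dw ddw] w0 w1 w2] := HK t t1; have [[du ddu] u0 u1 u2] := HL t t1.
have bw x : `|w t x| <= `|c| + K.
  rewrite -[w t x](subrK c) addrC (le_trans (ler_normD _ _))// lerD2l.
  by rewrite (le_trans (w0 x))// ler_piMr.
have bu x : `|u t x| <= `|e| + L.
  rewrite -[u t x](subrK e) addrC (le_trans (ler_normD _ _))// lerD2l.
  by rewrite (le_trans (u0 x))// ler_piMr.
have tt : `|t| * `|t| <= `|t| by rewrite ler_piMr.
split; first exact: twice_diffM.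
- move=> x; have -> : w t x * u t x - c * e = (w t x - c) * u t x + c * (u t x - e) by ring.
  apply: (@le_trans _ _ ((K * (`|e| + L) + (`|c| + K) * L) * `|t|)); last by rewrite ler_wpM2r.
  rewrite [leRHS]mulrDl (le_trans (ler_normD _ _)) // lerD // normrM.
    by rewrite mulrAC ler_pM.
  by rewrite -mulrA ler_pM// lerDl.
- move=> i x; rewrite partialM//.
  apply: (@le_trans _ _ ((K * (`|e| + L) + (`|c| + K) * L) * `|t|)); last by rewrite ler_wpM2r.
  rewrite [leRHS]mulrDl (le_trans (ler_normD _ _)) // lerD // normrM.
    by rewrite mulrAC ler_pM.
  by rewrite -mulrA ler_pM.
- move=> i j x; rewrite partialM// partialD; last 2 first.
  + by move=> y; apply: differentiableM.
  + by move=> y; apply: differentiableM.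
  rewrite !partialM//.
  have -> : D * `|t| = (K * `|t| * (`|e| + L) + K * L * `|t|) + (K * L * `|t| + (`|c| + K) * (L * `|t|)).
    by rewrite /D; ring.
  have m1 : (K * `|t|) * (L * `|t|) <= K * L * `|t|.
    have -> : (K * `|t|) * (L * `|t|) = K * L * (`|t| * `|t|) by ring.
    by rewrite ler_wpM2l// mulr_ge0.
  have D4 (a1 a2 a3 a4 b1 b2 b3 b4 : R) : `|a1| <= b1 -> `|a2| <= b2 -> `|a3| <= b3 -> `|a4| <= b4 ->
    `|a1 + a2 + (a3 + a4)| <= b1 + b2 + (b3 + b4).
    move=> h1 h2 h3 h4; rewrite (le_trans (ler_normD _ _))// lerD//.
      by rewrite (le_trans (ler_normD _ _))// lerD.
    by rewrite (le_trans (ler_normD _ _))// lerD.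
  apply: D4.
  + by rewrite normrM ler_pM.
  + by rewrite normrM (le_trans _ m1)// ler_pM.
  + by rewrite normrM (le_trans _ m1)// ler_pM.
  + by rewrite normrM ler_pM.
Qed.

Lemma jet_family_sum (I : Type) (r : seq I) (c : I -> R) (w : I -> R -> 'rV[R]_d -> R) :
  (forall k, jet_family (c k) (w k)) ->
  jet_family (\sum_(k <- r) c k) (fun t x => \sum_(k <- r) w k t x).
Proof.
move=> H; elim: r => [|k r IH].
  have := jet_family_cst 0; congr jet_family; first by rewrite big_nil.
  by apply/funext => t; apply/funext => x; rewrite big_nil.
have := jet_familyD (H k) IH; congr jet_family; first by rewrite big_cons.
by apply/funext => t; apply/funext => x; rewrite big_cons.
Qed.

Lemma jet_family_prod (I : Type) (r : seq I) (c : I -> R) (w : I -> R -> 'rV[R]_d -> R) :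
  (forall k, jet_family (c k) (w k)) ->
  jet_family (\prod_(k <- r) c k) (fun t x => \prod_(k <- r) w k t x).
Proof.
move=> H; elim: r => [|k r IH].
  have := jet_family_cst 1; congr jet_family; first by rewrite big_nil.
  by apply/funext => t; apply/funext => x; rewrite big_nil.
have := jet_familyM (H k) IH; congr jet_family; first by rewrite big_cons.
by apply/funext => t; apply/funext => x; rewrite big_cons.
Qed.

(** The Leibniz expansion reduces the determinant to sums and products of jet families. *)
Lemma jet_family_det n (C : 'M[R]_n) (w : 'I_n -> 'I_n -> R -> 'rV[R]_d -> R) :
  (forall i j, jet_family (C i j) (w i j)) ->
  jet_family (\det C) (fun t x => \det (\matrix_(i, j) w i j t x)).
Proof.
move=> H.
have -> : (fun t x => \det (\matrix_(i, j) w i j t x)) =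
  (fun t x => \sum_(s : 'S_n) (-1) ^+ s * \prod_i w i (s i) t x).
  apply/funext => t; apply/funext => x; apply: eq_bigr => s _; congr (_ * _).
  by apply: eq_bigr => i _; rewrite mxE.
apply: jet_family_sum => s; apply: jet_familyM; first exact: jet_family_cst.
by apply: jet_family_prod => i; exact: H.
Qed.
End PartialCalculus.

(** * First three derivatives of the flow in the initial condition *)

Section FlowJets.
Context {R : realType} {d : nat} (b : 'rV[R]_d -> 'rV[R]_d)
  (phi : R -> 'rV[R]_d -> 'rV[R]_d) (hphi : is_flow b phi).
Local Notation bc := (coordf b).
Context (hb : forall k, Ck 3 (bc k)).
Context (B1 B2 B3 : R) (hB1 : forall j k x, `|partial j (bc k) x| <= B1).
Context (hB2 : forall i j k x, `|partial i (partial j (bc k)) x| <= B2).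
Context (hB3 : forall i j l k x, `|partial i (partial j (partial l (bc k))) x| <= B3).
Context (B10 : 0 <= B1).

(** A bound on the time derivative becomes [O(t)] closeness to the value at time 0: this is where
    the factor [|t|] of [jet_family] originates. *)
Lemma ubnd_from_zero (a : R) (w dw : R -> 'rV[R]_d -> R) (c : R) : 0 < a -> ubnd a dw ->
  (forall x (t : R), `|t| < a -> is_derive t 1 (fun s => w s x) (dw t x)) ->
  (forall x, w 0 x = c) ->
  exists2 K, 0 <= K & forall t x, `|t| < a -> `|w t x - c| <= K * `|t|.
Proof.
move=> a0 [K K0 HK] dwE w0; exists K => // t x ta.
rewrite -(w0 x) -[X in K * `|X|]subr0.
apply: (@mvt_abs _ (fun s => w s x) (fun s => dw s x) a) => //; last by rewrite normr0.
by move=> r ra; exact: HK.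
Qed.

Lemma udiff_has_grad (a : R) (w : R -> 'rV[R]_d -> R) (dw : 'I_d -> R -> 'rV[R]_d -> R) t x :
  udiff a w dw -> `|t| < a -> has_grad (w t) x (fun i => dw i t x).
Proof.
move=> H ta e e0; have [eta eta0 He] := H x e e0.
by exists eta => // v ve; exact: He.
Qed.

Lemma udiff_partial (a : R) (w : R -> 'rV[R]_d -> R) (dw : 'I_d -> R -> 'rV[R]_d -> R) t :
  udiff a w dw -> `|t| < a -> (forall x, differentiable (w t) x) /\
  forall i, partial i (w t) = dw i t.
Proof.
move=> H ta; split=> [x|i].
  by have [] := has_grad_diff (udiff_has_grad x H ta).
by apply/funext => x; have [_ ->] := has_grad_diff (udiff_has_grad x H ta).
Qed.

(** The first derivatives of the flow start at the identity matrix, the second and third ones at 0,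
    and all of them solve linear equations with bounded coefficients and forcing; hence their
    distance to the initial value is [O(t)]. *)
Lemma flow_jet : exists Y : 'I_d -> 'I_d -> R -> 'rV[R]_d -> R,
  [/\ forall i k x (t : R), `|t| < 2 -> is_derive t 1 (fun s => Y i k s x)
        (\sum_j partial j (bc k) (phi t x) * Y i j t x),
      forall i k x, Y i k 0 x = (i == k)%:R,
      forall i k, jet_family (i == k)%:R (Y i k) &
      forall k t, `|t| < 2 -> (forall x, differentiable (fun y => phi t y 0 k) x) /\
        forall i, partial i (fun y => phi t y 0 k) = Y i k t].
Proof.
have a0 : 0 < 2 :> R by [].
have [Y [Yode Y0 bY dY]] := flow_diff hphi a0 hb B10 hB1.
exists Y; split => //; last by move=> k t ta; exact: (udiff_partial (dY k) ta).
have cP j k := uC1_drift_jac hphi a0 hb B10 hB1 bY dY hB2 j k.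
have bP j k : ubnd 2 (drift_jac b phi j k) by case: (cP j k).
(* [Z i j k] is the derivative of [Y i k] in the direction [j]. The equation for [Y] has no forcing,
   so the only new source term is the derivative of the coefficients. *)
have /choice[Z HZ] : forall i, exists Z : 'I_d -> 'I_d -> R -> 'rV[R]_d -> R,
  [/\ forall j k x (t : R), `|t| < 2 -> is_derive t 1 (fun s => Z j k s x)
       (\sum_m drift_jac b phi m k t x * Z j m t x + (\sum_m drift_jac_diff b phi Y m k j t x * Y i m t x + 0)),
      forall j k x, Z j k 0 x = 0,
      forall j k, ubnd 2 (Z j k) &
      forall k, udiff 2 (Y i k) (fun j => Z j k)].
  move=> i.
  apply: (variational_udiff hphi a0 hb B10 hB1 bY dY hB2 (u := Y i) (g := fun _ _ _ => 0)
     (dg := fun _ _ _ _ => 0) (c := fun k => (i == k)%:R)) => //.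
    by move=> k x t ta; rewrite addr0; exact: Yode.
  by move=> k; exact: uC1_cst.
have cY i k : uC1 2 (Y i k) (fun j => Z i j k).
  by have [_ _ bZ dZ] := HZ i; split.
(* The forcing of the equation for [Z] contains second derivatives of [b] along the flow;
   differentiating it once more brings in the third ones, bounded by [B3]. *)
have /choice[cdP HcdP] : forall mkj : 'I_d * 'I_d * 'I_d, exists cdP : 'I_d -> R -> 'rV[R]_d -> R,
   uC1 2 (drift_jac_diff b phi Y mkj.1.1 mkj.1.2 mkj.2) cdP.
  move=> [[m k] j] /=; eexists.
  apply: uC1_sum => l; apply: uC1M; first exact: cY.
  apply: (uC1_comp_flow hphi a0 hb B10 hB1 bY dY (K := Num.max B2 B3)).
  - have [_ H] := hb k; have [_ H1] := H m; exact: H1.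
  - by move=> x; rewrite le_max hB2.
  - by move=> q x; rewrite le_max hB3 orbT.
(* [W l k] is the derivative of [Z i j k] in the direction [l], that is, a third derivative of the
   flow. *)
have /choice[W HW] : forall ij : 'I_d * 'I_d, exists W : 'I_d -> 'I_d -> R -> 'rV[R]_d -> R,
   [/\ forall l k x, W l k 0 x = 0,
     forall l k, exists2 K, 0 <= K & forall t x, `|t| < 2 -> `|W l k t x - 0| <= K * `|t| &
     forall k, udiff 2 (Z ij.1 ij.2 k) (fun l => W l k)].
  move=> [i j] /=; have [Zode Z0 bZ dZ] := HZ i.
  have /choice[cg Hcg] : forall k, exists cg : 'I_d -> R -> 'rV[R]_d -> R,
      uC1 2 (fun t x => \sum_m drift_jac_diff b phi Y m k j t x * Y i m t x + 0) cg.
    move=> k; eexists; apply: uC1D; last exact: uC1_cst.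
    by apply: uC1_sum => m; apply: uC1M; [exact: (HcdP (m, k, j))|exact: cY].
  have [W [Wode W0 bW dW]] := variational_udiff hphi a0 hb B10 hB1 bY dY hB2 (Zode j) (Z0 j) (bZ j) Hcg.
  exists W; split => // l k; apply: (ubnd_from_zero a0 _ (Wode l k) (W0 l k)).
  apply: ubndD; first by apply: ubnd_sum => m; apply: ubndM.
  apply: ubndD; last by case: (Hcg k).
  by apply: ubnd_sum => m; apply: ubndM => //; case: (HcdP (m, k, l)).
move=> i k.
have [KY KY0 HKY] : exists2 K, 0 <= K & forall t x, `|t| < 2 -> `|Y i k t x - (i == k)%:R| <= K * `|t|.
  apply: (ubnd_from_zero a0 _ (Yode i k) (Y0 i k)).
  by apply: ubnd_sum => m; apply: ubndM => //; exact: bP.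
have [||KZ KZ0 HKZ] := @fin_bound R _ (fun j K => forall t x, `|t| < 2 -> `|Z i j k t x - 0| <= K * `|t|).
- by move=> j K K' KK H t x ta; rewrite (le_trans (H t x ta))// ler_wpM2r.
- move=> j; have [Zode Z0 bZ _] := HZ i.
  apply: (ubnd_from_zero a0 _ (Zode j k) (Z0 j k)).
  apply: ubndD; first by apply: ubnd_sum => m; apply: ubndM.
  apply: ubndD; last exact: ubnd_cst.
  by apply: ubnd_sum => m; apply: ubndM => //; case: (HcdP (m, k, j)).
have [||KW KW0 HKW] := @fin_bound R _ (fun j K => forall l t x, `|t| < 2 -> `|W (i, j) l k t x - 0| <= K * `|t|).
- by move=> j K K' KK H l t x ta; rewrite (le_trans (H l t x ta))// ler_wpM2r.
- move=> j; have [||K K0 HK] := @fin_bound R _ (fun l K => forall t x, `|t| < 2 -> `|W (i, j) l k t x - 0| <= K * `|t|).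
  + by move=> l K K' KK H t x ta; rewrite (le_trans (H t x ta))// ler_wpM2r.
  + by move=> l; have [_ H _] := HW (i, j); exact: H.
  + by exists K.
exists (KY + (KZ + KW)); first by rewrite !addr_ge0.
move=> t t1; have ta : `|t| < 2 by rewrite (le_lt_trans t1)// ltr1n.
have [_ _ _ dZ] := HZ i.
have [dYt pY] := udiff_partial (dZ k) ta.
have pZ j : (forall x, differentiable (Z i j k t) x) /\
  forall l, partial l (Z i j k t) = W (i, j) l k t.
  by have [_ _ dW] := HW (i, j); exact: (udiff_partial (dW k) ta).
have KYZ : KY <= KY + (KZ + KW) by rewrite lerDl addr_ge0.
have KZY : KZ <= KY + (KZ + KW) by rewrite addrCA lerDl addr_ge0.
have KWY : KW <= KY + (KZ + KW) by rewrite addrA lerDr addr_ge0.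
split.
- split=> // j x; rewrite pY; by case: (pZ j).
- by move=> x; rewrite (le_trans (HKY t x ta))// ler_wpM2r.
- by move=> j x; rewrite pY; have := HKZ j t x ta; rewrite subr0 => /le_trans; apply; rewrite ler_wpM2r.
- move=> l j x; rewrite pY; have [_ ->] := pZ j; have := HKW j l t x ta; rewrite subr0 => /le_trans.
  by apply; rewrite ler_wpM2r.
Qed.

Lemma differentiable_rV (F : 'rV[R]_d -> 'rV[R]_d) x :
  (forall k, differentiable (fun y => F y 0 k) x) -> differentiable F x.
Proof.
move=> H; have -> : F = \sum_k (fun y => F y 0 k *: delta_mx 0 k).
  by apply/funext => y; rewrite fct_sumE [LHS]row_sum_delta.
by apply: differentiable_sum => k; apply: differentiableZl.
Qed.

Lemma jacobianE (F : 'rV[R]_d -> 'rV[R]_d) x i k :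
  (forall k, differentiable (fun y => F y 0 k) x) ->
  jacobian F x i k = partial i (fun y => F y 0 k) x.
Proof.
move=> H; have dF := differentiable_rV H.
rewrite mxE -deriveE// derive_mx ?mxE//; exact: diff_derivable.
Qed.
End FlowJets.

(** * The Jacobian determinant of the flow *)

Lemma jet_family_ext {R : realType} {d : nat} (c : R) (w u : R -> 'rV[R]_d -> R) :
  (forall t, `|t| <= 1 -> w t = u t) -> jet_family c w -> jet_family c u.
Proof.
move=> E [K K0 H]; exists K => [//|t t1].
by rewrite -(E t t1); exact: H.
Qed.

Section Jacobian.
Context {R : realType} {d : nat} (b : 'rV[R]_d -> 'rV[R]_d)
  (phi : R -> 'rV[R]_d -> 'rV[R]_d) (hphi : is_flow b phi).
Local Notation bc := (coordf b).
Context (B1 : R) (B10 : 0 <= B1) (hB1 : forall j k x, `|partial j (bc k) x| <= B1).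
Context (hbd : forall k x, differentiable (bc k) x).
Context (Y : 'I_d -> 'I_d -> R -> 'rV[R]_d -> R).
Context (Yode : forall i k x (t : R), `|t| < 2 -> is_derive t 1 (fun s => Y i k s x)
        (\sum_j partial j (bc k) (phi t x) * Y i j t x)).
Context (Y0 : forall i k x, Y i k 0 x = (i == k)%:R).
Context (Yjet : forall i k, jet_family (i == k)%:R (Y i k)).
Context (Yphi : forall k t, `|t| < 2 -> (forall x, differentiable (fun y => phi t y 0 k) x) /\
        forall i, partial i (fun y => phi t y 0 k) = Y i k t).

Local Notation YM t x := (\matrix_(i, k) Y i k t x).

Lemma flow_jacE t x : `|t| < 2 -> flow_jac phi t x = \det (YM t x).
Proof.
move=> ta; congr (\det _); apply/matrixP => i k; rewrite [RHS]mxE jacobianE.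
  by have [_ ->] := Yphi k ta.
by move=> j; case: (Yphi j ta).
Qed.

Lemma flow_jac_jet : jet_family 1 (flow_jac phi).
Proof.
apply: (@jet_family_ext _ _ _ (fun t x => \det (YM t x))).
  move=> t t1; apply/funext => x; rewrite flow_jacE// (le_lt_trans t1)// ltr1n//.
have -> : 1 = \det (1%:M : 'M[R]_d) by rewrite det1.
by apply: jet_family_det => i j; rewrite mxE.
Qed.

Let g := gconst d B1 2.

(* A row vector times [D phi_t] solves a linear equation, so Gronwall from time [t]
   back to time 0 bounds the inverse of [D phi_t]. *)
Lemma flow_jac_row_bound (v : 'I_d -> R) t x (m : R) : `|t| < 2 -> 0 <= m ->
  (forall k, `|\sum_i v i * Y i k t x| <= m) -> forall k, `|v k| <= g * m.
Proof.
move=> ta m0 H k; rewrite -[m]addr0.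
have -> : v k = \sum_i v i * Y i k 0 x.
  rewrite (bigD1 k)//= Y0 eqxx mulr1 big1 ?addr0// => i /negbTE ik.
  by rewrite Y0 ik mulr0.
apply: (@gronwall_vec _ _ (fun k s => \sum_i v i * Y i k s x)
   (fun k s => \sum_j partial j (bc k) (phi s x) * \sum_i v i * Y i j s x) 2 B1 0 m 0 t) => //.
- move=> j r ra.
  have -> : (fun s => \sum_i v i * Y i j s x) = \sum_i (fun s => v i * Y i j s x).
    by apply/funext => s; rewrite fct_sumE.
  have -> : \sum_l partial l (bc j) (phi r x) * \sum_i v i * Y i l r x =
     \sum_i v i * \sum_l partial l (bc j) (phi r x) * Y i l r x.
    under eq_bigr do rewrite mulr_sumr.
    rewrite exchange_big/=; apply: eq_bigr => i _; rewrite mulr_sumr.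
    by apply: eq_bigr => l _; rewrite mulrCA.
  apply: is_derive_sum => i; have Hd := Yode i j x ra.
  by apply: is_derive_eq; rewrite /GRing.scale /=; ring.
- by move=> j r ra; rewrite addr0; apply: norm_sumM_le => l.
- by rewrite normr0.
Qed.

(** A vector of the left kernel has image 0, so the backward bound with [m = 0] makes it vanish. *)
Lemma flow_jac_neq0 t x : `|t| < 2 -> \det (YM t x) != 0.
Proof.
move=> ta; apply/negP => /det0P[v v0 vM].
move/negP: v0; apply; apply/eqP/rowP => k; rewrite [RHS]mxE; apply/eqP.
rewrite -normr_le0 -[leRHS](mulr0 g).
apply: (flow_jac_row_bound (v := fun i => v 0 i) (x := x) ta) => // j.
have := congr1 (fun M : 'rV[R]_d => M 0 j) vM; rewrite !mxE => E.
by under eq_bigr do [rewrite -[Y _ _ _ _](mxE matrix_key (fun i k => Y i k t x))]; rewrite E normr0.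
Qed.

(** Each row of the inverse matrix is sent to a basis vector, so its entries are at most [g]; the
    Leibniz expansion then bounds the determinant of the inverse, uniformly in [x]. *)
Lemma flow_jac_inv_bound : exists2 D : R, 1 <= D & forall t x, `|t| < 2 ->
  D^-1 <= `|\det (YM t x)|.
Proof.
have g1 : 1 <= g by exact: gconst_ge1.
have g0 : 0 <= g by apply: le_trans g1.
exists (1 + (#|'S_d|)%:R * g ^+ d); first by rewrite lerDl mulr_ge0// exprn_ge0.
move=> t x ta; set M := YM t x.
have detM : \det M != 0 by exact: flow_jac_neq0.
have uM : M \in unitmx by rewrite unitmxE unitfE.
have NM : invmx M *m M = 1%:M by rewrite mulVmx.
have Nb i k : `|invmx M i k| <= g.
  rewrite -[g]mulr1; apply: (flow_jac_row_bound (v := fun k => invmx M i k) (x := x) ta) => // j.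
  have := congr1 (fun M : 'M[R]_d => M i j) NM; rewrite !mxE => E.
  rewrite (_ : \sum_i0 _ = (i == j)%:R); first by case: eqP => _; rewrite ?normr1 ?normr0.
  by rewrite -E; apply: eq_bigr => l _; rewrite [M _ _]mxE.
have dN : `|\det (invmx M)| <= (#|'S_d|)%:R * g ^+ d.
  apply: (le_trans (ler_norm_sum _ _ _)).
  rewrite mulr_natl -sumr_const; apply: ler_sum => s _.
  rewrite normrM normrX normrN1 expr1n mul1r normr_prod.
  rewrite -[X in g ^+ X]card_ord -prodr_const; apply: ler_prod => i _.
  by rewrite normr_ge0 Nb.
have := det_mulmx (invmx M) M; rewrite NM det1 => /esym/(congr1 Num.norm).
rewrite normrM normr1 => E.
have D0 : 0 < 1 + (#|'S_d|)%:R * g ^+ d by rewrite ltr_wpDr// mulr_ge0// exprn_ge0.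
rewrite -div1r ler_pdivrMr// -[leLHS]E mulrC ler_wpM2l//.
by apply: (le_trans dN); rewrite lerDr.
Qed.

(** The determinant is continuous in time, equals 1 at time 0 and never vanishes, so it keeps its
    sign. *)
Lemma flow_jac_gt0 t x : `|t| <= 1 -> 0 < flow_jac phi t x.
Proof.
move=> t1; have ta : `|t| < 2 by rewrite (le_lt_trans t1)// ltr1n.
rewrite flow_jacE//; pose F s := \det (YM s x).
have cF s : `|s| < 2 -> {for s, continuous F}.
  move=> sa; have cY i k : {for s, continuous (fun s => Y i k s x)}.
    have [H _] := Yode i k x sa.
    by apply: differentiable_continuous; apply/derivable1_diffP.
  have -> : F = \sum_(p : 'S_d) (fun s => (-1) ^+ p * \prod_i Y i (p i) s x).
    apply/funext => r; rewrite fct_sumE; apply: eq_bigr => p _; congr (_ * _).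
    by apply: eq_bigr => i _; rewrite mxE.
  elim/big_ind : _ => [|f1 f2 H1 H2|p _]; [exact: cst_continuous|exact: continuousD|].
  apply: continuousM; first exact: cst_continuous.
  have -> : (fun s => \prod_i Y i (p i) s x) = \prod_i (fun s => Y i (p i) s x).
    by apply/funext => r; rewrite fct_prodE.
  elim/big_ind : _ => [|f1 f2 H1 H2|i _]; [exact: cst_continuous|exact: continuousM|exact: cY].
have F0 : F 0 = 1.
  rewrite /F -[RHS](det1 R d); congr (\det _); apply/matrixP => i k.
  by rewrite !mxE Y0.
rewrite lt_neqAle eq_sym flow_jac_neq0//=.
case: leP => // Ft'; exfalso.
have {Ft'} Ft : F t <= 0 := ltW Ft'.
have cw l r : `|l| < 2 -> `|r| < 2 -> {within `[l, r], continuous F}.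
  move=> la ra; apply: continuous_in_subspaceT => s; rewrite inE/= in_itv/= => /andP[ls sr].
  apply: cF; move: la ra; rewrite !ltr_norml => /andP[? ?] /andP[? ?]; apply/andP; split; lra.
have z2 : `|0 : R| < 2 by rewrite normr0.
have [t0|t0] := leP 0 t.
  have [] := @IVT R F 0 t 0 t0 (cw _ _ z2 ta).
    by rewrite F0 ge_min le_max ler01 Ft ?orbT.
  move=> c; rewrite in_itv/= => /andP[c0 ct] Fc.
  have ca : `|c| < 2 by rewrite ger0_norm// (le_lt_trans ct)// (le_lt_trans (ler_norm _) ta).
  by have := flow_jac_neq0 x ca; rewrite -/(F c) Fc eqxx.
have [] := @IVT R F t 0 0 (ltW t0) (cw _ _ ta z2).
  by rewrite F0 ge_min le_max ler01 Ft ?orbT.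
move=> c; rewrite in_itv/= => /andP[ct c0] Fc.
have ca : `|c| < 2.
  rewrite ler0_norm//; move: ta; rewrite ltr0_norm//; lra.
by have := flow_jac_neq0 x ca; rewrite -/(F c) Fc eqxx.
Qed.

(** The upper bound follows from [1 + u <= expR u]. For the lower one, [1 - u >= expR (- (2 * u))]
    serves as long as [u = K |t|] is at most 1/2; beyond, [2 K |t| >= 1] and the uniform bound
    [D^-1 = expR (- ln D)] suffices. The constant [2 K (1 + ln D)] covers both regimes. *)
Lemma flow_jac_exp : exists2 K, 0 <= K & forall t x, `|t| <= 1 ->
  expR (- (K * `|t|)) <= flow_jac phi t x <= expR (K * `|t|).
Proof.
have [K K0 HK] := flow_jac_jet; have [D D1 HD] := flow_jac_inv_bound.
have D0 : 0 < D by apply: lt_le_trans D1.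
have lnD : 0 <= ln D by apply: ln_ge0.
exists (2 * K * (1 + ln D)); first by rewrite !mulr_ge0// addr_ge0.
move=> t x t1; have ta : `|t| < 2 by rewrite (le_lt_trans t1)// ltr1n.
have [_ J1 _ _] := HK t t1; have := J1 x; rewrite ler_distl => /andP[Jl Ju].
have KK : K <= 2 * K * (1 + ln D).
  by have := mulr_ge0 K0 lnD; lra.
apply/andP; split; last first.
  apply: (le_trans Ju); apply: (le_trans (expR_ge1Dx _)).
  by rewrite ler_expR ler_wpM2r.
have [small|big] := leP (K * `|t|) 2^-1.
  apply: le_trans Jl.
  apply: (@le_trans _ _ (expR (- (2 * (K * `|t|))))).
    rewrite ler_expR lerN2 mulrA ler_wpM2r//.
    by have := mulr_ge0 K0 lnD; lra.
  set u := K * `|t| in small *; have u0 : 0 <= u by rewrite mulr_ge0.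
  rewrite expRN -div1r ler_pdivrMr ?expR_gt0//.
  apply: (@le_trans _ _ ((1 - u) * (1 + 2 * u))).
    by have : 0 <= u * (1 - 2 * u); [apply: mulr_ge0 => //; lra|lra].
  by rewrite ler_wpM2l ?expR_ge1Dx//; lra.
have := HD t x ta; rewrite -flow_jacE// gtr0_norm ?flow_jac_gt0//.
apply: le_trans; rewrite -[leRHS]lnK ?posrE ?invr_gt0// ler_expR lnV ?posrE// lerN2.
have -> : 2 * K * (1 + ln D) * `|t| = 2 * (K * `|t|) + (2 * (K * `|t|)) * ln D by ring.
rewrite -[leLHS]add0r lerD//; first by rewrite mulr_ge0// mulr_ge0.
by rewrite ler_peMl//; lra.
Qed.

Definition sqr1 (x : 'rV[R]_d) : R := 1 + \sum_k x 0 k ^+ 2.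

(** The summand 1 in [sqr1] absorbs the affine part of the growth of [b], so Gronwall applies
    without forcing and the loss is purely multiplicative. *)
Lemma flow_sqr1 : exists2 K, 0 <= K & forall t x, `|t| <= 1 ->
  sqr1 (phi t x) <= expR (K * `|t|) * sqr1 x.
Proof.
pose m := \sum_k `|bc k 0|.
have m0 : 0 <= m by apply: sumr_ge0.
pose C := m + (m + 2 * (d%:R * B1)) * d%:R.
have C0 : 0 <= C by rewrite addr_ge0// mulr_ge0// addr_ge0// !mulr_ge0.
exists C => // t x t1.
have ta : `|t| < 2 by rewrite (le_lt_trans t1)// ltr1n.
have z2 : `|0 : R| < 2 by rewrite normr0.
have := @gronwall R (fun s => sqr1 (phi s x))
  (fun s => \sum_k 2 * phi s x 0 k * bc k (phi s x)) 2 C 0 t 0.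
rewrite mul0r addr0 subr0; case: hphi => -> _ H.
rewrite mulrC; apply: H => //.
- move=> r ra; rewrite /sqr1 -[X in is_derive _ _ _ X]add0r.
  apply: is_deriveD.
  have -> : (fun s => \sum_k phi s x 0 k ^+ 2) = \sum_k (fun s => phi s x 0 k ^+ 2).
    by apply/funext => s; rewrite fct_sumE.
  apply: is_derive_sum => k; have Hd := flow_coord hphi x k r.
  by apply: is_derive_eq; rewrite /GRing.scale /=; ring.
- move=> r ra; rewrite addr0; set y := phi r x.
  pose S := \sum_k `|y 0 k|.
  have S0 : 0 <= S by apply: sumr_ge0.
  have S2 : S ^+ 2 <= d%:R * \sum_k y 0 k ^+ 2.
    apply: (le_trans (sqr_sum_le _)); rewrite ler_wpM2l// ler_sum// => k _.
    by rewrite real_normK// num_real.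
  have bk k : `|bc k y| <= m + d%:R * B1 * S.
    have := grad_bound_lip (hbd k) (fun i => hB1 i k) 0 y; rewrite add0r => H1.
    rewrite -[bc k y](subrK (bc k 0)) addrC (le_trans (ler_normD _ _))// lerD//.
      by rewrite /m (bigD1 k)//= lerDl sumr_ge0.
    by apply: (le_trans H1); rewrite ler_wpM2l ?mulr_ge0//; exact: norm_le_sum.
  apply: (@le_trans _ _ (2 * S * (m + d%:R * B1 * S))).
    apply: (le_trans (ler_norm_sum _ _ _)); rewrite -mulrA mulr_suml mulr_sumr.
    by apply: ler_sum => k _; rewrite -mulrA normrM ger0_norm// ler_wpM2l// normrM ler_wpM2l.
  apply: (@le_trans _ _ (m + (m + 2 * (d%:R * B1)) * S ^+ 2)).
    by have := mulr_ge0 m0 (sqr_ge0 (S - 1)); lra.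
  rewrite /C /sqr1; set Q := \sum_k y 0 k ^+ 2 in S2 *.
  have Q0 : 0 <= Q by apply: sumr_ge0 => k _; exact: sqr_ge0.
  have h : 0 <= m + 2 * (d%:R * B1) by rewrite addr_ge0// !mulr_ge0.
  apply: (@le_trans _ _ (m + (m + 2 * (d%:R * B1)) * (d%:R * Q))).
    by rewrite lerD2l ler_wpM2l.
  have e1 := mulr_ge0 m0 Q0; have e2 := mulr_ge0 h (ler0n R d).
  rewrite -subr_ge0; set A := m + 2 * _ in e2 *.
  have -> : (m + A * d%:R) * (1 + Q) - (m + A * (d%:R * Q)) = m * Q + A * d%:R by ring.
  exact: addr_ge0.
Qed.
End Jacobian.

(** * The concave weight and the class of densities *)

Section ConcaveWeight.
Context {R : realType} (r : nat) (r1 : (1 <= r)%N).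
Implicit Types M u k J : R.

(* [u |-> u (r - ln (u / M))^r] is concave on ]0, M]. *)
Definition log_weight M u : R := u * (r%:R - ln (u / M)) ^+ r.

Lemma log_weight_arg M u : 0 < u -> u <= M -> r%:R <= r%:R - ln (u / M).
Proof.
move=> u0 uM; have M0 : 0 < M by apply: lt_le_trans uM.
by rewrite lerDl oppr_ge0 ln_le0// ler_pdivrMr// mul1r.
Qed.

Lemma log_weight_arg1 M u : 0 < u -> u <= M -> 1 <= r%:R - ln (u / M).
Proof. by move=> u0 uM; apply: le_trans (log_weight_arg u0 uM); rewrite ler1n. Qed.

Lemma log_weight_ge M u : 0 < u -> u <= M -> u <= log_weight M u.
Proof.
move=> u0 uM; rewrite /log_weight ler_peMr ?(ltW u0)//.
by apply: exprn_ege1; exact: log_weight_arg1.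
Qed.

Lemma log_weight_ge0 M u : 0 < u -> u <= M -> 0 <= log_weight M u.
Proof. by move=> u0 uM; apply: le_trans (log_weight_ge u0 uM); exact: ltW. Qed.

(** Raising [M] to [M expR k] makes the new ratio [u J / (M expR k)] at most [u / M], so the
    logarithmic factor can only grow; the factor [J] itself costs at most [expR k]. *)
Lemma log_weight_scale M u k J : 0 < u -> u <= M -> 0 <= k ->
  expR (- k) <= J -> J <= expR k ->
  u * J <= M * expR k /\ log_weight M u <= expR k * log_weight (M * expR k) (u * J).
Proof.
move=> u0 uM k0 Jl Ju; have M0 : 0 < M by apply: lt_le_trans uM.
have J0 : 0 < J by apply: lt_le_trans Jl; exact: expR_gt0.
split; first by rewrite ler_pM// ltW.
rewrite /log_weight mulrA ler_pM//.
- exact: ltW.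
- by rewrite exprn_ge0// (le_trans ler01)// log_weight_arg1.
- rewrite mulrCA ler_peMr ?(ltW u0)//.
  by rewrite -ler_pdivrMl ?expR_gt0// mulr1 -expRN.
- rewrite lerXn2r ?nnegrE//.
  + by rewrite (le_trans ler01)// log_weight_arg1.
  + rewrite (le_trans ler01)// log_weight_arg1//; first by rewrite mulr_gt0.
    by rewrite ler_pM// ltW.
  + rewrite lerD2l lerN2.
    have -> : u * J / (M * expR k) = (u / M) * (J / expR k).
      by field; rewrite !gt_eqF ?expR_gt0.
    rewrite lnM ?posrE ?divr_gt0 ?expR_gt0//.
    by rewrite gerDl ln_le0// ler_pdivrMr ?expR_gt0// mul1r.
Qed.

Lemma log_weight_monoM M M' u : 0 < u -> u <= M -> M <= M' -> log_weight M u <= log_weight M' u.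
Proof.
move=> u0 uM MM; have M0 : 0 < M by apply: lt_le_trans uM.
have M'0 : 0 < M' by apply: lt_le_trans MM.
rewrite /log_weight ler_wpM2l ?(ltW u0)// lerXn2r ?nnegrE//.
- by rewrite (le_trans ler01)// log_weight_arg1.
- by rewrite (le_trans ler01)// log_weight_arg1// (le_trans uM).
- rewrite lerD2l lerN2 ler_ln ?posrE ?divr_gt0//.
  by rewrite ler_wpM2l ?(ltW u0)// lef_pV2 ?posrE.
Qed.

(** Two tangent inequalities at [th * y], weighted by [th] and [1 - th]: the terms linear in [y]
    cancel. *)
Lemma expR_convex (th y : R) : 0 <= th <= 1 ->
  expR (th * y) <= 1 - th + th * expR y.
Proof.
move=> /andP[t0 t1].
have e1 : expR (th * y) * (1 + (1 - th) * y) <= expR y.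
  have -> : expR y = expR (th * y) * expR ((1 - th) * y) by rewrite -expRD; congr expR; ring.
  by rewrite ler_wpM2l ?expR_ge0// expR_ge1Dx.
have e2 : expR (th * y) * (1 - th * y) <= 1.
  rewrite -[leRHS](@expR0 R) -(subrr (th * y)) expRD ler_wpM2l ?expR_ge0//.
  exact: expR_ge1Dx.
have t1' : 0 <= 1 - th by rewrite subr_ge0.
have := ler_wpM2l t0 e1; have := ler_wpM2l t1' e2; lra.
Qed.

(* With [y = ln (u0 / u)], [l0 = r - ln (u0 / M)] and [th = r / l0 <= 1], this is
   [(1 + y / l0)^r <= exp (th y) <= 1 - th + th exp y]. *)
Lemma log_weight_tangent M u0 : 0 < u0 -> u0 <= M -> exists A, forall u, 0 < u -> u <= M ->
  log_weight M u <= log_weight M u0 + A * (u - u0).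
Proof.
move=> u00 u0M; have M0 : 0 < M by apply: lt_le_trans u0M.
pose l0 := r%:R - ln (u0 / M); pose th := r%:R / l0.
have l0r : r%:R <= l0 by exact: log_weight_arg.
have l01 : 1 <= l0 by exact: log_weight_arg1.
have l00 : 0 < l0 by apply: lt_le_trans l01.
have th01 : 0 <= th <= 1.
  by rewrite divr_ge0 ?(ltW l00)//= ler_pdivrMr// mul1r.
(* This slope is the derivative of [log_weight M] at [u0], namely [l0 ^+ r - r l0 ^+ (r - 1)]. *)
exists (l0 ^+ r * (1 - th)) => u uu0 uM.
pose y := ln (u0 / u).
have lE : r%:R - ln (u / M) = l0 * (1 + y / l0).
  have -> : l0 * (1 + y / l0) = l0 + y by field; rewrite gt_eqF.
  rewrite /l0 /y !ln_div ?posrE//; ring.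
have l1 : 1 <= l0 * (1 + y / l0) by rewrite -lE; exact: log_weight_arg1.
have p0 : 0 <= 1 + y / l0.
  by rewrite -(pmulr_rge0 _ l00) (le_trans ler01).
have key : (1 + y / l0) ^+ r <= 1 - th + th * (u0 / u).
  have -> : u0 / u = expR y by rewrite /y lnK// posrE divr_gt0.
  apply: le_trans (expR_convex y th01).
  have -> : th * y = r%:R * (y / l0) by rewrite /th; ring.
  rewrite expRM_natl lerXn2r ?nnegrE ?expR_ge0//; exact: expR_ge1Dx.
rewrite /log_weight -/l0 lE exprMn.
have := ler_wpM2l (exprn_ge0 r (ltW l00)) (ler_wpM2l (ltW uu0) key).
have -> : u * (1 - th + th * (u0 / u)) = u0 + (1 - th) * (u - u0).
  by field; rewrite gt_eqF.
set p := (1 + y / l0) ^+ r; set q := l0 ^+ r; lra.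
Qed.
End ConcaveWeight.

Section Good.
Context {R : realType} {d : nat}.
Implicit Types (f g : 'rV[R]_d -> R).

Lemma sqr1_ge1 (x : 'rV[R]_d) : 1 <= sqr1 x.
Proof. by rewrite lerDl; apply: sumr_ge0 => k _; exact: sqr_ge0. Qed.

(* The bounds are entrywise, so that close to the identity a change of variables
   multiplies them by [1 + O(s)], without a dimensional factor. *)
Definition controlled (r m : nat) (M C c : R) f :=
  [/\ twice_differentiable f, forall x, 0 < f x <= M,
    forall x, expR (- (c * sqr1 x ^+ m)) <= f x,
    forall i x, `|partial i f x| <= C * log_weight r M (f x) &
    forall i j x, `|partial i (partial j f) x| <= C * log_weight r M (f x)].

Lemma controlled_mono r m (M C c M' C' c' : R) f : (1 <= r)%N -> 0 <= C ->
  M <= M' -> C <= C' -> c <= c' -> controlled r m M C c f -> controlled r m M' C' c' f.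
Proof.
move=> r1 C0 MM CC cc [tf fM fc f1 f2].
have H x : C * log_weight r M (f x) <= C' * log_weight r M' (f x).
  have /andP[f0 fM'] := fM x.
  by rewrite ler_pM// ?log_weight_ge0// log_weight_monoM.
split=> //.
- by move=> x; have /andP[-> /= f0] := fM x; exact: le_trans MM.
- move=> x; apply: le_trans (fc x); rewrite ler_expR lerN2 ler_wpM2r//.
  by rewrite exprn_ge0// (le_trans ler01)// sqr1_ge1.
- by move=> i x; exact: le_trans (H x).
- by move=> i j x; exact: le_trans (H x).
Qed.

Lemma partial_comp g (F : 'rV[R]_d -> 'rV[R]_d) x i : differentiable g (F x) ->
  (forall k, differentiable (fun y => F y 0 k) x) ->
  differentiable (fun y => g (F y)) x /\
  partial i (fun y => g (F y)) x = \sum_k partial i (fun y => F y 0 k) x * partial k g (F x).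
Proof.
move=> dg dF; have dF' := differentiable_rV dF.
have dgF : differentiable (g \o F) x by exact: differentiable_comp.
split=> //; rewrite /partial deriveE// diff_comp//= diff_sum//.
apply: eq_bigr => k _; congr (_ * _); rewrite -deriveE// derive_mx ?mxE//.
exact: diff_derivable.
Qed.

Lemma partial_sum n (f : 'I_n -> 'rV[R]_d -> R) i x :
  (forall k, differentiable (f k) x) ->
  partial i (fun y => \sum_k f k y) x = \sum_k partial i (f k) x.
Proof.
move=> df; rewrite /partial -derive_sum => [|k]; last exact: diff_derivable.
by congr (derive _ _ _); apply/funext => y; rewrite fct_sumE.
Qed.

Lemma differentiable_sumf n (f : 'I_n -> 'rV[R]_d -> R) x :
  (forall k, differentiable (f k) x) -> differentiable (fun y => \sum_k f k y) x.
Proof.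
move=> df; have -> : (fun y => \sum_k f k y) = \sum_k f k.
  by apply/funext => y; rewrite fct_sumE.
exact: differentiable_sum.
Qed.
End Good.

(** * Stability of the class under advection *)

Section CompMul.
Context {R : realType} {d : nat}.

(** After one differentiation, every term of the derivative of an advected density is a product
    [(G \o F) * mu] with [F] close to the identity and [mu] close to a constant [c]. Here [D]
    measures both distances, and the error is linear in [D] when [D] is bounded. *)
Lemma partial_comp_mul (G mu : 'rV[R]_d -> R) (F : 'rV[R]_d -> 'rV[R]_d) i x (c D B : R) :
  (forall x, differentiable G x) -> (forall k x, differentiable (fun y => F y 0 k) x) ->
  (forall x, differentiable mu x) ->
  (forall k, `|partial i (fun y => F y 0 k) x - (i == k)%:R| <= D) ->
  `|mu x - c| <= D -> `|partial i mu x| <= D -> `|c| <= 1 ->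
  `|G (F x)| <= B -> (forall k, `|partial k G (F x)| <= B) ->
  `|partial i (fun y => G (F y) * mu y) x - c * partial i G (F x)| <=
    D * B * (d%:R * (1 + D) + 2).
Proof.
move=> dG dF dmu hF hmu hdmu c1 GB dGB.
have D0 : 0 <= D by apply: le_trans hdmu.
have B0 : 0 <= B by apply: le_trans GB.
have dGF y : differentiable (fun y => G (F y)) y by case: (@partial_comp _ _ G F y i (dG _) (fun k => dF k y)).
rewrite partialM//; have [_ ->] := @partial_comp _ _ G F x i (dG _) (fun k => dF k x).
have E : \sum_k partial i (fun y => F y 0 k) x * partial k G (F x) =
  \sum_k (partial i (fun y => F y 0 k) x - (i == k)%:R) * partial k G (F x) + partial i G (F x).
  have -> : partial i G (F x) = \sum_k (i == k)%:R * partial k G (F x).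
    rewrite (bigD1 i)//= eqxx mul1r big1 ?addr0// => k /negbTE; rewrite eq_sym => ->.
    by rewrite mul0r.
  by rewrite -big_split/=; apply: eq_bigr => k _; ring.
rewrite E; set S := \sum_k _.
have -> : (S + partial i G (F x)) * mu x + G (F x) * partial i mu x - c * partial i G (F x) =
  S * mu x + (partial i G (F x) * (mu x - c) + G (F x) * partial i mu x) by ring.
have SD : `|S| <= D * (d%:R * B).
  apply: (le_trans (norm_sumM_le _ (fun k => hF k))); rewrite ler_wpM2l//.
  exact: sum_le_const.
have muD : `|mu x| <= 1 + D.
  by rewrite -[mu x](subrK c) addrC (le_trans (ler_normD _ _))// lerD.
apply: (@le_trans _ _ (D * (d%:R * B) * (1 + D) + (B * D + B * D))); last first.
  by rewrite le_eqVlt; apply/orP; left; apply/eqP; ring.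
rewrite (le_trans (ler_normD _ _))// lerD ?normrM ?ler_pM//.
by rewrite (le_trans (ler_normD _ _))// lerD ?normrM ?ler_pM.
Qed.
End CompMul.

Section Advection.
Context {R : realType} {d : nat} (phi : R -> 'rV[R]_d -> 'rV[R]_d).
Context (Y : 'I_d -> 'I_d -> R -> 'rV[R]_d -> R).
Context (Yjet : forall i k, jet_family (i == k)%:R (Y i k)).
Context (Yphi : forall k t, `|t| < 2 -> (forall x, differentiable (fun y => phi t y 0 k) x) /\
        forall i, partial i (fun y => phi t y 0 k) = Y i k t).
Context (Jjet : jet_family 1 (flow_jac phi)).
Context (K1 : R) (K10 : 0 <= K1) (Jexp : forall t x, `|t| <= 1 ->
  expR (- (K1 * `|t|)) <= flow_jac phi t x <= expR (K1 * `|t|)).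
Context (K2 : R) (K20 : 0 <= K2) (Vexp : forall t x, `|t| <= 1 ->
  sqr1 (phi t x) <= expR (K2 * `|t|) * sqr1 x).

(** The derivatives of the advected density are compared with those of [g] at the foot [phi (- s) x]
    of the characteristic. The weight [B] is evaluated at that same point, so that no regularity of
    [B] is involved. *)
Lemma advection_jet : exists2 K, 0 <= K & forall s g (B : 'rV[R]_d -> R), 0 <= s <= 1 ->
  twice_differentiable g -> (forall x, `|g x| <= B x) ->
  (forall i x, `|partial i g x| <= B x) ->
  (forall i j x, `|partial i (partial j g) x| <= B x) ->
  let f := advection phi s g in
  [/\ twice_differentiable f,
    forall i x, `|partial i f x - partial i g (phi (- s) x)| <= K * s * B (phi (- s) x) &
    forall i j x, `|partial i (partial j f) x - partial i (partial j g) (phi (- s) x)| <=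
       K * s * B (phi (- s) x)].
Proof.
have [||KY KY0 HKY] := @fin_bound R _ (fun i K => forall k t, `|t| <= 1 -> jet_near (i == k)%:R (K * `|t|) (Y i k t)).
- move=> i K K' KK H k t t1; have [h0 h1 h2 h3] := H k t t1.
  have le : K * `|t| <= K' * `|t| by rewrite ler_wpM2r.
  by split=> // *; apply: le_trans le.
- move=> i; apply: fin_bound => [k K K' KK H t t1|k]; last exact: Yjet.
  have [h0 h1 h2 h3] := H t t1.
  have le : K * `|t| <= K' * `|t| by rewrite ler_wpM2r.
  by split=> // *; apply: le_trans le.
have [KJ KJ0 HKJ] := Jjet.
have [||KM KM0 HKM] := @fin_bound R _ (fun i K => forall k t, `|t| <= 1 ->
   jet_near (i == k)%:R (K * `|t|) (fun x => Y i k t x * flow_jac phi t x)).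
- move=> i K K' KK H k t t1; have [h0 h1 h2 h3] := H k t t1.
  have le : K * `|t| <= K' * `|t| by rewrite ler_wpM2r.
  by split=> // *; apply: le_trans le.
- move=> i; apply: fin_bound => [k K K' KK H t t1|k].
    have [h0 h1 h2 h3] := H t t1.
    have le : K * `|t| <= K' * `|t| by rewrite ler_wpM2r.
    by split=> // *; apply: le_trans le.
  by have := jet_familyM (Yjet i k) Jjet; rewrite mulr1.
pose K := KY + (KJ + KM).
have K0 : 0 <= K by rewrite !addr_ge0.
have KYK : KY <= K by rewrite lerDl addr_ge0.
have KJK : KJ <= K by rewrite /K addrCA lerDl addr_ge0.
have KMK : KM <= K by rewrite /K addrA lerDr addr_ge0.
pose Q := d%:R * (1 + K) + 2.
have Q0 : 0 <= Q by rewrite addr_ge0// mulr_ge0// addr_ge0.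
(* A second derivative consists of [d] terms from the chain rule and one term where the Jacobian is
   differentiated. *)
exists (d.+1%:R * (K * Q)); first by rewrite mulr_ge0// mulr_ge0.
move=> s g B /andP[s0 s1] [dg ddg] gB g1B g2B f.
have st : `|- s| <= 1 by rewrite normrN ger0_norm.
have st2 : `|- s| < 2 by rewrite (le_lt_trans st)// ltr1n.
have B0 x : 0 <= B x by apply: le_trans (gB x).
pose D := K * s.
have D0 : 0 <= D by rewrite mulr_ge0.
have DK : D <= K by rewrite ler_piMr.
have le c : c <= K -> c * `|- s| <= D by move=> cK; rewrite normrN ger0_norm// ler_wpM2r.
have dF k x : differentiable (fun y => phi (- s) y 0 k) x by case: (Yphi k st2).
have pF i k : partial i (fun y => phi (- s) y 0 k) = Y i k (- s) by case: (Yphi k st2).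
have [[dJ ddJ] J0 J1 J2] := HKJ _ st.
have hF i x k : `|partial i (fun y => phi (- s) y 0 k) x - (i == k)%:R| <= D.
  by rewrite pF; have [_ h _ _] := HKY i k _ st; apply: le_trans (h x) (le _ KYK).
have bound (E : R) y : E <= D * B y * (d%:R * (1 + D) + 2) -> E <= K * Q * s * B y.
  move=> /le_trans; apply.
  have -> : K * Q * s * B y = D * B y * Q by rewrite /D; ring.
  by rewrite ler_wpM2l ?mulr_ge0// lerD2r ler_wpM2l// lerD2l.
(* Grouping [Y i k] with the Jacobian gives a single multiplier, close to 1 if [i = k] and to 0
   otherwise; the multiplier of the last term is close to 0. *)
have pf i : partial i f = fun x => \sum_k partial k g (phi (- s) x) * (Y i k (- s) x * flow_jac phi (- s) x)
    + g (phi (- s) x) * partial i (flow_jac phi (- s)) x.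
  have dgF y : differentiable (fun y => g (phi (- s) y)) y.
    by case: (@partial_comp _ _ g (phi (- s)) y i (dg _) (fun k => dF k y)).
  rewrite /f /advection partialM//; apply/funext => x; congr (_ + _).
  have [_ ->] := @partial_comp _ _ g (phi (- s)) x i (dg _) (fun k => dF k x).
  rewrite mulr_suml; apply: eq_bigr => k _; rewrite pF; ring.
have dgF h : (forall x, differentiable h x) -> forall x, differentiable (fun y => h (phi (- s) y)) x.
  move=> dh x; apply: (@differentiable_comp _ _ _ _ (phi (- s)) h x); last exact: dh.
  exact: differentiable_rV.
have dM i k x : differentiable (fun x => Y i k (- s) x * flow_jac phi (- s) x) x.
  by have [[h _] _ _ _] := HKM i k _ st; exact: h.
have df1 i k x : differentiable (fun x => partial k g (phi (- s) x) * (Y i k (- s) x * flow_jac phi (- s) x)) x.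
  by apply: differentiableM; [apply: dgF => y; exact: ddg|exact: dM].
have df2 i x : differentiable (fun x => g (phi (- s) x) * partial i (flow_jac phi (- s)) x) x.
  by apply: differentiableM; [exact: dgF|exact: ddJ].
split.
- split=> [x|i x]; first by apply: differentiableM; [exact: dgF|exact: dJ].
  by rewrite pf; apply: differentiableD => //; apply: differentiable_sumf.
- move=> i x; have := @partial_comp_mul R d g (flow_jac phi (- s)) (phi (- s)) i x 1 D (B (phi (- s) x))
    dg dF dJ (hF i x).
  rewrite mul1r => H.
  have {H} := H (le_trans (J0 x) (le _ KJK)) (le_trans (J1 i x) (le _ KJK)).
  rewrite normr1 => /(_ (lexx _) (gB _) (fun k => g1B k _)) /bound /le_trans; apply.
  by rewrite !ler_wpM2r// ler_peMl ?mulr_ge0// ler1n.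
- move=> i j x; rewrite pf partialD; last 2 first.
    by move=> y; apply: differentiable_sumf.
    by move=> y; exact: df2.
  rewrite partial_sum//.
  have -> : partial i (partial j g) (phi (- s) x) =
     \sum_k (j == k)%:R * partial i (partial k g) (phi (- s) x) + 0 * partial i g (phi (- s) x).
    rewrite mul0r addr0 (bigD1 j)//= eqxx mul1r big1 ?addr0// => k /negbTE; rewrite eq_sym => ->.
    by rewrite mul0r.
  rewrite opprD addrACA -sumrB (le_trans (ler_normD _ _))//.
  have -> : d.+1%:R * (K * Q) * s * B (phi (- s) x) =
    d%:R * (K * Q * s * B (phi (- s) x)) + K * Q * s * B (phi (- s) x).
    by rewrite -natr1; ring.
  apply: lerD.
    apply: (le_trans (ler_norm_sum _ _ _)); apply: sum_le_const => k; apply: bound.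
    have [_ M0 M1 _] := HKM j k _ st.
    apply: (@partial_comp_mul R d (partial k g)) => //.
    + exact: le_trans (M0 x) (le _ KMK).
    + exact: le_trans (M1 i x) (le _ KMK).
    + by case: eqP => _; rewrite ?normr1 ?normr0.
  apply: bound; apply: (@partial_comp_mul R d g) => //.
  + by rewrite subr0; apply: le_trans (J1 j x) (le _ KJK).
  + exact: le_trans (J2 i j x) (le _ KJK).
  + by rewrite normr0.
Qed.

(** The derivatives lose [K3 s (C + 1)] times the weight, hence at most [(C + 1) expR (K3 s) - 1] in
    place of [C]. The Jacobian adds [K1 s] to the exponent of the lower bound, and
    [K1 s <= expR (K s) - 1] lets [c + 1] absorb it. *)
Lemma advection_controlled (r m : nat) : (1 <= r)%N -> exists2 K, 0 <= K &
  forall s M C c g, 0 <= s <= 1 -> 0 <= C -> 0 <= c -> controlled r m M C c g ->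
  controlled r m (M * expR (K * s)) ((C + 1) * expR (K * s) - 1) ((c + 1) * expR (K * s) - 1)
    (advection phi s g).
Proof.
move=> r1; have [K3 K30 HK3] := advection_jet.
pose K := K1 + (m%:R * K2 + K3).
have mK2 : 0 <= m%:R * K2 by rewrite mulr_ge0.
exists K; first by rewrite !addr_ge0.
move=> s M C c g s01 C0 c0 [tg gM gc g1 g2]; have /andP[s0 s1] := s01.
have st : `|- s| <= 1 by rewrite normrN ger0_norm.
have h0 x : 0 <= log_weight r M (g x) by have /andP[g0 g0M] := gM x; exact: log_weight_ge0.
(* Since [u <= log_weight r M u], the multiple [C + 1] of the weight dominates [g] together with its
   derivatives. *)
have gh x : `|g x| <= (C + 1) * log_weight r M (g x).
  have /andP[g0 g0M] := gM x; rewrite gtr0_norm// (le_trans (log_weight_ge r1 g0 g0M))//.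
  by rewrite ler_peMl// lerDr.
have hC x : C * log_weight r M (g x) <= (C + 1) * log_weight r M (g x) by rewrite ler_wpM2r// lerDl.
have [tf f1 f2] := HK3 s g (fun x => (C + 1) * log_weight r M (g x)) s01 tg gh
  (fun i x => le_trans (g1 i x) (hC x)) (fun i j x => le_trans (g2 i j x) (hC x)).
(* Sharper constants that keep apart the contributions of the Jacobian ([K1]), of the weight [sqr1]
   ([K2]) and of the derivatives ([K3]). *)
suff main : controlled r m (M * expR (K1 * s)) (((C + 1) * expR (K3 * s) - 1) * expR (K1 * s))
   (c * expR (m%:R * K2 * s) + K1 * s) (advection phi s g).
  have e0 a : 0 <= a -> 1 <= expR (a * s) by move=> a0; rewrite -expR0 ler_expR mulr_ge0.
  have eK : expR (K * s) = expR (K1 * s) * expR (m%:R * K2 * s) * expR (K3 * s).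
    by rewrite -!expRD; congr expR; rewrite /K; ring.
  have M0 : 0 <= M by have /andP[/ltW g0 g0M] := gM 0; exact: le_trans g0M.
  apply: controlled_mono main => //.
  - rewrite mulr_ge0 ?expR_ge0// subr_ge0.
    by rewrite -[leLHS]mulr1 ler_pM// ?e0// lerDr.
  - by rewrite ler_wpM2l// ler_expR ler_wpM2r// lerDl addr_ge0.
  - rewrite mulrBl mul1r lerB ?e0//.
    rewrite -mulrA ler_wpM2l ?addr_ge0// eK mulrC -mulrA ler_wpM2l ?expR_ge0//.
    by rewrite ler_peMl ?expR_ge0// e0.
  - have e1 : expR (m%:R * K2 * s) <= expR (K * s).
      by rewrite ler_expR ler_wpM2r// /K addrCA lerDl addr_ge0.
    have e2 : K1 * s <= expR (K * s) - 1.
      rewrite lerBrDl (le_trans (expR_ge1Dx _))// ler_expR ler_wpM2r//.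
      by rewrite lerDl addr_ge0.
    have := ler_wpM2l c0 e1; lra.
have Jb x := Jexp x st.
have sc x : g (phi (- s) x) * flow_jac phi (- s) x <= M * expR (K1 * s) /\
   log_weight r M (g (phi (- s) x)) <= expR (K1 * s) * log_weight r (M * expR (K1 * s)) (advection phi s g x).
  have /andP[g0 g0M] := gM (phi (- s) x).
  have := Jb x; rewrite normrN ger0_norm// => /andP[Jl Ju].
  by apply: log_weight_scale => //; rewrite mulr_ge0.
have Jpos x : 0 < flow_jac phi (- s) x.
  by have /andP[Jl _] := Jb x; apply: lt_le_trans Jl; exact: expR_gt0.
have e3 : 1 + K3 * s <= expR (K3 * s) by exact: expR_ge1Dx.
(* A bound by the weight of [g] at the foot of the characteristic is moved to the weight of the
   advected density by [log_weight_scale], at the price [expR (K1 * s)]. *)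
have fin (X Y' : R) x : `|X - Y'| <= K3 * s * ((C + 1) * log_weight r M (g (phi (- s) x))) ->
  `|Y'| <= C * log_weight r M (g (phi (- s) x)) ->
  `|X| <= ((C + 1) * expR (K3 * s) - 1) * expR (K1 * s) * log_weight r (M * expR (K1 * s)) (advection phi s g x).
  move=> XY Yb; have [_ sc2] := sc x.
  have b1 : `|X| <= ((C + 1) * expR (K3 * s) - 1) * log_weight r M (g (phi (- s) x)).
    rewrite -[X](subrK Y') (le_trans (ler_normD _ _))// (le_trans (lerD XY Yb))//.
    rewrite mulrA -mulrDl ler_wpM2r//.
    have C1 : 0 <= C + 1 by rewrite addr_ge0.
    have := ler_wpM2l C1 e3; lra.
  apply: (le_trans b1); rewrite -mulrA ler_wpM2l//.
  rewrite subr_ge0 -[leLHS]mulr1 ler_pM// ?lerDr//.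
  by rewrite -expR0 ler_expR mulr_ge0.
split => //.
- move=> x; have [-> _] := sc x; rewrite andbT mulr_gt0//.
  by have /andP[] := gM (phi (- s) x).
- move=> x.
  have := Jb x; rewrite normrN ger0_norm// => /andP[Jl _].
  apply: (@le_trans _ _ (expR (- (c * sqr1 (phi (- s) x) ^+ m)) * expR (- (K1 * s)))); last first.
    by rewrite ler_pM// ?expR_ge0.
  rewrite -expRD ler_expR -opprD lerN2.
  have V1 : 1 <= sqr1 x ^+ m by rewrite exprn_ege1// sqr1_ge1.
  rewrite mulrDl lerD//; last by rewrite ler_peMr ?mulr_ge0.
  rewrite -[leRHS]mulrA ler_wpM2l//.
  have := Vexp x st; rewrite normrN ger0_norm// => Vx.
  rewrite -[m%:R * _ * _]mulrA expRM_natl -exprMn lerXn2r ?nnegrE//.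
    by rewrite (le_trans ler01)// sqr1_ge1.
  by rewrite mulr_ge0 ?expR_ge0// (le_trans ler01)// sqr1_ge1.
- by move=> i x; apply: fin (f1 i x) (g1 i _).
- by move=> i j x; apply: fin (f2 i j x) (g2 i j _).
Qed.
End Advection.

(** * Integration on tuples *)

Section MeasurabilityTuple.
Context {R : realType} {d : nat}.
Local Notation mR := (measurableTypeR R).

Lemma measurable_coord (i : 'I_d) :
  measurable_fun setT (fun t : d.-tuple mR => row_of_tuple t 0 i).
Proof.
under eq_fun do rewrite mxE.
exact: measurable_tnth.
Qed.

(** Links the topology of row vectors to the product sigma-algebra of tuples: an open set is a
    countable union of cubes with rational centres and radii [1 / (n + 1)], enumerated through
    [pickle]. *)
Lemma open_measurable_tuple (O : set 'rV[R]_d) : open O ->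
  measurable [set t : d.-tuple mR | O (row_of_tuple t)].
Proof.
move=> oO.
pose box (p : 'rV[rat]_d * nat) : set (d.-tuple mR) :=
  [set t | forall i, `|ratr (p.1 0 i) - row_of_tuple t 0 i| < p.2.+1%:R^-1].
pose P (k : nat) : Prop := if @unpickle ('rV[rat]_d * nat)%type k is Some p then
  box p `<=` [set t | O (row_of_tuple t)] else False.
pose F (k : nat) := if @unpickle ('rV[rat]_d * nat)%type k is Some p then box p else set0.
have -> : [set t : d.-tuple mR | O (row_of_tuple t)] = \bigcup_(k in P) F k.
  apply/seteqP; split=> [t /= Ot|t [k]]; last first.
    by rewrite /P /F; case: unpickle => // p; apply.
  have [e /= e0 He] := (nbhs_ballP _ _).1 (open_nbhs_nbhs (conj oO Ot)).
  pose n := (Num.truncn (2 / e)).+1.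
  have ne : 2 * n.+1%:R^-1 < e.
    rewrite ltr_pdivrMr// -ltr_pdivrMl// mulrC (lt_trans (truncnS_gt _))// ltr_nat//.
  have n0 : 0 < n.+1%:R^-1 :> R by rewrite invr_gt0.
  have /choice[q Hq] : forall i : 'I_d, exists q : rat, `|ratr q - row_of_tuple t 0 i| < n.+1%:R^-1.
    move=> i; have /rat_in_itvoo[q] : row_of_tuple t 0 i - n.+1%:R^-1 < row_of_tuple t 0 i + n.+1%:R^-1.
      by rewrite ltrD2l gtrN.
    by rewrite in_itv/= => qq; exists q; rewrite ltr_distl.
  pose p : 'rV[rat]_d * nat := (\row_i q i, n).
  have tp : box p t by move=> i; rewrite /= mxE.
  exists (pickle p); last by rewrite /F pickleK.
  rewrite /P pickleK => t' Ht' /=; apply: He; rewrite -ball_normE /ball_/=.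
  apply: le_lt_trans ne; apply: norm_le_coord => [|i]; first by rewrite mulr_ge0.
  have := Ht' i; have := Hq i; rewrite !mxE /= ?mxE => h1 h2.
  rewrite -(subrKA (ratr (q i))) (le_trans (ler_normD _ _))//.
  by rewrite mulr_natl mulr2n lerD// ltW// distrC.
apply: bigcup_measurable => k _; rewrite /F; case: unpickle => // p.
have -> : box p = \bigcap_(i in setT) [set t | `|ratr (p.1 0 i) - row_of_tuple t 0 i| < p.2.+1%:R^-1].
  by apply/seteqP; split => [t H i _|t H i]; exact: H.
apply: fin_bigcap_measurable => // i _.
have mf : measurable_fun setT (fun t : d.-tuple mR => `|ratr (p.1 0 i) - row_of_tuple t 0 i|).
  apply: measurableT_comp => //; apply: measurable_funB => //; exact: measurable_coord.
have := mf measurableT `]-oo, p.2.+1%:R^-1[%classic (measurable_itv _).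
by rewrite setTI; congr measurable; apply/seteqP; split => t /=; rewrite in_itv.
Qed.

Lemma continuous_measurable_tuple (f : 'rV[R]_d -> R) : continuous f ->
  measurable_fun setT (fun t : d.-tuple mR => f (row_of_tuple t)).
Proof.
move=> cf; apply: (measurability _ (RGenOpens.measurableE R)).
move=> _ [_ [a [b ->] <-]]; rewrite setTI.
apply: (open_measurable_tuple (O := f @^-1` `]a, b[%classic)).
by move/continuousP: cf; apply; exact: interval_open.
Qed.
End MeasurabilityTuple.

Section Reflection.
Context {R : realType}.
Local Notation mR := (measurableTypeR R).

(** Uniqueness of Lebesgue measure: reflection moves the closed end of a half-open interval but
    preserves its length. *)
Lemma lebesgue_measure_refl (a : R) (A : set mR) : measurable A ->
  pushforward lebesgue_measure ((fun x => a - x) : mR -> mR) A = lebesgue_measure A.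
Proof.
have mf : measurable_fun setT ((fun x => a - x) : mR -> mR) by exact: measurable_funB.
move=> mA; apply/esym.
apply: (lebesgue_measure_unique (mu := [the measure _ _ of pushforward lebesgue_measure
  ((fun x => a - x) : mR -> mR)])) => //= _ [[u v]] _ <-.
rewrite /pushforward/=.
have -> : (fun x : R => a - x) @^-1` `]u, v] = `[a - v, a - u[%classic.
  by apply/seteqP; split => x /=; rewrite !in_itv/= => /andP[? ?]; apply/andP; split; lra.
rewrite !lebesgue_measure_itv/= !lte_fin ltrD2l ltrN2; case: ifP => // _.
by rewrite -!EFinB; congr EFin; lra.
Qed.

Lemma ge0_integral_refl (a : R) (F : mR -> \bar R) : measurable_fun setT F ->
  (forall x, 0 <= F x)%E ->
  (\int[lebesgue_measure]_x F (a - x)%R = \int[lebesgue_measure]_x F x)%E.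
Proof.
move=> mF F0.
have mf : measurable_fun setT ((fun x => a - x) : mR -> mR) by exact: measurable_funB.
have := ge0_integral_pushforward mf lebesgue_measure measurableT mF (fun x _ => F0 x).
rewrite preimage_setT => <-.
by apply: eq_measure_integral => //= A mA _; exact: lebesgue_measure_refl.
Qed.

(** Tonelli splits off the first coordinate, which sets up inductions on the dimension. *)
Lemma ge0_integral_tuple_cons n (F : n.+1.-tuple mR -> \bar R) : measurable_fun setT F ->
  (forall x, 0 <= F x)%E ->
  (\int[lebesgue_tuple n.+1]_t F t =
   \int[lebesgue_measure]_x \int[lebesgue_tuple n]_t F (tuple_cons (x, t)))%E.
Proof.
move=> mF F0.
have := ge0_integral_pushforward (@measurable_tuple_cons R n)
  (lebesgue_measure \x lebesgue_tuple n)%E measurableT mF (fun x _ => F0 x).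
rewrite preimage_setT => E.
transitivity (\int[pushforward (lebesgue_measure \x lebesgue_tuple n) (@tuple_cons R n)]_t F t)%E.
  by [].
rewrite E fubini_tonelli1//; last by move=> p; exact: F0.
exact: (measurableT_comp mF (@measurable_tuple_cons R n)).
Qed.

Definition tuple_refl n (a t : n.-tuple mR) : n.-tuple mR :=
  [tuple tnth a i - tnth t i | i < n].

Lemma measurable_tuple_refl n (a : n.-tuple mR) : measurable_fun setT (tuple_refl a).
Proof.
apply/measurable_fun_tnthP => i.
rewrite (_ : _ \o _ = fun t => tnth a i - tnth t i); last first.
  by apply/funext => t /=; rewrite tnth_mktuple.
by apply: measurable_funB => //; exact: measurable_tnth.
Qed.

(* The involution [t |-> a - t] gives both the change of variables in convolutions
   and the symmetry of Gaussian integrals. *)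
Lemma ge0_integral_tuple_refl n (a : n.-tuple mR) (F : n.-tuple mR -> \bar R) :
  measurable_fun setT F -> (forall x, 0 <= F x)%E ->
  (\int[lebesgue_tuple n]_t F (tuple_refl a t) = \int[lebesgue_tuple n]_t F t)%E.
Proof.
elim: n a F => [|n IH] a F mF F0.
  by apply: eq_integral => t _; congr F; apply/eq_from_tnth => -[].
rewrite !ge0_integral_tuple_cons//; last first.
  exact: (measurableT_comp mF (measurable_tuple_refl a)).
pose a' : n.-tuple mR := [tuple of behead a].
have reflE x t : tuple_refl a (tuple_cons (x, t)) = tuple_cons (thead a - x, tuple_refl a' t).
  apply/eq_from_tnth => i; rewrite tnth_mktuple.
  case: (unliftP ord0 i) => [j ->|->]; rewrite ?tnthS/=.
    rewrite tnth_mktuple tnth_behead; congr (tnth a _ - _).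
    by apply/val_inj; rewrite /= inordK// ltnS.
  by rewrite !tnth0.
transitivity (\int[lebesgue_measure]_x \int[lebesgue_tuple n]_t F (tuple_cons ((thead a - x)%R, t)))%E.
  apply: eq_integral => x _.
  under eq_integral do rewrite reflE.
  apply: (IH a' (fun t => F (tuple_cons ((thead a - x)%R, t)))) => //.
  apply: (measurableT_comp mF); apply: (measurableT_comp (@measurable_tuple_cons R n)).
  exact: measurable_pair1.
apply: (ge0_integral_refl (thead a) (F := fun x => (\int[lebesgue_tuple n]_t F (tuple_cons (x, t)))%E)).
  apply: (measurable_fun_fubini_tonelli_F (F \o @tuple_cons R n)).
    exact: (measurableT_comp mF (@measurable_tuple_cons R n)).
  by move=> p; exact: F0.
by move=> x; apply: integral_ge0 => t _; exact: F0.
Qed.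

Lemma integral_tuple_prod n (p : R -> R) : measurable_fun setT (p : mR -> mR) ->
  (forall x, 0 <= p x) -> (\int[lebesgue_measure]_x (p x)%:E = 1)%E ->
  (\int[lebesgue_tuple n]_t (\prod_i p (tnth t i))%:E = 1)%E.
Proof.
move=> mp p0 p1; elim: n => [|n IH].
  rewrite [X in (\int[X]_t _)%E](_ : _ = \d_([tuple] : 0.-tuple mR))//.
  rewrite integral_dirac//= ?diracT ?mul1e; last first.
    by apply/measurable_EFinP; apply: measurable_prod => i; case: i.
  by rewrite big_ord0.
have mP m : measurable_fun setT (fun t : m.-tuple mR => (\prod_i p (tnth t i))%:E).
  apply/measurable_EFinP; apply: measurable_prod => i _.
  by apply: (measurableT_comp mp); exact: measurable_tnth.
rewrite ge0_integral_tuple_cons//; last by move=> t; rewrite lee_fin prodr_ge0.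
rewrite -[RHS]p1; apply: eq_integral => x _.
transitivity (\int[lebesgue_tuple n]_t ((p x)%:E * (\prod_i p (tnth t i))%:E))%E.
  apply: eq_integral => t _; rewrite -EFinM big_ord_recl/= tnth0; congr (_ * _)%:E.
  by apply: eq_bigr => i _; rewrite tnthS.
rewrite ge0_integralZl_EFin//; first by rewrite IH mule1.
  by move=> t _; rewrite lee_fin prodr_ge0.
exact: mP.
Qed.
End Reflection.

(** * Gaussian averages *)

Section HeatKernel.
Context {R : realType} {d : nat} (beta : R) (beta0 : 0 < beta).
Local Notation mR := (measurableTypeR R).
Local Notation mu := (lebesgue_tuple d).

Lemma enorm_sqr (z : 'rV[R]_d) : enorm z ^+ 2 = \sum_i z 0 i ^+ 2.
Proof. by rewrite /enorm sqr_sqrtr//; apply: sumr_ge0 => i _; exact: sqr_ge0. Qed.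

Lemma heat_kernel_ge0 s (z : 'rV[R]_d) : 0 <= heat_kernel beta s z.
Proof. by rewrite mulr_ge0 ?powR_ge0 ?expR_ge0. Qed.

(** Factorisation into centred normal densities of variance [2 s / beta] reduces the total mass of
    the kernel to dimension one. *)
Lemma heat_kernel_prod (s : R) (t : d.-tuple mR) : 0 < s ->
  heat_kernel beta s (row_of_tuple t) =
  \prod_i normal_pdf 0 (Num.sqrt (2 * s / beta)) (tnth t i).
Proof.
move=> s0; set sg := Num.sqrt _.
have q0 : 0 < 2 * s / beta by rewrite divr_gt0// mulr_gt0.
have sg0 : sg != 0 by rewrite gt_eqF// sqrtr_gt0.
have sg2 : sg ^+ 2 = 2 * s / beta by rewrite sqr_sqrtr// ltW.
have p0 : 0 < 4 * pi / beta * s by rewrite !mulr_gt0 ?pi_gt0 ?invr_gt0.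
rewrite (eq_bigr (fun i => normal_peak sg * normal_fun 0 sg (tnth t i))); last first.
  by move=> i _; rewrite normal_pdfE.
rewrite big_split/= prodr_const card_ord; congr (_ * _).
  rewrite /normal_peak sg2 (_ : 2 * s / beta * pi *+ 2 = 4 * pi / beta * s); last by rewrite -mulr_natl; ring.
  rewrite powRN [d%:R / 2]mulrC powRrM powR_mulrn ?powR_ge0// powR12_sqrt ?(ltW p0)//.
  by rewrite exprVn.
rewrite /normal_fun -expR_sum; congr expR.
rewrite enorm_sqr mulr_sumr mulr_suml -sumrN; apply: eq_bigr => i _.
rewrite mxE subr0 sg2 -mulr_natl; field.
by rewrite !gt_eqF.
Qed.

Lemma continuous_enorm2 : continuous (fun z : 'rV[R]_d => \sum_i z 0 i ^+ 2).
Proof.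
move=> x; have -> : (fun z : 'rV[R]_d => \sum_i z 0 i ^+ 2) = \sum_i (fun z : 'rV[R]_d => z 0 i ^+ 2).
  by apply/funext => z; rewrite fct_sumE.
elim/big_ind : _ => [|f g cf cg|i _]; [exact: cst_continuous|exact: continuousD|].
apply: (@continuous_comp _ _ _ (fun z : 'rV[R]_d => z 0 i) (fun y : R => y ^+ 2)).
  exact: coord_continuous.
exact: exprn_continuous.
Qed.

Lemma measurable_heat_kernel s : measurable_fun setT
  (fun t : d.-tuple mR => heat_kernel beta s (row_of_tuple t)).
Proof.
apply: measurable_funM => //.
apply: measurableT_comp => //.
under eq_fun do rewrite enorm_sqr -mulNr.
apply: measurable_funM => //; apply: measurableT_comp => //.
apply: measurable_funM => //.
by apply: (continuous_measurable_tuple (f := fun z => \sum_i z 0 i ^+ 2)); exact: continuous_enorm2.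
Qed.

Lemma integral_heat_kernel s : 0 < s ->
  (\int[mu]_t (heat_kernel beta s (row_of_tuple t))%:E = 1)%E.
Proof.
move=> s0; under eq_integral do rewrite heat_kernel_prod//.
apply: integral_tuple_prod.
- exact: measurable_normal_pdf.
- by move=> x; exact: normal_pdf_ge0.
- by apply: integral_normal_pdf.
Qed.

Lemma heat_kernelN s (z : 'rV[R]_d) : heat_kernel beta s (- z) = heat_kernel beta s z.
Proof.
rewrite /heat_kernel !enorm_sqr.
have -> : \sum_i (- z) 0 i ^+ 2 = \sum_i z 0 i ^+ 2.
  by apply: eq_bigr => i _; rewrite mxE sqrrN.
by [].
Qed.

Lemma measurable_refl_comp (w : 'rV[R]_d -> R) (x : 'rV[R]_d) :
  measurable_fun setT (fun t : d.-tuple mR => w (row_of_tuple t)) ->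
  measurable_fun setT (fun t : d.-tuple mR => w (x - row_of_tuple t)).
Proof.
move=> mw; pose a : d.-tuple mR := [tuple x 0 i | i < d].
have := measurableT_comp mw (measurable_tuple_refl a).
congr measurable_fun; apply/funext => t /=; congr w.
by apply/rowP => i; rewrite !mxE !tnth_mktuple.
Qed.

(** Expectation of [w] under the centred Gaussian law of covariance [(2 s / beta) I]. *)
Definition gauss_avg (s : R) (w : 'rV[R]_d -> R) : R :=
  \int[mu]_t (heat_kernel beta s (row_of_tuple t) * w (row_of_tuple t)).

(** The substitution [y -> x - y] moves the variable [x] from the kernel into [g], so that
    differentiation in [x] falls on [g]. *)
Lemma diffusion_gav s (g : 'rV[R]_d -> R) x : 0 < s ->
  measurable_fun setT (fun t : d.-tuple mR => g (row_of_tuple t)) ->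
  (forall y, 0 <= g y) -> diffusion beta s g x = gauss_avg s (fun z => g (x - z)).
Proof.
move=> s0 mg g0; rewrite /diffusion gt_eqF//; congr fine.
pose a : d.-tuple mR := [tuple x 0 i | i < d].
have rowE t : row_of_tuple (tuple_refl a t) = x - row_of_tuple t.
  by apply/rowP => i; rewrite !mxE !tnth_mktuple.
pose F (t : d.-tuple mR) := (heat_kernel beta s (row_of_tuple t) * g (x - row_of_tuple t))%:E.
rewrite -(@ge0_integral_tuple_refl _ _ a F).
- by apply: eq_integral => t _; rewrite /F !rowE subKr.
- apply/measurable_EFinP; apply: measurable_funM; first exact: measurable_heat_kernel.
  exact: measurable_refl_comp.
- by move=> t; rewrite lee_fin mulr_ge0 ?heat_kernel_ge0.
Qed.

Context (s : R) (s0 : 0 < s).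
Local Notation G t := (heat_kernel beta s (row_of_tuple t)).

Definition gauss_int (w : 'rV[R]_d -> R) :=
  mu.-integrable setT (EFin \o (fun t => G t * w (row_of_tuple t))).

Lemma gauss_int_cst c : gauss_int (fun=> c).
Proof.
apply/integrableP; split.
  by apply/measurable_EFinP; apply: measurable_funM => //; exact: measurable_heat_kernel.
under eq_integral => t _.
  rewrite /= normrM ger0_norm ?heat_kernel_ge0// mulrC EFinM.
  over.
rewrite ge0_integralZl_EFin//.
- by rewrite integral_heat_kernel// mule1 ltey.
- by move=> t _; rewrite lee_fin heat_kernel_ge0.
- by apply/measurable_EFinP; exact: measurable_heat_kernel.
Qed.

Lemma gauss_int_le (w W : 'rV[R]_d -> R) :
  measurable_fun setT (fun t : d.-tuple mR => w (row_of_tuple t)) ->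
  (forall z, `|w z| <= W z) -> gauss_int W -> gauss_int w.
Proof.
move=> mw wW; apply: le_integrable => //.
  by apply/measurable_EFinP; apply: measurable_funM => //; exact: measurable_heat_kernel.
move=> t _ /=; rewrite lee_fin !normrM ler_wpM2l//.
by rewrite (le_trans (wW _))// ler_norm.
Qed.

Lemma gauss_int_bounded (w : 'rV[R]_d -> R) K :
  measurable_fun setT (fun t : d.-tuple mR => w (row_of_tuple t)) ->
  (forall z, `|w z| <= K) -> gauss_int w.
Proof. by move=> mw wK; apply: (gauss_int_le mw wK); exact: gauss_int_cst. Qed.

Lemma gauss_avg_cst c : gauss_avg s (fun=> c) = c.
Proof.
rewrite /gauss_avg RintegralZr//; last first.
  have := gauss_int_cst 1; congr (_.-integrable _ _); apply/funext => t /=.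
  by rewrite mulr1.
by rewrite /Rintegral integral_heat_kernel//= mul1r.
Qed.

Lemma gauss_intD w W : gauss_int w -> gauss_int W -> gauss_int (fun z => w z + W z).
Proof.
move=> iw iW; have := integrableD measurableT iw iW.
by congr (_.-integrable _ _); apply/funext => t /=; rewrite -EFinD mulrDr.
Qed.

Lemma gauss_intZ c w : gauss_int w -> gauss_int (fun z => c * w z).
Proof.
move=> iw; have := integrableZl measurableT c iw.
by congr (_.-integrable _ _); apply/funext => t /=; rewrite -EFinM mulrCA.
Qed.

Lemma gauss_avgD w W : gauss_int w -> gauss_int W -> gauss_avg s (fun z => w z + W z) = gauss_avg s w + gauss_avg s W.
Proof.
move=> iw iW; rewrite /gauss_avg -RintegralD//.
by apply: eq_Rintegral => t _; rewrite mulrDr.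
Qed.

Lemma gauss_avgZ c w : gauss_int w -> gauss_avg s (fun z => c * w z) = c * gauss_avg s w.
Proof.
move=> iw; rewrite /gauss_avg -RintegralZl//.
by apply: eq_Rintegral => t _; rewrite mulrCA.
Qed.

Lemma gauss_int_sum n (w : 'I_n -> 'rV[R]_d -> R) : (forall i, gauss_int (w i)) ->
  gauss_int (fun z => \sum_i w i z).
Proof.
elim: n w => [|n IH] w iw.
  have := gauss_int_cst 0; congr gauss_int; apply/funext => z; by rewrite big_ord0.
have := gauss_intD (IH (fun k => w (widen_ord (leqnSn n) k)) (fun k => iw _)) (iw ord_max).
by congr gauss_int; apply/funext => z; rewrite big_ord_recr.
Qed.

Lemma gauss_avg_sum n (w : 'I_n -> 'rV[R]_d -> R) : (forall i, gauss_int (w i)) ->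
  gauss_avg s (fun z => \sum_i w i z) = \sum_i gauss_avg s (w i).
Proof.
elim: n w => [|n IH] w iw.
  rewrite big_ord0 -[RHS](gauss_avg_cst 0); congr gauss_avg; apply/funext => z.
  by rewrite big_ord0.
rewrite big_ord_recr/= -IH// -gauss_avgD//; last exact: gauss_int_sum.
by congr gauss_avg; apply/funext => z; rewrite big_ord_recr.
Qed.

Lemma gauss_avg_le w W : gauss_int w -> gauss_int W -> (forall z, w z <= W z) -> gauss_avg s w <= gauss_avg s W.
Proof.
move=> iw iW wW; apply: le_Rintegral => // t _.
by rewrite ler_wpM2l ?heat_kernel_ge0.
Qed.

Lemma gauss_avg_norm_le w W : gauss_int w -> gauss_int W -> (forall z, `|w z| <= W z) ->
  `|gauss_avg s w| <= gauss_avg s W.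
Proof.
move=> iw iW wW; rewrite ler_norml; apply/andP; split.
  rewrite -mulN1r -gauss_avgZ//; apply: gauss_avg_le => //; first exact: gauss_intZ.
  by move=> z; have := wW z; rewrite ler_norml mulN1r => /andP[].
by apply: gauss_avg_le => // z; have := wW z; rewrite ler_norml => /andP[].
Qed.
End HeatKernel.

(** * Differentiation under a Gaussian average *)

Section GaussianDifferentiation.
Context {R : realType} {d : nat} (beta : R) (beta0 : 0 < beta).
Local Notation mR := (measurableTypeR R).
Local Notation mu := (lebesgue_tuple d).
Local Notation mtuple w := (measurable_fun setT (fun t : d.-tuple mR => w (row_of_tuple t))).

Lemma continuous_shift (g : 'rV[R]_d -> R) (v : 'rV[R]_d) : continuous g -> continuous (fun y : 'rV[R]_d => g (y + v)).
Proof.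
move=> cg y.
have c1 : (fun u : 'rV[R]_d => u + v) @ y --> y + v 
  by apply: (@continuousD _ _ _ (fun u : 'rV[R]_d => u) (fun _ => v)) => //; exact: cst_continuous.
exact: (cvg_comp _ _ c1 (cg (y + v))).
Qed.

Lemma delta_norm_le (k : 'I_d) (h : R) : `|h *: (delta_mx 0 k : 'rV[R]_d)| <= `|h|.
Proof.
rewrite normrZ ler_piMr//; apply: norm_le_coord => // i.
by rewrite mxE; case: (_ && _); rewrite ?normr1 ?normr0.
Qed.

Lemma sum_delta (k : 'I_d) (h : R) (b : 'I_d -> R) :
  \sum_i (h *: (delta_mx 0 k : 'rV[R]_d)) 0 i * b i = h * b k.
Proof.
rewrite (bigD1 k)//= big1 ?addr0 => [|j ji]; rewrite !mxE eqxx/= ?eqxx ?mulr1//.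
by rewrite (negbTE ji) mulr0 mul0r.
Qed.

(** Twice differentiability does not make the second partial derivatives continuous; measurability
    comes from the limit of difference quotients instead. *)
Lemma partial_measurable (g : 'rV[R]_d -> R) k : (forall x, differentiable g x) ->
  mtuple (partial k g).
Proof.
move=> dg.
have cg : continuous g by move=> x; exact: differentiable_continuous.
pose v (n : nat) : 'rV[R]_d := n.+1%:R^-1 *: delta_mx 0 k.
apply: (measurable_fun_cvg (h := fun n t => n.+1%:R * (g (row_of_tuple t + v n) - g (row_of_tuple t)))).
  move=> n; apply: measurable_funM => //; apply: measurable_funB.
    by apply: (continuous_measurable_tuple (f := fun y => g (y + v n))); exact: continuous_shift.
  exact: continuous_measurable_tuple.
move=> t _; apply/cvgrPdist_le => e e0.
have [eta eta0 H] := has_gradP (dg (row_of_tuple t)) e0.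
exists (Num.truncn eta^-1) => // n /= Nn.
have n0 : 0 < n.+1%:R :> R by rewrite ltr0n.
have nle : n.+1%:R^-1 <= eta.
  rewrite -[leRHS]invrK lef_pV2 ?posrE ?invr_gt0//.
  by rewrite (le_trans (ltW (truncnS_gt _)))// ler_nat ltnS.
have vn : `|v n| <= n.+1%:R^-1.
  by rewrite (le_trans (delta_norm_le _ _))// ger0_norm// invr_ge0.
have := H (v n) (le_trans vn nle); rewrite sum_delta => H1.
rewrite distrC -(ler_pM2l (x := n.+1%:R^-1)) ?invr_gt0//.
rewrite -[X in X * `|_| <= _](@ger0_norm _ n.+1%:R^-1) ?invr_ge0// -normrM mulrBr mulrA mulVf ?gt_eqF// mul1r.
by rewrite (le_trans H1)// mulrC ler_wpM2r// ltW.
Qed.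

Context (s : R) (s0 : 0 < s).
Local Notation G t := (heat_kernel beta s (row_of_tuple t)).

(** Dominated convergence is sequential, so failure of the expansion is turned into increments [v n]
    tending to 0. The normalised remainders [q n] are bounded by [2 d K] and tend pointwise to 0,
    which contradicts their averages exceeding [e]. *)
Lemma gauss_avg_has_grad (g : 'rV[R]_d -> R) (K : R) : (forall x, differentiable g x) ->
  (forall x, `|g x| <= K) -> (forall k x, `|partial k g x| <= K) -> forall x,
  has_grad (fun y => gauss_avg beta s (fun z => g (y - z))) x
    (fun k => gauss_avg beta s (fun z => partial k g (x - z))).
Proof.
move=> dg gK dgK x.
have cg : continuous g by move=> y; exact: differentiable_continuous.
have K0 : 0 <= K by apply: le_trans (gK 0).
have mg : mtuple g by exact: continuous_measurable_tuple.
have mgx y : mtuple (fun z => g (y - z)) by exact: measurable_refl_comp.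
have mpx k y : mtuple (fun z => partial k g (y - z)).
  by apply: measurable_refl_comp; exact: partial_measurable.
have ig y : gauss_int beta s (fun z => g (y - z)) by apply: (gauss_int_bounded _ _ (K := K)).
have ip k y : gauss_int beta s (fun z => partial k g (y - z)).
  by apply: (gauss_int_bounded _ _ (K := K)) => // z; exact: dgK.
apply: contrapT => /existsNP[e /not_implyP[e0 /forall2NP He]].
have /choice[v Hv] : forall n : nat, exists v : 'rV[R]_d, `|v| <= n.+1%:R^-1 /\
   ~ (`|gauss_avg beta s (fun z => g (x + v - z)) - gauss_avg beta s (fun z => g (x - z)) -
     \sum_i v 0 i * gauss_avg beta s (fun z => partial i g (x - z))| <= e * `|v|).
  move=> n; have n0 : 0 < n.+1%:R^-1 :> R by rewrite invr_gt0.
  have [//|/existsNP[v /not_implyP[? ?]]] := He n.+1%:R^-1.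
  by exists v.
pose q n z := (g (x + v n - z) - g (x - z) - \sum_i v n 0 i * partial i g (x - z)) / `|v n|.
have v0 n : 0 < `|v n|.
  rewrite normr_gt0; apply/eqP => vn0; have [_] := Hv n; apply.
  rewrite vn0 addr0 subrr big1 ?subr0 ?normr0 ?mulr0//.
  by move=> i _; rewrite mxE mul0r.
have qK n z : `|q n z| <= 2 * (d%:R * K).
  rewrite /q normrM normfV normr_id ler_pdivrMr// mulrDl mul1r.
  have H1 := grad_bound_lip dg dgK (x - z) (v n).
  have H2 : `|\sum_i v n 0 i * partial i g (x - z)| <= d%:R * K * `|v n|.
    by apply: norm_sum_coord_le => i; exact: dgK.
  rewrite mulrDl (le_trans (ler_normB _ _))// lerD//.
  by rewrite [x + v n - z]addrAC.
have mq n : mtuple (q n).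
  apply: measurable_funM => //; apply: measurable_funB.
    by apply: measurable_funB.
  by apply: measurable_sum => i; apply: measurable_funM.
have iq n : gauss_int beta s (q n) by apply: (gauss_int_bounded _ _ (K := 2 * (d%:R * K))).
have gauss_avgq n : gauss_avg beta s (q n) = (gauss_avg beta s (fun z => g (x + v n - z)) - gauss_avg beta s (fun z => g (x - z)) -
     \sum_i v n 0 i * gauss_avg beta s (fun z => partial i g (x - z))) / `|v n|.
  have -> : q n = fun z => `|v n|^-1 * (g (x + v n - z) + (-1 * g (x - z) +
     -1 * \sum_i v n 0 i * partial i g (x - z))).
    by apply/funext => z; rewrite /q; ring.
  have i1 : gauss_int beta s (fun z => -1 * g (x - z)) by exact: gauss_intZ.
  have i2 : gauss_int beta s (fun z => \sum_i v n 0 i * partial i g (x - z)).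
    by apply: gauss_int_sum => // i; exact: gauss_intZ.
  have i3 := gauss_intZ (-1) i2.
  have i4 := gauss_intD i1 i3.
  rewrite gauss_avgZ//; last exact: gauss_intD.
  rewrite gauss_avgD// gauss_avgD// gauss_avgZ// gauss_avgZ// gauss_avg_sum//; last by move=> i; exact: gauss_intZ.
  rewrite (eq_bigr (fun i => v n 0 i * gauss_avg beta s (fun z => partial i g (x - z)))); last first.
    by move=> i _; rewrite gauss_avgZ.
  ring.
have qcvg t : (fun n => q n (row_of_tuple t)) @ \oo --> (0 : R).
  apply/cvgrPdist_le => e' e'0.
  have [eta eta0 H] := has_gradP (dg (x - row_of_tuple t)) e'0.
  exists (Num.truncn eta^-1) => // n /= Nn.
  have nle : n.+1%:R^-1 <= eta.
    rewrite -[leRHS]invrK lef_pV2 ?posrE ?invr_gt0//.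
    by rewrite (le_trans (ltW (truncnS_gt _)))// ler_nat ltnS.
  rewrite sub0r normrN /q normrM normfV normr_id ler_pdivrMr//.
  rewrite [x + v n - _]addrAC; apply: H.
  by have [vn _] := Hv n; exact: le_trans nle.
have [||||| _ _ D3] := @dominated_convergence _ _ _ mu setT measurableT
   (fun n t => (G t * q n (row_of_tuple t))%:E) (fun=> 0%E)
   (fun t => (G t * (2 * (d%:R * K)))%:E).
- by move=> n; apply/measurable_EFinP; apply: measurable_funM => //; exact: measurable_heat_kernel.
- exact: measurable_cst.
- apply: aeW => t _; apply: cvg_EFin; first by near=> n.
  rewrite -[X in _ --> X](mulr0 (G t)); apply: cvgM; first exact: cvg_cst.
  exact: qcvg.
- exact: gauss_int_cst.
- apply: aeW => t n _; rewrite lee_fin normrM ger0_norm ?heat_kernel_ge0//.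
  by rewrite ler_wpM2l ?heat_kernel_ge0.
have {}D3 : (fun n => gauss_avg beta s (q n)) @ \oo --> (0 : R).
  move: D3; rewrite integral_cst//= mul0e => D3.
  exact: (fine_cvg D3).
move/cvgrPdist_le : D3 => /(_ _ e0)[N _ HN].
have := HN N (leqnn N); rewrite sub0r normrN gauss_avgq normrM normfV normr_id ler_pdivrMr//.
by have [_] := Hv N.
Unshelve. all: by end_near. Qed.

Lemma gauss_avg_diff (g : 'rV[R]_d -> R) (K : R) : (forall x, differentiable g x) ->
  (forall x, `|g x| <= K) -> (forall k x, `|partial k g x| <= K) ->
  (forall x, differentiable (fun y => gauss_avg beta s (fun z => g (y - z))) x) /\
  forall k, partial k (fun y => gauss_avg beta s (fun z => g (y - z))) =
    fun y => gauss_avg beta s (fun z => partial k g (y - z)).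
Proof.
move=> dg gK dgK; split=> [x|k].
  by have [] := has_grad_diff (gauss_avg_has_grad dg gK dgK x).
by apply/funext => x; have [_ ->] := has_grad_diff (gauss_avg_has_grad dg gK dgK x).
Qed.
End GaussianDifferentiation.

(** * Gaussian averages of powers of [1 + |x|^2] *)

Section Moments.
Context {R : realType} {d : nat} (beta : R) (beta0 : 0 < beta).
Local Notation mR := (measurableTypeR R).
Local Notation mtuple w := (measurable_fun setT (fun t : d.-tuple mR => w (row_of_tuple t))).

Definition sqn (z : 'rV[R]_d) : R := \sum_i z 0 i ^+ 2.

Lemma sqn_ge0 z : 0 <= sqn z.
Proof. by apply: sumr_ge0 => i _; exact: sqr_ge0. Qed.

(** Even and odd parts in [b] of [(al + b) ^+ m]. Here [b] may be as large as [sqrt N], but the even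
    part involves only [b ^+ 2], so it is [1 + O(N)]; the bound on [P] is needed for the
    induction. *)
Lemma even_odd_power m : exists2 C : R, 0 <= C & forall al b N : R,
  0 <= N -> 0 <= al -> al <= 1 + N -> b ^+ 2 <= N ->
  exists E P, [/\ (al + b) ^+ m = E + b * P, (al - b) ^+ m = E - b * P,
    0 <= E, E <= 1 + C * (N * (1 + N) ^+ m) & 0 <= P <= C * (1 + N) ^+ m].
Proof.
elim: m => [|m [C C0 IH]].
  exists 0 => // al b N N0 _ _ _; exists 1, 0; split; rewrite ?expr0 ?mulr0 ?addr0 ?subr0//.
  - by rewrite mul0r addr0.
  - by rewrite mul0r lexx.
exists (1 + 2 * C); first by rewrite addr_ge0// mulr_ge0.
move=> al b N N0 al0 alN bN.
have [E [P [E1 E2 E3 E4 /andP[P0 P1]]]] := IH al b N N0 al0 alN bN.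
exists (al * E + b ^+ 2 * P), (al * P + E).
set Q := (1 + N) ^+ m in E4 P1.
have N1 : 1 <= 1 + N by rewrite lerDl.
have Q1 : 1 <= Q by exact: exprn_ege1.
have Q0 : 0 <= Q by apply: le_trans Q1.
have QS : (1 + N) ^+ m.+1 = (1 + N) * Q by rewrite exprS.
have b0 := sqr_ge0 b.
split.
- by rewrite exprS E1; ring.
- by rewrite exprS E2; ring.
- by rewrite addr_ge0// mulr_ge0.
- rewrite QS.
  have h1 : al * E <= (1 + N) * (1 + C * (N * Q)) by rewrite ler_pM.
  have h2 : b ^+ 2 * P <= N * (C * Q) by rewrite ler_pM.
  apply: (le_trans (lerD h1 h2)).
  have h3 : 0 <= N * (Q - 1) by rewrite mulr_ge0// subr_ge0.
  have h4 : 0 <= N * N * Q by rewrite !mulr_ge0.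
  have h5 : 0 <= C * (N * N * Q) by rewrite mulr_ge0.
  rewrite -subr_ge0.
  have -> : 1 + (1 + 2 * C) * (N * ((1 + N) * Q)) - ((1 + N) * (1 + C * (N * Q)) + N * (C * Q)) =
    N * (Q - 1) + N * N * Q + C * (N * N * Q) by ring.
  by rewrite !addr_ge0.
- rewrite addr_ge0 ?mulr_ge0//= QS.
  have h1 : al * P <= (1 + N) * (C * Q) by rewrite ler_pM.
  apply: (le_trans (lerD h1 E4)); rewrite -subr_ge0.
  have -> : (1 + 2 * C) * ((1 + N) * Q) - ((1 + N) * (C * Q) + (1 + C * (N * Q))) =
    (Q - 1) + N * Q + C * Q by ring.
  by apply: addr_ge0; [apply: addr_ge0|]; rewrite ?mulr_ge0 ?subr_ge0.
Qed.

(** Lagrange's identity: twice the defect is a double sum of squares. *)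
Lemma cauchy_schwarz (x z : 'rV[R]_d) :
  (\sum_i x 0 i * z 0 i) ^+ 2 <= sqn x * sqn z.
Proof.
rewrite -subr_ge0 -(pmulr_rge0 _ (ltr0n R 2)).
suff -> : 2%:R * (sqn x * sqn z - (\sum_i x 0 i * z 0 i) ^+ 2) =
    \sum_i \sum_j (x 0 i * z 0 j - x 0 j * z 0 i) ^+ 2.
  by apply: sumr_ge0 => i _; apply: sumr_ge0 => j _; exact: sqr_ge0.
have S (a b : 'I_d -> R) : (\sum_i a i) * (\sum_j b j) = \sum_i \sum_j a i * b j.
  by rewrite mulr_suml; apply: eq_bigr => i _; rewrite mulr_sumr.
set xz := \sum_i x 0 i * z 0 i.
have -> : \sum_i \sum_j (x 0 i * z 0 j - x 0 j * z 0 i) ^+ 2 =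
    sqn x * sqn z + sqn z * sqn x - 2 * (xz * xz).
  rewrite /sqn /xz !S mulr_sumr -big_split -sumrB/=; apply: eq_bigr => i _.
  rewrite mulr_sumr -big_split -sumrB/=; apply: eq_bigr => j _; ring.
ring.
Qed.

(* Symmetrising removes the term linear in [z], which would only be [O(sqrt s)] on
   average. *)
Lemma sqr1_sym m : exists2 C : R, 0 <= C & forall x z : 'rV[R]_d,
  sqr1 (x + z) ^+ m + sqr1 (x - z) ^+ m <=
  2 * (sqr1 x ^+ m * (1 + C * (sqn z * (1 + sqn z) ^+ m))).
Proof.
have [C C0 H] := even_odd_power m; exists C => // x z.
set p := sqr1 x; set N := sqn z; pose xz := \sum_i x 0 i * z 0 i.
have p1 : 1 <= p by exact: sqr1_ge1.
have p0 : 0 < p by apply: lt_le_trans p1.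
have N0 : 0 <= N by exact: sqn_ge0.
have pE : p = 1 + sqn x by [].
(* Division by [p = 1 + |x|^2] normalises the expansion: [(p + N) / p <= 1 + N], and the square of
   [2 xz / p] is at most [N] by Cauchy-Schwarz and [4 |x|^2 <= (1 + |x|^2)^2]. *)
have sp : sqr1 (x + z) = p * ((p + N) / p + 2 * xz / p).
  have -> : p * ((p + N) / p + 2 * xz / p) = p + N + 2 * xz by field; rewrite gt_eqF.
  rewrite pE /sqr1 /N /xz /sqn mulr_sumr -!addrA -!big_split/=; congr (_ + _).
  by apply: eq_bigr => i _; rewrite !mxE; ring.
have sm : sqr1 (x - z) = p * ((p + N) / p - 2 * xz / p).
  have -> : p * ((p + N) / p - 2 * xz / p) = p + N - 2 * xz by field; rewrite gt_eqF.
  rewrite pE /sqr1 /N /xz /sqn mulr_sumr -!addrA -sumrN -!big_split/=; congr (_ + _).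
  by apply: eq_bigr => i _; rewrite !mxE; ring.
have [|||E [P [E1 E2 _ E3 _]]] := H ((p + N) / p) (2 * xz / p) N N0.
- apply: divr_ge0; last exact: ltW.
  by apply: addr_ge0 => //; exact: ltW.
- rewrite ler_pdivrMr// mulrDl mul1r lerD2l -[leLHS]mulr1 ler_pM//.
- rewrite expr_div_n ler_pdivrMr ?exprn_gt0//.
  have cs := cauchy_schwarz x z; rewrite -/xz -/N in cs.
  have h1 : (2 * xz) ^+ 2 <= 4 * sqn x * N by rewrite exprMn; move: cs; lra.
  apply: (le_trans h1); rewrite mulrC ler_wpM2l// pE.
  by have := sqr_ge0 (1 - sqn x); lra.
rewrite sp sm !exprMn -mulrDr E1 E2.
have -> : E + 2 * xz / p * P + (E - 2 * xz / p * P) = 2 * E by ring.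
rewrite mulrCA ler_pM2l//; apply: ler_wpM2l => //; apply: exprn_ge0; exact: ltW.
Qed.

(** [1 + u <= a expR (u / a)] for [a >= 1], with [a] so large that [n / a <= beta / 8]. The rate
    [beta / 8] is what doubling the time leaves over: with [u = |z|^2 / s] the exponents are
    [beta u / 4] at time [s] and [beta u / 8] at time [2 s]. *)
Lemma power_le_exp n : exists2 C : R, 0 <= C & forall u, 0 <= u ->
  (1 + u) ^+ n <= C * expR (beta * u / 8).
Proof.
pose a := 1 + 8 * n%:R / beta.
have a1 : 1 <= a by rewrite lerDl divr_ge0 ?(ltW beta0)// mulr_ge0.
have a0 : 0 < a by apply: lt_le_trans a1.
exists (a ^+ n); first by rewrite exprn_ge0// ltW.
move=> u u0.
have h1 : 1 + u <= a * expR (u / a).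
  apply: (@le_trans _ _ (a * (1 + u / a))).
    rewrite mulrDr mulr1 mulrCA divff ?gt_eqF// mulr1 lerD2r//.
  by rewrite ler_wpM2l ?(ltW a0)// expR_ge1Dx.
apply: (@le_trans _ _ ((a * expR (u / a)) ^+ n)).
  by rewrite lerXn2r ?nnegrE ?addr_ge0// mulr_ge0 ?expR_ge0// ltW.
rewrite exprMn ler_wpM2l ?exprn_ge0 ?(ltW a0)// -expRM_natl ler_expR.
rewrite mulrCA [beta * u]mulrC -mulrA ler_wpM2l// ler_pdivrMr//.
rewrite /a mulrDr mulr1.
have -> : beta / 8 * (8 * n%:R / beta) = n%:R by field; rewrite gt_eqF.
by rewrite lerDr divr_ge0// ltW.
Qed.

(* Polynomial factors are absorbed by doubling the time in the kernel, the factor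
   [s] being gained from the parabolic scaling. *)
Lemma heat_moment m : exists2 C : R, 0 <= C & forall s (z : 'rV[R]_d), 0 < s -> s <= 1 ->
  heat_kernel beta s z * (sqn z * (1 + sqn z) ^+ m) <= s * C * heat_kernel beta (2 * s) z.
Proof.
have [C C0 HC] := power_le_exp m.+1.
exists (C * 2 `^ (d%:R / 2)); first by rewrite mulr_ge0// powR_ge0.
move=> s z s0 s1; set N := sqn z; have N0 : 0 <= N by exact: sqn_ge0.
pose u := N / s; have u0 : 0 <= u by rewrite divr_ge0// ltW.
have NE : N = s * u by rewrite /u mulrCA divff ?gt_eqF// mulr1.
have h1 : N * (1 + N) ^+ m <= s * (1 + u) ^+ m.+1.
  rewrite [X in X * _]NE -mulrA ler_wpM2l ?(ltW s0)// exprS.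
  have Nu : N <= u by rewrite NE ler_piMl.
  by rewrite ler_pM ?exprn_ge0 ?addr_ge0// ?lerDr// lerXn2r ?nnegrE ?addr_ge0// lerD2l.
have h2 : N * (1 + N) ^+ m <= s * (C * expR (beta * u / 8)).
  by apply: (le_trans h1); rewrite ler_wpM2l ?(ltW s0)//; exact: HC.
rewrite /heat_kernel !enorm_sqr -/(sqn z) -/N.
set c := 4 * pi / beta * s.
have c0 : 0 <= c by rewrite !mulr_ge0 ?pi_ge0 ?invr_ge0// ltW.
have -> : 4 * pi / beta * (2 * s) = 2 * c by rewrite /c; ring.
rewrite [(2 * c) `^ _]powRM// [2 `^ (- _)]powRN.
apply: (@le_trans _ _ (c `^ (- (d%:R / 2)) * expR (- (beta * N / (4 * s))) * (s * (C * expR (beta * u / 8))))).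
  by rewrite ler_wpM2l// mulr_ge0 ?powR_ge0 ?expR_ge0.
have p2 : 2 `^ (d%:R / 2) != 0 :> R by rewrite gt_eqF// powR_gt0.
have -> : - (beta * N / (4 * s)) = - (beta * u / 8) + - (beta * N / (4 * (2 * s))).
  by rewrite NE; field; rewrite gt_eqF.
rewrite expRD expRN le_eqVlt; apply/orP; left; apply/eqP; field.
by rewrite p2 gt_eqF ?expR_gt0.
Qed.

Lemma continuous_sqr1 m : continuous (fun x : 'rV[R]_d => sqr1 x ^+ m).
Proof.
move=> x.
have c1 : (fun y : 'rV[R]_d => sqr1 y) @ x --> sqr1 x.
  have h1 : (fun _ : 'rV[R]_d => 1 : R) @ x --> (1 : R) by exact: (@cst_continuous _ _ (1 : R) x).
  exact: (cvgD h1 (@continuous_enorm2 R d x)).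
exact: (cvg_comp _ (fun u : R => u ^+ m) c1 (@exprn_continuous _ m _)).
Qed.

Lemma gauss_avg_opp s (w : 'rV[R]_d -> R) : mtuple w -> (forall z, 0 <= w z) ->
  gauss_avg beta s (fun z => w (- z)) = gauss_avg beta s w.
Proof.
move=> mw w0; congr fine.
pose a : d.-tuple mR := [tuple 0 | i < d].
have rowE t : row_of_tuple (tuple_refl a t) = - row_of_tuple t :> 'rV[R]_d.
  by apply/rowP => i; rewrite !mxE !tnth_mktuple sub0r.
pose F (t : d.-tuple mR) := (heat_kernel beta s (row_of_tuple t) * w (row_of_tuple t))%:E.
rewrite -[RHS](@ge0_integral_tuple_refl _ _ a F).
- by apply: eq_integral => t _; rewrite /F rowE heat_kernelN.
- by apply/measurable_EFinP; apply: measurable_funM => //; exact: measurable_heat_kernel.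
- by move=> t; rewrite lee_fin mulr_ge0 ?heat_kernel_ge0.
Qed.

(** The kernel is even, so twice the average equals the average of the symmetrised sum. The
    remaining moment is compared with the kernel at time [2 s], of total mass 1, and
    [1 + C1 C2 s <= expR (C1 C2 s)]. *)
Lemma gauss_avg_sqr1 m : exists2 K : R, 0 <= K & forall s (x : 'rV[R]_d), 0 < s -> s <= 1 ->
  gauss_int beta s (fun z => sqr1 (x - z) ^+ m) /\
  gauss_avg beta s (fun z => sqr1 (x - z) ^+ m) <= expR (K * s) * sqr1 x ^+ m.
Proof.
have [C1 C10 H1] := sqr1_sym m; have [C2 C20 H2] := heat_moment m.
exists (C1 * C2); first exact: mulr_ge0.
move=> s x s0 s1.
have s20 : 0 < 2 * s by rewrite mulr_gt0.
pose q (z : 'rV[R]_d) := sqn z * (1 + sqn z) ^+ m.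
have q0 z : 0 <= q z by rewrite mulr_ge0 ?sqn_ge0// exprn_ge0// addr_ge0// sqn_ge0.
have mq : mtuple q.
  have ms : mtuple sqn by apply: continuous_measurable_tuple; exact: continuous_enorm2.
  by apply: measurable_funM => //; apply: measurable_funX; apply: measurable_funD.
have iq : gauss_int beta s q.
  apply: (@le_integrable _ _ _ (lebesgue_tuple d) setT measurableT _
     (EFin \o (fun t => s * C2 * heat_kernel beta (2 * s) (row_of_tuple t)))).
  - by apply/measurable_EFinP; apply: measurable_funM => //; exact: measurable_heat_kernel.
  - move=> t _; rewrite /= lee_fin ger0_norm; last first.
      by apply: mulr_ge0; [exact: heat_kernel_ge0|exact: q0].
    by rewrite (le_trans (H2 _ _ s0 s1))// ler_norm.
  - rewrite (_ : EFin \o _ = EFin \o (fun t : d.-tuple mR => heat_kernel beta (2 * s) (row_of_tuple t) * (s * C2))).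
      exact: gauss_int_cst.
    by apply/funext => t /=; rewrite mulrC.
have gq : gauss_avg beta s q <= s * C2.
  have -> : s * C2 = gauss_avg beta (2 * s) (fun _ : 'rV[R]_d => s * C2) by rewrite gauss_avg_cst.
  apply: le_Rintegral => //; first exact: gauss_int_cst.
  by move=> t _; rewrite (le_trans (H2 _ _ s0 s1))// mulrC.
pose V (z : 'rV[R]_d) := sqr1 z ^+ m.
have V0 z : 0 <= V z by rewrite exprn_ge0// (le_trans ler01)// sqr1_ge1.
have mV : mtuple V by apply: continuous_measurable_tuple; exact: continuous_sqr1.
have mV1 : mtuple (fun z => V (x - z)) by exact: measurable_refl_comp.
have mV2 : mtuple (fun z => V (x + z)).
  rewrite (_ : (fun t => _) = (fun t : d.-tuple mR => V (row_of_tuple t + x))).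
    apply: (continuous_measurable_tuple (f := fun z => V (z + x))).
    by apply: continuous_shift; exact: continuous_sqr1.
  by apply/funext => t; rewrite addrC.
have iW : gauss_int beta s (fun z => 2 * (V x * (1 + C1 * q z))).
  apply: gauss_intZ => //; apply: gauss_intZ => //; apply: gauss_intD => //; first exact: gauss_int_cst.
  exact: gauss_intZ.
have i1 : gauss_int beta s (fun z => V (x - z)).
  apply: (gauss_int_le mV1 _ iW) => z; rewrite ger0_norm// (le_trans _ (H1 x z))//.
  by rewrite -/(V (x + z)) -/(V (x - z)) lerDr.
have i2 : gauss_int beta s (fun z => V (x + z)).
  apply: (gauss_int_le mV2 _ iW) => z; rewrite ger0_norm// (le_trans _ (H1 x z))//.
  by rewrite -/(V (x + z)) -/(V (x - z)) lerDl.
split=> //.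
have e1 : gauss_avg beta s (fun z => V (x - z)) = gauss_avg beta s (fun z => V (x + z)).
  by rewrite -(@gauss_avg_opp s (fun z => V (x + z))).
have e2 : gauss_avg beta s (fun z => V (x + z)) + gauss_avg beta s (fun z => V (x - z)) <=
    2 * (V x * (1 + C1 * gauss_avg beta s q)).
  rewrite -gauss_avgD//.
  have -> : 2 * (V x * (1 + C1 * gauss_avg beta s q)) = gauss_avg beta s (fun z => 2 * (V x * (1 + C1 * q z))).
    rewrite gauss_avgZ//; last by apply: gauss_intZ; apply: gauss_intD; [exact: gauss_int_cst|exact: gauss_intZ].
    rewrite gauss_avgZ//; last by apply: gauss_intD; [exact: gauss_int_cst|exact: gauss_intZ].
    rewrite gauss_avgD//; [|exact: gauss_int_cst|exact: gauss_intZ].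
    by rewrite gauss_avg_cst// gauss_avgZ.
  apply: gauss_avg_le => //; [exact: gauss_intD|by move=> z; exact: H1].
rewrite -/(V x).
have e3 : gauss_avg beta s (fun z => V (x - z)) <= V x * (1 + C1 * gauss_avg beta s q).
  by move: e2; rewrite -e1; lra.
apply: (le_trans e3); rewrite mulrC ler_wpM2r//.
apply: le_trans (expR_ge1Dx _); rewrite lerD2l -mulrA [C2 * s]mulrC ler_wpM2l//.
Qed.
End Moments.

(** * Stability under diffusion and averaging *)

Section Diffusion.
Context {R : realType} {d : nat} (beta : R) (beta0 : 0 < beta).
Context (r : nat) (r1 : (1 <= r)%N).
Local Notation mR := (measurableTypeR R).
Local Notation mtuple w := (measurable_fun setT (fun t : d.-tuple mR => w (row_of_tuple t))).

(** The tangent at [M] dominates the weight on the whole interval. The derivatives of a controlled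
    function are therefore bounded, as differentiation under the average requires. *)
Lemma log_weight_bounded (M : R) : 0 < M -> exists2 H, 0 <= H & forall u, 0 < u -> u <= M ->
  log_weight r M u <= H.
Proof.
move=> M0; have [A HA] := log_weight_tangent r1 M0 (lexx M).
exists (log_weight r M M + `|A| * M); first by rewrite addr_ge0 ?log_weight_ge0// mulr_ge0// ltW.
move=> u u0 uM; apply: (le_trans (HA u u0 uM)); rewrite lerD2l.
rewrite (le_trans (ler_norm _))// normrM ler_wpM2l// distrC ger0_norm ?subr_ge0//.
by rewrite gerBl ltW.
Qed.

Lemma diffusion0 (g : 'rV[R]_d -> R) : diffusion beta 0 g = g.
Proof. by apply/funext => x; rewrite /diffusion eqxx. Qed.

Lemma diffusion_controlled m : exists2 K, 0 <= K & forall s M C c (g : 'rV[R]_d -> R),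
  0 <= s <= 1 -> 0 <= C -> 0 <= c -> controlled r m M C c g ->
  controlled r m M C (c * expR (K * s)) (diffusion beta s g).
Proof.
have [K K0 HK] := @gauss_avg_sqr1 R d beta beta0 m; exists K => // s M C c g /andP[s0' s1] C0 c0 gg.
(* At [s = 0] the diffusion is the identity by definition; the Gaussian argument needs [s > 0]. *)
move: s0'; rewrite le_eqVlt => /predU1P[<-|s0].
  by rewrite diffusion0 mulr0 expR0 mulr1.
have [[dg ddg] gM gc g1 g2] := gg.
have cg : continuous g by move=> x; exact: differentiable_continuous.
have g0 x : 0 <= g x by have /andP[/ltW] := gM x.
have mg : mtuple g by exact: continuous_measurable_tuple.
have M0 : 0 < M by have /andP[h1 h2] := gM 0; exact: lt_le_trans h2.
have [H H0 HH] := log_weight_bounded M0.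
have hH y : C * log_weight r M (g y) <= C * H by have /andP[? ?] := gM y; rewrite ler_wpM2l// HH.
pose B := M + C * H.
have CHB : C * H <= B by rewrite lerDr ltW.
have gB y : `|g y| <= B.
  have /andP[g00 gMy] := gM y; rewrite gtr0_norm// (le_trans gMy)// lerDl.
  by rewrite mulr_ge0.
have g1B k y : `|partial k g y| <= B by rewrite (le_trans (g1 k y))// (le_trans (hH y)).
have g2B i k y : `|partial i (partial k g) y| <= B by rewrite (le_trans (g2 i k y))// (le_trans (hH y)).
have fE : diffusion beta s g = fun x => gauss_avg beta s (fun z => g (x - z)).
  by apply/funext => x; rewrite diffusion_gav.
have [df pf] := gauss_avg_diff beta0 s0 dg gB g1B.
have dpf j := gauss_avg_diff beta0 s0 (ddg j) (g1B j) (fun i => g2B i j).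
have mgx y : mtuple (fun z => g (y - z)) by exact: measurable_refl_comp.
have ig y : gauss_int beta s (fun z => g (y - z)).
  by apply: (gauss_int_bounded beta0 s0 (mgx y) (K := B)).
have fM x : gauss_avg beta s (fun z => g (x - z)) <= M.
  rewrite -[leRHS](gauss_avg_cst beta0 s0 (d := d)); apply: gauss_avg_le => //; first exact: gauss_int_cst.
  by move=> z; have /andP[] := gM (x - z).
have flow x : expR (- (c * expR (K * s) * sqr1 x ^+ m)) <= gauss_avg beta s (fun z => g (x - z)).
  have [iV VK] := HK s x s0 s1.
  pose k := c * gauss_avg beta s (fun z => sqr1 (x - z) ^+ m).
  apply: (@le_trans _ _ (expR (- k))).
    by rewrite ler_expR lerN2 /k -mulrA ler_wpM2l.
  (* Tangent inequality for [exp] at [- k]. *)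
  have -> : expR (- k) = gauss_avg beta s (fun z => expR (- k) * ((1 + k) + (- c) * sqr1 (x - z) ^+ m)).
    have j1 := gauss_intZ (- c) iV.
    have j2 : gauss_int beta s (fun _ : 'rV[R]_d => 1 + k) by exact: gauss_int_cst.
    rewrite gauss_avgZ//; last exact: gauss_intD.
    by rewrite gauss_avgD// gauss_avgZ// gauss_avg_cst// /k mulNr addrK mulr1.
  apply: gauss_avg_le => //.
    by apply: gauss_intZ; apply: gauss_intD; [exact: gauss_int_cst|exact: gauss_intZ].
  move=> z; apply: le_trans (gc (x - z)).
  have -> : - (c * sqr1 (x - z) ^+ m) = - k + (k - c * sqr1 (x - z) ^+ m) by ring.
  rewrite expRD ler_wpM2l ?expR_ge0//; apply: le_trans (expR_ge1Dx _).
  by rewrite mulNr addrA.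
have f0 x : 0 < gauss_avg beta s (fun z => g (x - z)).
  by apply: lt_le_trans (flow x); exact: expR_gt0.
have jensen (w : 'rV[R]_d -> R) x : mtuple w -> (forall y, `|w y| <= C * log_weight r M (g y)) ->
    `|gauss_avg beta s (fun z => w (x - z))| <= C * log_weight r M (gauss_avg beta s (fun z => g (x - z))).
  move=> mw wh; set u0 := gauss_avg beta s (fun z => g (x - z)).
  (* Integrating the tangent inequality at [u0] kills the linear term. *)
  have [A HA] := log_weight_tangent r1 (f0 x) (fM x).
  have iA : gauss_int beta s (fun z => A * (g (x - z) + - u0)).
    by apply: gauss_intZ; apply: gauss_intD; [exact: ig|exact: gauss_int_cst].
  have iW : gauss_int beta s (fun z => C * (log_weight r M u0 + A * (g (x - z) + - u0))).
    by apply: gauss_intZ; apply: gauss_intD => //; exact: gauss_int_cst.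
  have -> : C * log_weight r M u0 = gauss_avg beta s (fun z => C * (log_weight r M u0 + A * (g (x - z) + - u0))).
    rewrite gauss_avgZ//; last by apply: gauss_intD => //; exact: gauss_int_cst.
    rewrite gauss_avgD//; last exact: gauss_int_cst.
    rewrite gauss_avg_cst// gauss_avgZ//; last by apply: gauss_intD; [exact: ig|exact: gauss_int_cst].
    rewrite gauss_avgD//; last exact: gauss_int_cst.
    by rewrite gauss_avg_cst// subrr mulr0 addr0.
  have wle z : `|w (x - z)| <= C * (log_weight r M u0 + A * (g (x - z) + - u0)).
    rewrite (le_trans (wh _))// ler_wpM2l//; have /andP[? ?] := gM (x - z); exact: HA.
  apply: gauss_avg_norm_le => //; apply: (gauss_int_le _ wle iW).
  exact: measurable_refl_comp.
rewrite fE; split.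
- by split => // i x; rewrite pf; case: (dpf i).
- by move=> x; rewrite f0 fM.
- exact: flow.
- by move=> i x; rewrite pf; apply: jensen => //; exact: partial_measurable.
- move=> i j x; rewrite pf; have [_ ->] := dpf j.
  by apply: jensen => //; exact: partial_measurable.
Qed.

Lemma average_controlled m M C c (f g : 'rV[R]_d -> R) : 0 <= C ->
  controlled r m M C c f -> controlled r m M C c g -> controlled r m M C c (fun x => 2^-1 * (f x + g x)).
Proof.
move=> C0 [[df ddf] fM fc f1 f2] [[dg ddg] gM gc g1 g2].
have half a b (K : R) : a <= K -> b <= K -> 2^-1 * (a + b) <= K by lra.
have avM x : 0 < 2^-1 * (f x + g x) <= M.
  have /andP[f0 fm] := fM x; have /andP[g0 gm] := gM x.
  by rewrite mulr_gt0 ?addr_gt0//=; apply: half.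
have hc x (a b : R) : `|a| <= C * log_weight r M (f x) -> `|b| <= C * log_weight r M (g x) ->
    `|2^-1 * (a + b)| <= C * log_weight r M (2^-1 * (f x + g x)).
  move=> aC bC; have /andP[v0 vM] := avM x.
  have /andP[f0 fm] := fM x; have /andP[g0 gm] := gM x.
  (* The tangent at the midpoint, evaluated at the two values and averaged, gives midpoint concavity
     since the linear terms cancel. *)
  have [A HA] := log_weight_tangent r1 v0 vM.
  have H1 := HA _ f0 fm; have H2 := HA _ g0 gm.
  set h := log_weight r M (2^-1 * _) in H1 H2 *.
  have H3 : 2^-1 * (log_weight r M (f x) + log_weight r M (g x)) <= h by move: H1 H2; lra.
  rewrite normrM ger0_norm ?invr_ge0// (le_trans _ (ler_wpM2l C0 H3))//.
  rewrite mulrCA ler_wpM2l ?invr_ge0// mulrDr (le_trans (ler_normD _ _))// lerD//.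
have p1 i : partial i (fun x => 2^-1 * (f x + g x)) = fun x => 2^-1 * (partial i f x + partial i g x).
  rewrite partialM//; last by move=> x; apply: differentiableD.
  by rewrite partialD// partial_cst; apply/funext => x; rewrite mul0r add0r.
have p2 i j : partial i (partial j (fun x => 2^-1 * (f x + g x))) =
    fun x => 2^-1 * (partial i (partial j f) x + partial i (partial j g) x).
  rewrite p1 partialM//; last by move=> x; apply: differentiableD.
  by rewrite partialD// partial_cst; apply/funext => x; rewrite mul0r add0r.
split.
- by apply: twice_diffM; [exact: twice_diff_cst|apply: twice_diffD].
- exact: avM.
- by move=> x; have := fc x; have := gc x; lra.
- by move=> i x; rewrite p1; apply: hc.
- by move=> i j x; rewrite p2; apply: hc.
Qed.
End Diffusion.

(** * Accumulation of the constants over the steps *)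

Section Iteration.
Context {R : realType} {d : nat} (beta : R) (phi : R -> 'rV[R]_d -> 'rV[R]_d).
Context (phi0 : forall x, phi 0 x = x).
Context (r m : nat) (r1 : (1 <= r)%N) (M C c : R) (C0 : 0 <= C) (c0 : 0 <= c) (M0 : 0 <= M).
Context (Ka Kd : R) (Ka0 : 0 <= Ka) (Kd0 : 0 <= Kd).
Context (Hadv : forall s M C c g, 0 <= s <= 1 -> 0 <= C -> 0 <= c -> controlled r m M C c g ->
  controlled r m (M * expR (Ka * s)) ((C + 1) * expR (Ka * s) - 1) ((c + 1) * expR (Ka * s) - 1)
    (advection phi s g)).
Context (Hdif : forall s M C c (g : 'rV[R]_d -> R),
  0 <= s <= 1 -> 0 <= C -> 0 <= c -> controlled r m M C c g ->
  controlled r m M C (c * expR (Kd * s)) (diffusion beta s g)).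

(** A single exponent drives all three constants, so composing operations amounts to adding
    exponents; at [th = 0] the initial constants are recovered. *)
Definition controlled_at (th : R) (f : 'rV[R]_d -> R) :=
  controlled r m (M * expR th) ((C + 1) * expR th - 1) ((c + 1) * expR th - 1) f.

Lemma controlled_at_coef_ge0 (a th : R) : 0 <= a -> 0 <= th -> 0 <= (a + 1) * expR th - 1.
Proof.
move=> a0 th0; rewrite subr_ge0 -[leLHS]mulr1 ler_pM// ?lerDr//.
by rewrite -expR0 ler_expR.
Qed.

Lemma controlled_at_mono th th' f : 0 <= th -> th <= th' -> controlled_at th f -> controlled_at th' f.
Proof.
move=> th0 tt; apply: controlled_mono => //.
- exact: controlled_at_coef_ge0.
- by rewrite ler_wpM2l// ler_expR.
- by rewrite lerD2r ler_wpM2l ?addr_ge0// ler_expR.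
- by rewrite lerD2r ler_wpM2l ?addr_ge0// ler_expR.
Qed.

Lemma controlled_at_advection s th f : 0 <= s <= 1 -> 0 <= th -> controlled_at th f ->
  controlled_at (th + Ka * s) (advection phi s f).
Proof.
move=> s01 th0 gf; have := Hadv s01 (controlled_at_coef_ge0 C0 th0) (controlled_at_coef_ge0 c0 th0) gf.
by rewrite !subrK /controlled_at expRD !mulrA.
Qed.

Lemma controlled_at_diffusion s th f : 0 <= s <= 1 -> 0 <= th -> controlled_at th f ->
  controlled_at (th + Kd * s) (diffusion beta s f).
Proof.
move=> s01 th0 gf; have /andP[s0 s1] := s01.
have k0 : 0 <= Kd * s by rewrite mulr_ge0.
have := Hdif s01 (controlled_at_coef_ge0 C0 th0) (controlled_at_coef_ge0 c0 th0) gf.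
have e1 : 1 <= expR (Kd * s) by rewrite -expR0 ler_expR.
apply: controlled_mono => //.
- exact: controlled_at_coef_ge0.
- by rewrite ler_wpM2l// ler_expR lerDl.
- by rewrite lerD2r ler_wpM2l ?addr_ge0// ler_expR lerDl.
- by rewrite mulrBl mul1r -mulrA -expRD lerB.
Qed.

Lemma controlled_at_step s th f : 0 <= s <= 1 -> 0 <= th -> controlled_at th f ->
  controlled_at (th + (Ka + Kd) * s) (averaged_step phi beta s f).
Proof.
move=> s01 th0 gf; have /andP[s0 s1] := s01.
have a0 : 0 <= Ka * s by rewrite mulr_ge0.
have d0 : 0 <= Kd * s by rewrite mulr_ge0.
have e1 : th + (Ka + Kd) * s = th + Kd * s + Ka * s by ring.
have e2 : th + (Ka + Kd) * s = th + Ka * s + Kd * s by ring.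
rewrite /averaged_step; apply: average_controlled => //.
- by apply: controlled_at_coef_ge0 => //; rewrite e1 !addr_ge0.
- rewrite e1; apply: controlled_at_advection => //; first by rewrite addr_ge0.
  exact: controlled_at_diffusion.
- rewrite e2; apply: controlled_at_diffusion => //; first by rewrite addr_ge0.
  exact: controlled_at_advection.
Qed.

Lemma controlled_at_law tau n f : 0 <= tau <= 1 -> controlled_at 0 f ->
  controlled_at ((Ka + Kd) * (n%:R * tau)) (rslmc_law phi beta tau f n).
Proof.
move=> t01 gf; have /andP[t0 t1] := t01; elim: n => [|n IH]; first by rewrite mul0r mulr0.
have -> : (Ka + Kd) * (n.+1%:R * tau) = (Ka + Kd) * (n%:R * tau) + (Ka + Kd) * tau.
  by rewrite -natr1; ring.
rewrite /rslmc_law iterS; apply: controlled_at_step => //.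
by rewrite mulr_ge0 ?addr_ge0// mulr_ge0.
Qed.

(** The [n] full steps and the last fraction of a step have total duration exactly [t], so the
    exponent is [(Ka + Kd) * t] whatever [tau] is. *)
Lemma controlled_at_density tau t T f : 0 < tau <= 1 -> 0 <= t <= T -> controlled_at 0 f ->
  controlled_at ((Ka + Kd) * T) (averaged_density phi beta tau f t).
Proof.
move=> /andP[t0 t1] /andP[t0' tT] gf; rewrite /averaged_density.
set n := Num.truncn _.
have K0 : 0 <= Ka + Kd by rewrite addr_ge0.
have /andP[n1 n2] : n%:R <= t / tau < n.+1%:R by apply: truncn_itv; rewrite divr_ge0// ltW.
have nt : n%:R * tau <= t by rewrite -ler_pdivlMr.
have s01 : 0 <= t - n%:R * tau <= 1.
  rewrite subr_ge0 nt/=; apply: le_trans t1.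
  rewrite lerBlDr; move: n2; rewrite ltr_pdivrMr// -natr1 mulrDl mul1r addrC => /ltW.
  by rewrite addrC.
have n0 : 0 <= (Ka + Kd) * (n%:R * tau) by rewrite mulr_ge0// mulr_ge0// ltW.
have t01 : 0 <= tau <= 1 by rewrite ltW.
have := controlled_at_step s01 n0 (controlled_at_law n t01 gf).
rewrite -mulrDr [n%:R * tau + _]addrC subrK; apply: controlled_at_mono; first by rewrite mulr_ge0.
by rewrite ler_wpM2l.
Qed.
End Iteration.

(** * Logarithmic derivatives *)

Section LogCalculus.
Context {R : realType} {d : nat}.
Implicit Types (f : 'rV[R]_d -> R) (x : 'rV[R]_d).

Lemma partial_scalar_comp (h : R -> R) (dh : R) f x i :
  differentiable f x -> is_derive (f x) 1 h dh ->
  differentiable (fun y => h (f y)) x /\ partial i (fun y => h (f y)) x = dh * partial i f x.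
Proof.
move=> df Hh; have dh1 : differentiable h (f x) by apply/derivable1_diffP; case: Hh.
split; first exact: (differentiable_comp df dh1).
rewrite /partial deriveE; last exact: (differentiable_comp df dh1).
rewrite (_ : (fun y => h (f y)) = h \o f)// diff_comp//= diff1E// derive1E.
have [_ ->] := Hh; rewrite deriveE// mulrC.
by rewrite /GRing.scale.
Qed.

Lemma log_partials f : twice_differentiable f -> (forall x, 0 < f x) ->
  [/\ twice_differentiable (fun y => ln (f y)),
    forall i x, partial i (fun y => ln (f y)) x = partial i f x / f x &
    forall i j x, partial i (partial j (fun y => ln (f y))) x =
      partial i (partial j f) x / f x - partial i f x / f x * (partial j f x / f x)].
Proof.
move=> [df ddf] f0.
have L x i := partial_scalar_comp i (df x) (is_derive1_ln (f0 x)).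
have I x i : differentiable (fun y => (f y)^-1) x /\
    partial i (fun y => (f y)^-1) x = - (f x) ^- 2 * partial i f x.
  have H : is_derive (f x) 1 (fun u : R => u^-1) (- (f x) ^- 2 *: 1).
    by apply: is_deriveV; rewrite gt_eqF.
  have := partial_scalar_comp i (df x) H.
  by rewrite /GRing.scale /= mulr1.
have dlog x : differentiable (fun y => ln (f y)) x.
  apply: (differentiable_comp (df x)); apply/derivable1_diffP.
  by case: (is_derive1_ln (f0 x)).
have dinv x : differentiable (fun y => (f y)^-1) x.
  apply: differentiableV => //; by rewrite gt_eqF.
have plog i : partial i (fun y => ln (f y)) = fun x => partial i f x * (f x)^-1.
  by apply/funext => x; have [_ ->] := L x i; rewrite mulrC.
split.
- split=> // i x; rewrite plog; exact: differentiableM.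
- by move=> i x; rewrite plog.
- move=> i j x; rewrite plog partialM//; have [_ ->] := I x i.
  by field; rewrite gt_eqF.
Qed.

Lemma enorm_ge0 x : 0 <= enorm x. Proof. exact: sqrtr_ge0. Qed.

Lemma coord_le_enorm x i : `|x 0 i| <= enorm x.
Proof.
rewrite -sqrtr_sqr /enorm ler_wsqrtr// (bigD1 i)//= lerDl.
by apply: sumr_ge0 => j _; exact: sqr_ge0.
Qed.

Lemma enorm_le_sum x : enorm x <= \sum_i `|x 0 i|.
Proof.
have S0 : 0 <= \sum_i `|x 0 i| by apply: sumr_ge0.
rewrite -[leRHS]ger0_norm// -sqrtr_sqr /enorm ler_wsqrtr//.
rewrite expr2 mulr_suml; apply: ler_sum => i _.
rewrite -[leLHS]real_normK ?num_real// expr2 ler_wpM2l//.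
by rewrite (bigD1 i)//= lerDl; apply: sumr_ge0.
Qed.

Lemma opnorm_le (A : 'M[R]_d) (B : R) : (forall i j, `|A i j| <= B) ->
  opnorm A <= d%:R * (d%:R * B).
Proof.
move=> AB; apply: ge_sup.
  by exists (enorm (0 *m A)), 0 => //=; rewrite /enorm big1 ?sqrtr0// => i _; rewrite mxE expr0n.
move=> _ [v /= v1 <-]; apply: (le_trans (enorm_le_sum _)).
apply: sum_le_const => j; rewrite mxE.
apply: (le_trans (ler_norm_sum _ _ _)); apply: sum_le_const => i.
rewrite normrM -[B]mul1r ler_pM// (le_trans _ v1)//; exact: coord_le_enorm.
Qed.

Lemma opnorm_ge (A : 'M[R]_d) i j : `|A i j| <= opnorm A.
Proof.
(* [opnorm] is a real-valued [sup]: boundedness must be established before it dominates the value at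
   a basis vector. *)
have ub : has_ubound [set enorm (v *m A) | v in [set v : 'rV[R]_d | enorm v <= 1]].
  exists (\sum_j0 \sum_i0 `|A i0 j0|) => _ [v /= v1 <-].
  apply: (le_trans (enorm_le_sum _)); apply: ler_sum => j0 _; rewrite mxE.
  apply: (le_trans (ler_norm_sum _ _ _)); apply: ler_sum => i0 _.
  rewrite normrM ler_piMl// (le_trans _ v1)//; exact: coord_le_enorm.
apply: (@le_trans _ _ (enorm (delta_mx 0 i *m A))).
  have := coord_le_enorm (delta_mx 0 i *m A) j; rewrite -rowE mxE; exact.
apply: ub_le_sup => //; exists (delta_mx 0 i) => //=.
rewrite /enorm (bigD1 i)//= big1 ?addr0 => [|k /negbTE ki]; last first.
  by rewrite mxE ki andbF expr0n.
by rewrite mxE !eqxx expr1n sqrtr1.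
Qed.

Lemma sqr1_enorm x : sqr1 x = 1 + enorm x ^+ 2.
Proof. by rewrite /enorm sqr_sqrtr//; apply: sumr_ge0 => i _; exact: sqr_ge0. Qed.

(** The lower bound on [f] makes [r - ln (f / M)] at most a multiple of [V = sqr1 x ^+ m], so
    dividing the derivative bounds by [f] leaves powers of [V]. Both [p] and [K] are fixed before
    [f], hence serve all times and step sizes at once. *)
Lemma controlled_log_bound (r m : nat) (M C c : R) : (1 <= r)%N -> 0 <= C -> 0 <= c ->
  exists p K : R, [/\ 0 < p, 0 < K & forall f, controlled r m M C c f ->
    (forall x, 0 < f x) /\ twice_differentiable (fun y => ln (f y)) /\
    forall x, `|ln (f x)| + enorm (grad (fun y => ln (f y)) x)
      + opnorm (hess (fun y => ln (f y)) x) <= K * (1 + enorm x) `^ p].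
Proof.
move=> r1 C0 c0.
pose B := r%:R + c + `|ln M|.
have B1 : 1 <= B by rewrite /B -addrA (le_trans (y := r%:R))// ?ler1n// lerDl addr_ge0.
have B0 : 0 <= B by apply: le_trans B1.
pose D := C * B ^+ r + (C * B ^+ r) ^+ 2.
have CB0 : 0 <= C * B ^+ r by rewrite mulr_ge0// exprn_ge0.
have D0 : 0 <= D by rewrite addr_ge0// sqr_ge0.
have dD : 0 <= d%:R * D by rewrite mulr_ge0.
have ddD : 0 <= d%:R * (d%:R * D) by rewrite mulr_ge0.
(* The product of two logarithmic derivatives costs [V ^+ (r + r)], and each [sqr1] is at most
   [(1 + enorm x) ^+ 2]. The exponent used is [n.+1], which is positive even if [m = 0]. *)
pose n := (2 * (m * (r + r)))%N.
exists (n.+1)%:R, (1 + B + d%:R * D + d%:R * (d%:R * D)); split; first by rewrite ltr0n.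
  by apply: ltr_wpDr => //; apply: ltr_wpDr => //; apply: ltr_wpDr.
move=> f [tf fM fc f1 f2].
have f0 x : 0 < f x by have /andP[] := fM x.
have [tl l1 l2] := log_partials tf f0.
split=> //; split=> // x.
set V := sqr1 x ^+ m.
have V1 : 1 <= V by rewrite exprn_ege1// sqr1_ge1.
have V0 : 0 <= V by apply: le_trans V1.
have /andP[fx0 fxM] := fM x.
have M0 : 0 < M by apply: lt_le_trans fxM.
have lnlow : - (c * V) <= ln (f x).
  by rewrite -ler_expR lnK ?posrE//; exact: fc.
have lnup : ln (f x) <= `|ln M| by apply: le_trans (ler_norm _); rewrite ler_ln ?posrE.
have cV : c <= c * V by rewrite ler_peMr.
have BV : r%:R + c * V + `|ln M| <= B * V.
  rewrite /B !mulrDl !lerD//; by rewrite ler_peMr.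
have r0 : 0 <= r%:R :> R by [].
have lnB : `|ln (f x)| <= B * V.
  rewrite ler_norml; apply/andP; split.
    by move: lnlow BV (normr_ge0 (ln M)) r0; lra.
  by have := mulr_ge0 c0 V0; move: lnup BV r0; lra.
have ell : r%:R - ln (f x / M) <= B * V.
  rewrite ln_div ?posrE//; have := ler_norm (ln M); move: lnlow BV; lra.
have ell1 : 1 <= r%:R - ln (f x / M) by exact: log_weight_arg1.
have hB : C * log_weight r M (f x) <= C * B ^+ r * V ^+ r * f x.
  rewrite /log_weight [f x * _]mulrC !mulrA ler_wpM2r ?(ltW fx0)// -mulrA ler_wpM2l//.
  by rewrite -exprMn lerXn2r ?nnegrE ?mulr_ge0// (le_trans ler01).
have VV : V ^+ r <= V ^+ (r + r) by rewrite ler_weXn2l// leq_addr.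
have Vrr : 1 <= V ^+ (r + r) by rewrite exprn_ege1.
have Vr1 : 1 <= V ^+ r by rewrite exprn_ege1.
have g1 i : `|partial i f x / f x| <= C * B ^+ r * V ^+ r.
  by rewrite normrM normfV (gtr0_norm fx0) ler_pdivrMr// (le_trans (f1 i x)).
have g2 i j : `|partial i (partial j f) x / f x| <= C * B ^+ r * V ^+ r.
  by rewrite normrM normfV (gtr0_norm fx0) ler_pdivrMr// (le_trans (f2 i j x)).
have V2 : 0 <= V ^+ (r + r) by apply: le_trans Vrr.
have b1 i : `|partial i (fun y => ln (f y)) x| <= D * V ^+ (r + r).
  rewrite l1 (le_trans (g1 i))// /D mulrDl -[leLHS]addr0 lerD//.
    by rewrite ler_wpM2l.
  by rewrite mulr_ge0// sqr_ge0.
have b2 i j : `|partial i (partial j (fun y => ln (f y))) x| <= D * V ^+ (r + r).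
  rewrite l2 (le_trans (ler_normB _ _))// /D mulrDl lerD//.
    by rewrite (le_trans (g2 i j))// ler_wpM2l.
  have -> : (C * B ^+ r) ^+ 2 * V ^+ (r + r) = (C * B ^+ r * V ^+ r) * (C * B ^+ r * V ^+ r).
    by rewrite exprD; ring.
  by rewrite normrM ler_pM.
have VE : V ^+ (r + r) <= (1 + enorm x) `^ n.+1%:R.
  have e0 := enorm_ge0 x.
  rewrite powR_mulrn ?addr_ge0// /V sqr1_enorm -exprM.
  have h : 1 + enorm x ^+ 2 <= (1 + enorm x) ^+ 2 by have := e0; lra.
  apply: (@le_trans _ _ (((1 + enorm x) ^+ 2) ^+ (m * (r + r)))).
    by rewrite lerXn2r ?nnegrE ?addr_ge0 ?sqr_ge0// exprn_ge0// addr_ge0.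
  by rewrite -exprM ler_weXn2l ?lerDl.
have VB : V <= V ^+ (r + r).
  rewrite -[leLHS]expr1 ler_weXn2l//; exact: leq_trans r1 (leq_addr _ _).
apply: (@le_trans _ _ ((1 + B + d%:R * D + d%:R * (d%:R * D)) * V ^+ (r + r))); last first.
  by rewrite ler_wpM2l// addr_ge0// addr_ge0// addr_ge0.
have t1 : `|ln (f x)| <= (1 + B) * V ^+ (r + r).
  apply: (le_trans lnB); rewrite ler_pM// lerDr//.
have t2 : enorm (grad (fun y => ln (f y)) x) <= d%:R * (D * V ^+ (r + r)).
  apply: (le_trans (enorm_le_sum _)); apply: sum_le_const => i; rewrite mxE; exact: b1.
have t3 : opnorm (hess (fun y => ln (f y)) x) <= d%:R * (d%:R * (D * V ^+ (r + r))).
  by apply: opnorm_le => i j; rewrite mxE; exact: b2.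
move: t1 t2 t3; set W := V ^+ _; rewrite !mulrA; lra.
Qed.
End LogCalculus.

(** * The initial density *)

Section PotentialGrowth.
Context {R : realType} {d : nat}.

Lemma enormZ (a : R) (x : 'rV[R]_d) : enorm (a *: x) = `|a| * enorm x.
Proof.
rewrite /enorm; under eq_bigr do rewrite mxE exprMn.
by rewrite -mulr_sumr sqrtrM ?sqr_ge0// sqrtr_sqr.
Qed.

(** Beyond [M0] two integrations of [k <= g2] give a quadratic lower bound, with initial slope at
    least [- G]; before [M0] the slope bound alone costs at most [G * M0]. *)
Lemma quadratic_growth (g g1 g2 : R -> R) (k M0 G t : R) : 0 < k -> 0 <= M0 ->
  (forall s : R, is_derive s 1 g (g1 s)) -> (forall s : R, is_derive s 1 g1 (g2 s)) ->
  (forall s, M0 <= s -> k <= g2 s) -> (forall s, 0 <= s -> s <= M0 -> - G <= g1 s) -> 0 <= G ->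
  0 <= t -> t <= g t - g 0 + G * M0 + M0 + (G + 1) ^+ 2 / (2 * k).
Proof.
move=> k0 M00 dg dg1 hk hG G0 t0.
have sq0 : 0 <= (G + 1) ^+ 2 / (2 * k) by rewrite divr_ge0 ?sqr_ge0// mulr_ge0// ltW.
have early s : 0 <= s -> s <= M0 -> - (G * M0) <= g s - g 0.
  move=> s0 sM.
  have := @nincr_oo R (fun u => - g u - G * u) (fun u => - g1 u - G) (s + 1) s 0.
  have s1 : `|s| < s + 1 by rewrite ger0_norm// ltrDl.
  have z1 : `|0 : R| < s + 1 by rewrite normr0 ltr_wpDl.
  move=> H; have {H} : - g s - G * s <= - g 0 - G * 0.
    apply: H => //.
      move=> u _; have Hd := dg u.
      by apply: is_derive_eq; rewrite /GRing.scale /=; ring.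
    by move=> u u0 us; have := hG u u0 (le_trans us sM); lra.
  have : G * s <= G * M0 by rewrite ler_wpM2l.
  lra.
have [tM|Mt] := leP t M0; first by have := early t t0 tM; lra.
have MtW := ltW Mt.
have H1 s : M0 <= s -> g1 M0 + k * (s - M0) <= g1 s.
  move=> Ms.
  have s0 : 0 <= s by apply: le_trans Ms.
  have := @nincr_oo R (fun u => k * u - g1 u) (fun u => k - g2 u) (s + 1) s M0.
  have s1 : `|s| < s + 1 by rewrite ger0_norm// ltrDl.
  have z1 : `|M0| < s + 1 by rewrite ger0_norm// (le_lt_trans Ms)// ltrDl.
  move=> H; have {H} : k * s - g1 s <= k * M0 - g1 M0.
    apply: H => //.
      move=> u _; have Hd := dg1 u.
      by apply: is_derive_eq; rewrite /GRing.scale /=; ring.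
    by move=> u u0 us; have := hk u u0; lra.
  lra.
have H2 : g M0 + g1 M0 * (t - M0) + k * (t - M0) ^+ 2 / 2 <= g t.
  have := @nincr_oo R (fun u => - g u + g1 M0 * u + k * (u - M0) ^+ 2 / 2)
    (fun u => - g1 u + g1 M0 + k * (u - M0)) (t + 1) t M0.
  have s1 : `|t| < t + 1 by rewrite ger0_norm// ltrDl.
  have z1 : `|M0| < t + 1 by rewrite ger0_norm// (le_lt_trans MtW)// ltrDl.
  move=> H; have {H} : - g t + g1 M0 * t + k * (t - M0) ^+ 2 / 2 <=
      - g M0 + g1 M0 * M0 + k * (M0 - M0) ^+ 2 / 2.
    apply: H => //.
      move=> u _; have Hd := dg u.
      by apply: is_derive_eq; rewrite /GRing.scale /=; field.
    by move=> u u0 us; have := H1 u u0; lra.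
  rewrite subrr expr0n /= mulr0 mul0r addr0; lra.
have e0 := early M0 M00 (lexx _).
have gM := hG M0 M00 (lexx _).
set y := t - M0 in H2; have y0 : 0 <= y by rewrite subr_ge0.
have h3 : - G * y <= g1 M0 * y by rewrite ler_wpM2r.
(* Completing the square: the slope [G + 1] compensates the initial slope [- G] and leaves growth of
   slope 1. *)
have h4 : (G + 1) * y <= k * y ^+ 2 / 2 + (G + 1) ^+ 2 / (2 * k).
  rewrite -subr_ge0.
  have -> : k * y ^+ 2 / 2 + (G + 1) ^+ 2 / (2 * k) - (G + 1) * y = (k * y - (G + 1)) ^+ 2 / (2 * k).
    by field; rewrite gt_eqF.
  by rewrite divr_ge0 ?sqr_ge0// mulr_ge0// ltW.
have tE : t = y + M0 by rewrite /y subrK.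
have h5 : (G + 1) * y = G * y + y by ring.
rewrite {1}tE; move: H2 h3 h4 e0; rewrite h5 mulNr; lra.
Qed.

(** [U] is restricted to the ray through [x]: the Lipschitz bound on [b] controls the slope inside
    the ball of radius [M0], and convexity takes over outside. *)
Lemma potential_growth (U : 'rV[R]_d -> R) (b : 'rV[R]_d -> 'rV[R]_d) :
  Ck 2 U -> b = (fun x => - grad U x) ->
  (exists M0 kappa : R, [/\ 0 < M0, 0 < kappa &
     forall x, M0 <= enorm x -> loewner_le (kappa%:M) (hess U x)]) ->
  (exists L : R, 0 < L /\ forall x y, enorm (b x - b y) <= L * enorm (x - y)) ->
  exists B : R, forall x, enorm x <= U x + B.
Proof.
move=> [dU cU] hb [M0 [k [M00 k0 hk]]] [L [L0 hL]].
have ddU i x : differentiable (partial i U) x by case: (cU i).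
pose m := \sum_k `|b 0 0 k|.
have m0 : 0 <= m by apply: sumr_ge0.
have bk x i : `|partial i U x| <= m + L * enorm x.
  have -> : partial i U x = - b x 0 i by rewrite hb !mxE opprK.
  rewrite normrN -[b x 0 i](subrK (b 0 0 i)) addrC (le_trans (ler_normD _ _))// lerD//.
    by rewrite /m (bigD1 i)//= lerDl; apply: sumr_ge0.
  have := hL x 0; rewrite subr0 => H; apply: le_trans H.
  by have := coord_le_enorm (b x - b 0) i; rewrite !mxE.
pose G := d%:R * (m + L * M0).
have G0 : 0 <= G by rewrite mulr_ge0// addr_ge0// mulr_ge0// ltW.
exists (- U 0 + G * M0 + M0 + (G + 1) ^+ 2 / (2 * k)) => x.
have [x0|xn0] := eqVneq (enorm x) 0.
  have xz : x = 0.
    apply/rowP => i; rewrite mxE; apply/eqP; rewrite -normr_le0 -x0.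
    exact: coord_le_enorm.
  rewrite x0 xz -!addrA addNKr; apply: addr_ge0; first by apply: mulr_ge0 => //; exact: ltW.
  apply: addr_ge0; first exact: ltW.
  by apply: divr_ge0; rewrite ?sqr_ge0// mulr_ge0// ltW.
pose e := (enorm x)^-1 *: x.
have e1 : enorm e = 1 by rewrite enormZ ger0_norm ?invr_ge0 ?enorm_ge0// mulVf.
have ei i : `|e 0 i| <= 1 by rewrite -e1 coord_le_enorm.
have se s : 0 <= s -> enorm (0 + s *: e) = s by move=> s0; rewrite add0r enormZ e1 mulr1 ger0_norm.
pose g s := U (0 + s *: e).
pose g1 s := \sum_i e 0 i * partial i U (0 + s *: e).
pose g2 s := \sum_i e 0 i * \sum_j e 0 j * partial j (partial i U) (0 + s *: e).
have gx : g (enorm x) = U x by rewrite /g add0r /e scalerA mulfV// scale1r.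
have g0 : g 0 = U 0 by rewrite /g scale0r addr0.
have := @quadratic_growth g g1 g2 k M0 G (enorm x) k0 (ltW M00).
rewrite gx g0 => H; rewrite -[X in U x + (X + _ + _ + _)]add0r !addrA addr0; apply: H => //.
- by move=> s; exact: is_derive_segment.
- move=> s; have -> : g1 = \sum_i (fun s => e 0 i * partial i U (0 + s *: e)).
    by apply/funext => u; rewrite fct_sumE.
  apply: is_derive_sum => i; have Hd := is_derive_segment (ddU i (0 + s *: e)).
  by apply: is_derive_eq; rewrite /GRing.scale /=; ring.
- move=> s Ms; have s0 : 0 <= s by apply: le_trans Ms; exact: ltW.
  have := hk (0 + s *: e); rewrite se// => /(_ Ms) /(_ e).
  have -> : (e *m k%:M *m e^T) 0 0 = k.
    rewrite mul_mx_scalar -scalemxAl mxE mxE.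
    under eq_bigr do rewrite [e^T _ _]mxE -expr2.
    have -> : \sum_j e 0 j ^+ 2 = enorm e ^+ 2.
      by rewrite /enorm sqr_sqrtr//; apply: sumr_ge0 => i _; exact: sqr_ge0.
    by rewrite e1 expr1n mulr1.
  suff -> : (e *m hess U (0 + s *: e) *m e^T) 0 0 = g2 s by [].
  rewrite mxE; apply: eq_bigr => i _; rewrite [e^T _ _]mxE mulrC; congr (_ * _).
  by rewrite mxE; apply: eq_bigr => j _; rewrite [hess _ _ _ _]mxE.
- move=> s s0 sM; rewrite lerNl; apply: le_trans (ler_norm _) _; rewrite normrN.
  apply: (le_trans (ler_norm_sum _ _ _)); apply: sum_le_const => i.
  rewrite normrM -[leRHS]mul1r ler_pM//; apply: (le_trans (bk _ _)).
  by rewrite se// lerD2l ler_wpM2l// ltW.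
- exact: enorm_ge0.
Qed.
End PotentialGrowth.

Section InitialDensity.
Context {R : realType} {d : nat}.

(** Bounds on derivatives of [ln rho0] become bounds on derivatives of [rho0] after multiplication
    by [rho0], provided that powers of [|x|] are dominated by powers of [r - ln (rho0 / M1)]. *)
Lemma initial_controlled (U rho0 : 'rV[R]_d -> R) (beta A0 A1 c0 delta p0 q C0 M1 B : R) :
  0 < beta -> (forall x, enorm x <= U x + B) ->
  (forall x, 0 < rho0 x) -> twice_differentiable rho0 ->
  0 < A0 -> 0 < A1 -> 0 < c0 -> 0 < delta -> 0 < p0 -> 0 < q -> 0 < C0 ->
  (sup_norm rho0 <= M1%:E)%E ->
  (forall x, A0 * expR (- c0 * enorm x `^ p0) <= rho0 x) ->
  (forall x, rho0 x <= A1 * expR (- delta * beta * U x)) ->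
  (forall x, enorm (grad (fun y => ln (rho0 y)) x) <= C0 * (1 - ln (rho0 x / M1))) ->
  (forall x, opnorm (hess (fun y => ln (rho0 y)) x) <= C0 * (1 + enorm x `^ q)) ->
  exists (r m : nat) (C c : R), [/\ (1 <= r)%N, 0 <= C, 0 <= c & controlled r m M1 C c rho0].
Proof.
move=> beta0 hU r0 tr hA0 hA1 hc0 hdelta hp0 hq hC0 hM1 hlow hup hgrad hhess.
have rM x : rho0 x <= M1.
  rewrite -lee_fin; apply: le_trans hM1.
  rewrite -[X in (X%:E <= _)%E]gtr0_norm//; apply: ereal_sup_ubound; by exists x.
have M10 : 0 < M1 by apply: lt_le_trans (r0 0) (rM 0).
(* [r >= q] converts [|x|^q] and [r >= 2] covers the product of two logarithmic derivatives;
   [m > p0] lets [sqr1 x ^+ m] dominate [|x|^p0]. *)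
pose r := (Num.truncn q).+2; pose m := (Num.truncn p0).+1.
have r1 : (1 <= r)%N by [].
have qr : q <= r%:R.
  by rewrite (le_trans (ltW (truncnS_gt _)))// ler_nat.
have p0m : p0 <= m%:R by rewrite ltW// truncnS_gt.
pose a := (delta * beta)^-1.
have a0 : 0 < a by rewrite invr_gt0 mulr_gt0.
pose Cx := 1 + a * (1 + `|ln A1| + `|ln M1|) + `|B|.
have Cx1 : 1 <= Cx by rewrite /Cx -addrA lerDl addr_ge0// mulr_ge0 ?(ltW a0)// !addr_ge0.
(* The summands serve the gradient, the Hessian of [ln rho0], and the product of two logarithmic
   derivatives. *)
pose C := C0 + (C0 * (1 + Cx ^+ r) + C0 ^+ 2).
have Cx0 : 0 <= Cx by apply: le_trans Cx1.
have C00 := ltW hC0.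
have Cxr : 0 <= Cx ^+ r by rewrite exprn_ge0.
have CC : C0 <= C.
  by rewrite lerDl addr_ge0 ?sqr_ge0// mulr_ge0// addr_ge0.
pose c := c0 + `|ln A0|.
exists r, m, C, c; split=> //.
- exact: le_trans CC.
- by rewrite addr_ge0// ltW.
have [tl l1 l2] := log_partials tr r0.
have ell x : 1 <= r%:R - ln (rho0 x / M1) by exact: log_weight_arg1.
have l1r x : 1 - ln (rho0 x / M1) <= r%:R - ln (rho0 x / M1).
  by rewrite lerD2r ler1n.
have gb i x : `|partial i rho0 x / rho0 x| <= C0 * (r%:R - ln (rho0 x / M1)).
  rewrite -l1; have := coord_le_enorm (grad (fun y => ln (rho0 y)) x) i; rewrite mxE => H.
  by rewrite (le_trans H)// (le_trans (hgrad x))// ler_wpM2l.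
(* The upper bound on [rho0] gives [delta beta U <= ln A1 - ln rho0], and [enorm x <= U x + B].
   Additive constants are multiplied by [l >= 1], which makes the estimate linear in [l]. *)
have xb x : 1 + enorm x <= Cx * (r%:R - ln (rho0 x / M1)).
  have e0 := ell x; set l := r%:R - _ in e0 *.
  have lE : ln (rho0 x) = r%:R - l + ln M1.
    by rewrite /l ln_div ?posrE//; ring.
  have h1 : delta * beta * U x <= ln A1 - ln (rho0 x).
    have : ln (rho0 x) <= ln (A1 * expR (- delta * beta * U x)).
      by rewrite ler_ln ?posrE ?mulr_gt0 ?expR_gt0.
    rewrite lnM ?posrE ?expR_gt0// expRK !mulNr; lra.
  have h2 : U x <= a * (l + `|ln A1| + `|ln M1|).
    rewrite /a ler_pdivlMl ?mulr_gt0//; apply: (le_trans h1); rewrite lE.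
    have := ler_norm (ln A1); have := ler_norm (- ln M1); rewrite normrN.
    have : 0 <= r%:R :> R by []; lra.
  have h3 : `|ln A1| <= `|ln A1| * l by rewrite ler_peMr.
  have h4 : `|ln M1| <= `|ln M1| * l by rewrite ler_peMr.
  have h5 : `|B| <= `|B| * l by rewrite ler_peMr.
  have h6 : a * (l + `|ln A1| + `|ln M1|) <= a * (1 + `|ln A1| + `|ln M1|) * l.
    rewrite -mulrA ler_wpM2l ?(ltW a0)//; lra.
  have := hU x; have := ler_norm B; rewrite /Cx; lra.
have xq x : 1 + enorm x `^ q <= (1 + Cx ^+ r) * (r%:R - ln (rho0 x / M1)) ^+ r.
  have e0 := ell x; have e1 := xb x; set l := r%:R - _ in e0 e1 *.
  rewrite mulrDl mul1r lerD//; first by rewrite exprn_ege1.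
  rewrite -exprMn; apply: (@le_trans _ _ ((1 + enorm x) `^ q)).
    by rewrite ge0_ler_powR ?nnegrE ?enorm_ge0 ?addr_ge0 ?enorm_ge0 ?(ltW hq)// lerDr.
  apply: (@le_trans _ _ ((1 + enorm x) `^ r%:R)).
    by rewrite ler_powR// lerDl enorm_ge0.
  rewrite powR_mulrn ?addr_ge0 ?enorm_ge0//.
  by rewrite lerXn2r ?nnegrE ?addr_ge0 ?enorm_ge0// mulr_ge0// (le_trans ler01).
split => //.
- by move=> x; rewrite r0 rM.
- move=> x; apply: le_trans (hlow x).
  have -> : A0 * expR (- c0 * enorm x `^ p0) = expR (ln A0 - c0 * enorm x `^ p0).
    by rewrite expRD lnK ?posrE// mulNr.
  rewrite ler_expR.
  have V1 : 1 <= sqr1 x by exact: sqr1_ge1.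
  have eV : enorm x `^ p0 <= sqr1 x ^+ m.
    have es : enorm x <= sqr1 x.
      by rewrite sqr1_enorm; have := sqr_ge0 (enorm x - 1); have := sqr_ge0 (enorm x); lra.
    apply: (@le_trans _ _ (sqr1 x `^ p0)).
      by rewrite ge0_ler_powR ?nnegrE ?enorm_ge0 ?(ltW hp0)// (le_trans ler01).
    rewrite -powR_mulrn ?(le_trans ler01)//.
    by rewrite ler_powR.
  have Vm : 1 <= sqr1 x ^+ m by rewrite exprn_ege1.
  have h1 := ler_wpM2l (ltW hc0) eV.
  have h2 : `|ln A0| <= `|ln A0| * sqr1 x ^+ m by rewrite ler_peMr.
  have := ler_norm (- ln A0); rewrite normrN /c mulrDl; lra.
- move=> i x; have e0 := ell x; set l := r%:R - _ in e0.
  have rx := r0 x; have rn : rho0 x != 0 by rewrite gt_eqF.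
  rewrite -[partial i rho0 x](divfK rn) normrM (gtr0_norm rx) /log_weight -/l.
  rewrite [rho0 x * _]mulrC mulrA ler_wpM2r ?(ltW rx)// (le_trans (gb i x))//.
  have l0 : 0 <= l by apply: le_trans e0.
  have ll : l <= l ^+ r by rewrite -[leLHS]expr1; apply: ler_weXn2l.
  by rewrite -/l; apply: ler_pM.
- move=> i j x; have e0 := ell x; have rx := r0 x; have rn : rho0 x != 0 by rewrite gt_eqF.
  have g1 := gb i x; have g2 := gb j x; have xq1 := xq x; set l := r%:R - _ in e0 g1 g2 xq1.
  have l0 : 0 <= l by apply: le_trans e0.
  have E : partial i (partial j rho0) x / rho0 x =
    partial i (partial j (fun y => ln (rho0 y))) x + partial i rho0 x / rho0 x * (partial j rho0 x / rho0 x).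
    by rewrite l2 subrK.
  have Hb : `|partial i (partial j rho0) x / rho0 x| <= C * l ^+ r.
    rewrite E (le_trans (ler_normD _ _))//.
    apply: (@le_trans _ _ (C0 * ((1 + Cx ^+ r) * l ^+ r) + C0 ^+ 2 * l ^+ r)).
      apply: lerD.
        have := opnorm_ge (hess (fun y => ln (rho0 y)) x) i j; rewrite mxE => H.
        by rewrite (le_trans H)// (le_trans (hhess x))// ler_wpM2l.
      rewrite normrM (le_trans (ler_pM _ _ g1 g2))//.
      have -> : C0 * l * (C0 * l) = C0 ^+ 2 * l ^+ 2 by ring.
      by rewrite ler_wpM2l ?sqr_ge0// ler_weXn2l.
    rewrite mulrA -mulrDl ler_wpM2r ?exprn_ge0// lerDr//.
  rewrite /log_weight -/l -[partial i (partial j rho0) x](divfK rn) normrM (gtr0_norm rx).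
  by rewrite [rho0 x * _]mulrC mulrA ler_wpM2r ?(ltW rx).
Qed.
End InitialDensity.

(** * Derivative bounds for the drift *)

Section Drift.
Context {R : realType} {d : nat}.

Lemma Ck_opp k (f : 'rV[R]_d -> R) : Ck k f -> Ck k (fun x => - f x).
Proof.
elim: k f => [|k IH] f /=; first by move=> cf x; apply: continuousN; exact: cf.
move=> [df cf]; split=> [x|i]; first exact: differentiableN.
have -> : partial i (fun x => - f x) = fun x => - partial i f x.
  by apply/funext => x; rewrite /partial deriveN//; exact: diff_derivable.
exact: IH.
Qed.

Lemma Ck_pred k (f : 'rV[R]_d -> R) : Ck k.+1 f -> Ck k f.
Proof.
elim: k f => [|k IH] f; first by move=> [df _] x; exact: differentiable_continuous.
by move=> [df cf]; split=> // i; apply: IH; exact: cf.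
Qed.

(** The first-order expansion is tested on a multiple of a basis vector, of Euclidean length [eta],
    and its relative error [e] is arbitrary. *)
Lemma partial_lip (f : 'rV[R]_d -> R) (L : R) x j : differentiable f x ->
  (forall y, `|f y - f x| <= L * enorm (y - x)) -> `|partial j f x| <= L.
Proof.
move=> df H; apply/ler_addgt0Pr => e e0.
have [eta eta0 He] := has_gradP df e0.
pose v : 'rV[R]_d := eta *: delta_mx 0 j.
have vE : enorm v = eta.
  rewrite enormZ gtr0_norm// [X in _ * X](_ : _ = 1) ?mulr1//.
  rewrite /enorm (bigD1 j)//= big1 ?addr0 => [|k /negbTE kj]; rewrite !mxE ?eqxx ?expr1n ?sqrtr1//.
  by rewrite kj andbF expr0n.
have vn : `|v| <= eta.
  by rewrite -vE; apply: norm_le_coord => [|k]; [exact: enorm_ge0|exact: coord_le_enorm].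
have sv : \sum_i v 0 i * partial i f x = eta * partial j f x.
  rewrite (bigD1 j)//= big1 ?addr0 => [|i /negbTE ij]; rewrite !mxE ?eqxx ?mulr1//.
  by rewrite ij andbF mulr0 mul0r.
have h1 := He v vn; rewrite sv in h1.
have h2 := H (x + v); rewrite addrAC subrr add0r vE in h2.
rewrite -(ler_pM2l eta0) -{1}(gtr0_norm eta0) -normrM.
have -> : eta * partial j f x = (f (x + v) - f x) - (f (x + v) - f x - eta * partial j f x) by ring.
rewrite (le_trans (ler_normB _ _))// mulrDr lerD//; first by rewrite mulrC.
by rewrite (le_trans h1)// mulrC ler_wpM2r// ltW.
Qed.

Lemma fin_bounded (T : finType) (X : Type) (w : T -> X -> R) :
  (forall p, exists K, forall x, `|w p x| <= K) -> exists K, forall p x, `|w p x| <= K.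
Proof.
move=> /choice[K HK]; exists (\sum_p `|K p|) => p x.
rewrite (le_trans (HK p x))// (le_trans (ler_norm _))// (bigD1 p)//= lerDl.
exact: sumr_ge0.
Qed.
End Drift.

(** * Bounds on the interpolated density, uniform in the step size *)

Theorem theorem4p2 (R : realType) (d : nat) (hd : (1 <= d)%N)
  (beta : R) (hbeta : 0 < beta)
  (U : 'rV[R]_d -> R) (hU : Ck 4 U)
  (b : 'rV[R]_d -> 'rV[R]_d) (hb : b = (fun x => - grad U x))
  (hconvex : exists M0 kappa : R, [/\ 0 < M0, 0 < kappa &
     forall x, M0 <= enorm x -> loewner_le (kappa%:M) (hess U x)])
  (hlip : exists L : R, 0 < L /\
     forall x y, enorm (b x - b y) <= L * enorm (x - y))
  (hb2 : forall i j k : 'I_d, exists K : R, forall x,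
     `|partial i (partial j (fun y => b y 0 k)) x| <= K)
  (hb3 : forall i j l k : 'I_d, exists K : R, forall x,
     `|partial i (partial j (partial l (fun y => b y 0 k))) x| <= K)
  (phi : R -> 'rV[R]_d -> 'rV[R]_d) (hphi : is_flow b phi)
  (rho0 : 'rV[R]_d -> R) (hrho0 : probability_density rho0)
  (hrho0_pos : forall x, 0 < rho0 x) (hrho0_diff : twice_differentiable rho0)
  (A0 A1 c0 delta p0 q C0 M1 : R)
  (hA0 : 0 < A0) (hA1 : 0 < A1) (hc0 : 0 < c0) (hdelta : 0 < delta)
  (hp0 : 0 < p0) (hq : 0 < q) (hC0 : 0 < C0)
  (hM1 : (sup_norm rho0 <= M1%:E)%E)
  (hlower : forall x, A0 * expR (- c0 * enorm x `^ p0) <= rho0 x)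
  (hupper : forall x, rho0 x <= A1 * expR (- delta * beta * U x))
  (hgrad : forall x,
     enorm (grad (fun y => ln (rho0 y)) x) <= C0 * (1 - ln (rho0 x / M1)))
  (hhess : forall x,
     opnorm (hess (fun y => ln (rho0 y)) x) <= C0 * (1 + enorm x `^ q)) :
  forall T : R, 0 < T ->
  exists p C : R, [/\ 0 < p, 0 < C &
    forall tau : R, 0 < tau <= 1 ->
    let rho := averaged_density phi beta tau rho0 in
    (forall t, 0 <= t <= T ->
       (forall x, 0 < rho t x) /\
       twice_differentiable (fun y => ln (rho t y))) /\
    (forall x,
       (ereal_sup [set (`|ln (rho t x)|
                        + enorm (grad (fun y => ln (rho t y)) x)
                        + opnorm (hess (fun y => ln (rho t y)) x))%R%:E
                  | t in [set t : R | (0 <= t <= T)%R]]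
        <= (C * (1 + enorm x) `^ p)%R%:E)%E)].
Proof.
have bE k : coordf b k = fun y => - partial k U y.
  by apply/funext => y; rewrite /coordf hb !mxE.
have cb k : Ck 3 (coordf b k).
  by rewrite bE; apply: Ck_opp; case: hU => _; apply.
have [L [L0 hL]] := hlip.
have dbc k x : differentiable (coordf b k) x by case: (cb k).
have hB1 j k x : `|partial j (coordf b k) x| <= L.
  apply: partial_lip => // y; apply: le_trans (hL y x).
  by have := coord_le_enorm (b y - b x) k; rewrite !mxE.
have [B2 hB2] := @fin_bounded R ('I_d * 'I_d * 'I_d)%type _
  (fun p => partial p.1.1 (partial p.1.2 (coordf b p.2))) (fun p => hb2 p.1.1 p.1.2 p.2).
have [B3 hB3] := @fin_bounded R ('I_d * 'I_d * 'I_d * 'I_d)%type _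
  (fun p => partial p.1.1.1 (partial p.1.1.2 (partial p.1.2 (coordf b p.2))))
  (fun p => hb3 p.1.1.1 p.1.1.2 p.1.2 p.2).
have L0' := ltW L0.
have [Y [Yode Y0 Yjet Yphi]] := flow_jet hphi cb hB1 (fun i j k => hB2 (i, j, k))
  (fun i j l k => hB3 (i, j, l, k)) L0'.
have Jjet := flow_jac_jet Yjet Yphi.
have [K1 K10 Jexp] := flow_jac_exp L0' hB1 Yode Y0 Yjet Yphi.
have [K2 K20 Vexp] := flow_sqr1 hphi L0' hB1 dbc.
have U2 : Ck 2 U by do 2 apply: Ck_pred.
have [B hBU] := potential_growth U2 hb hconvex hlip.
have [r [m [C [c [r1 C00 c00 g0]]]]] := initial_controlled hbeta hBU hrho0_pos hrho0_diff
  hA0 hA1 hc0 hdelta hp0 hq hC0 hM1 hlower hupper hgrad hhess.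
have [Ka Ka0 Hadv] := advection_controlled Yjet Yphi Jjet K10 Jexp K20 Vexp m r1.
have [Kd Kd0 Hdif] := @diffusion_controlled R d beta hbeta r r1 m.
have M10 : 0 <= M1 by have [_ rM _ _ _] := g0; have /andP[/ltW + /(le_trans _)] := rM 0; move=> h; apply.
have g00 : controlled_at r m M1 C c 0 rho0 by rewrite /controlled_at expR0 !mulr1 !addrK.
move=> T T0; pose th := (Ka + Kd) * T.
have th0 : 0 <= th by rewrite mulr_ge0 ?addr_ge0// ltW.
(* The exponent and the constant are read off the class reached at time [T], before [tau] is
   introduced. *)
have [p [K [p_gt0 K0 HK]]] := @controlled_log_bound R d r m (M1 * expR th) _ _ r1
  (controlled_at_coef_ge0 C00 th0) (controlled_at_coef_ge0 c00 th0).
exists p, K; split => // tau tau01 rho.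
have key t : 0 <= t <= T -> controlled_at r m M1 C c th (rho t).
  by move=> tT; apply: (controlled_at_density r1 C00 c00 M10 Ka0 Kd0 Hadv Hdif tau01 tT g00).
split=> [t /key/HK[rpos [rdiff _]]|x]; first by split.
apply: ge_ereal_sup => _ [t /= tT <-]; rewrite lee_fin.
by have [_ [_]] := HK _ (key t tT); apply.
Qed.
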